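(* Let $X$ be a Banach space with a conditional spreading basis $(e_i)_i$ and let $(z_i)_i$ be its convex block homogeneous part. Let $(x_i)_i$ be a non-trivial weak Cauchy sequence in $X$. Then $(x_i)_i$ has a convex block sequence $(w_i)_i$ that is either equivalent to the summing basis of $c_0$ or equivalent to $(z_i)_i$. Furthermore, the closed linear span of $(w_i)_i$ is complemented in $X$.
   Context: Banach spaces are real. Two sequences are equivalent if the norms of their finite linear combinations with the same coefficients are comparable up to uniform positive constants. A sequence is spreading (resp. 1-spreading) if it is equivalent (resp. isometrically equivalent) to all of its subsequences. A conditional spreading basis is a Schauder basis that is spreading and not unconditional. A sequence is non-trivial weak Cauchy if it is weak Cauchy and not weakly convergent. The summing basis of $c_0$ is the sequence of vectors $\sum_{j=1}^n\delta_j$, $n\in\mathbb{N}$, where $(\delta_j)_j$ is the unit vector basis of $c_0$. A convex block sequence of $(x_i)_i$ is a sequence $(w_k)_k$ with $w_k=\sum_{i\in F_k}c_ix_i$, where $F_1<F_2<\cdots$ are successive finite subsets of $\mathbb{N}$, $c_i\geqslant0$ and $\sum_{i\in F_k}c_i=1$. Convex block homogeneous part: let $(e_i)_i$ be a conditional spreading basis of $X$. After passing to an equivalent norm on $X$ with respect to which $(e_i)_i$ is 1-spreading (such a norm exists), let $Z$ be the completion of $c_{00}(\mathbb{N})$, with unit vector basis denoted $(z_i)_i$, under the norm $$\Big\|\sum_{i=1}^na_iz_i\Big\|=\lim_{N\to\infty}\Big\|\sum_{i=1}^na_i\Big(\frac1N\sum_{j=(i-1)N+1}^{iN}e_j\Big)\Big\|=\inf\Big\{\Big\|\sum_{i=1}^na_iw_i\Big\|:(w_i)_{i=1}^n\text{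 is a convex block sequence of }(e_i)_i\Big\}.$$ The sequence $(z_i)_i$, which is well defined up to equivalence, is the convex block homogeneous part of $(e_i)_i$. *)

(* Defs.v *)
(* All sequences are indexed from 0. *)
From HB Require Import structures.
From mathcomp Require Import all_boot all_order all_algebra.
From mathcomp Require Import finmap.
From mathcomp Require Import all_classical all_reals all_analysis.

Set Implicit Arguments.
Unset Strict Implicit.
Unset Printing Implicit Defensive.

Import Order.TTheory GRing.Theory Num.Theory.
Import numFieldNormedType.Exports.

Local Open Scope classical_set_scope.
Local Open Scope ring_scope.

Definition lincomb (R : realType) (V : lmodType R) (n : nat) (a : nat -> R)
    (x : nat -> V) : V :=
  \sum_(i < n) a i *: x i.

(* The norms are explicit arguments, so that these notions also apply to a
   renorming of a Banach space and to the sup norm on real sequences. *)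
Definition seq_equiv_for (R : realType) (V W : lmodType R)
    (p : V -> R) (q : W -> R) (x : nat -> V) (y : nat -> W) : Prop :=
  exists c C : R, [/\ 0 < c, 0 < C & forall (n : nat) (a : nat -> R),
    c * q (lincomb n a y) <= p (lincomb n a x) <= C * q (lincomb n a y)].

Definition seq_isometric_for (R : realType) (V W : lmodType R)
    (p : V -> R) (q : W -> R) (x : nat -> V) (y : nat -> W) : Prop :=
  forall (n : nat) (a : nat -> R), p (lincomb n a x) = q (lincomb n a y).

Definition seq_equiv (R : realType) (V W : normedModType R)
    (x : nat -> V) (y : nat -> W) : Prop :=
  seq_equiv_for (fun v : V => `|v|) (fun v : W => `|v|) x y.

Definition spreading (R : realType) (V : normedModType R)
    (x : nat -> V) : Prop :=
  forall phi : nat -> nat, increasing_seq phi -> seq_equiv x (x \o phi).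

Definition one_spreading_for (R : realType) (V : lmodType R)
    (p : V -> R) (x : nat -> V) : Prop :=
  forall phi : nat -> nat, increasing_seq phi ->
    seq_isometric_for p p x (x \o phi).

Definition schauder_basis (R : realType) (X : normedModType R)
    (e : nat -> X) : Prop :=
  forall v : X, exists! a : nat -> R,
    series (fun i => a i *: e i) @ \oo --> v.

Definition unconditional_basis (R : realType) (X : normedModType R)
    (e : nat -> X) : Prop :=
  schauder_basis e /\
  forall (a : nat -> R), cvgn (series (fun i => a i *: e i)) ->
  forall s : nat -> nat, bijective s ->
    cvgn (series (fun i => a (s i) *: e (s i))).

Definition conditional_spreading_basis (R : realType) (X : normedModType R)
    (e : nat -> X) : Prop :=
  [/\ schauder_basis e, spreading e & ~ unconditional_basis e].

Definition weakly_cvg (R : realType) (X : normedModType R)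
    (x : nat -> X) (v : X) : Prop :=
  forall f : {linear X -> R^o}, continuous f -> f \o x @ \oo --> f v.

Definition weakly_cauchy (R : realType) (X : normedModType R)
    (x : nat -> X) : Prop :=
  forall f : {linear X -> R^o}, continuous f -> cvgn (f \o x).

Definition nontrivial_weak_cauchy (R : realType) (X : normedModType R)
    (x : nat -> X) : Prop :=
  weakly_cauchy x /\ ~ exists v : X, weakly_cvg x v.

(* The sets F k are automatically nonempty, since the coefficients indexed by
   F k add up to 1; hence comparing consecutive sets suffices. *)
Definition convex_block_sequence (R : realType) (V : lmodType R)
    (x w : nat -> V) : Prop :=
  exists (F : nat -> {fset nat}) (c : nat -> R),
    (forall k i j, i \in F k -> j \in F k.+1 -> (i < j)%N) /\
    forall k, [/\ forall i, i \in F k -> 0 <= c i,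
                  \sum_(i <- F k) c i = 1
                & w k = \sum_(i <- F k) c i *: x i].

Definition equivalent_norm (R : realType) (X : normedModType R)
    (p : X -> R) : Prop :=
  [/\ forall u v : X, p (u + v) <= p u + p v,
      forall (t : R) (v : X), p (t *: v) = `|t| * p v
    & exists c C : R, [/\ 0 < c, 0 < C &
        forall v : X, c * `|v| <= p v <= C * `|v|]].

Definition closed_span (R : realType) (X : normedModType R)
    (x : nat -> X) : set X :=
  closure [set v | exists (n : nat) (a : nat -> R), v = lincomb n a x].

Definition block_average (R : realType) (V : lmodType R)
    (e : nat -> V) (N i : nat) : V :=
  N%:R^-1 *: \sum_(i * N <= j < i.+1 * N) e j.

(* (Z, z) is a realization of the completion of c_00 with its unit vector basis,
   for the norm given by the averages of e in some equivalent 1-spreading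
   norm p. *)
Definition convex_block_homogeneous_part (R : realType)
    (X : normedModType R) (e : nat -> X)
    (Z : completeNormedModType R) (z : nat -> Z) : Prop :=
  closed_span z = setT /\
  exists p : X -> R, [/\ equivalent_norm p, one_spreading_for p e &
    forall (n : nat) (a : nat -> R),
      (fun N => p (lincomb n a (block_average e N))) @ \oo
        --> `|lincomb n a z|].

(* Only finitely supported vectors of c_0 matter for the summing basis, so c_0
   is represented inside the space of all real sequences by its sup norm. *)
Definition c0_norm (R : realType) (u : nat -> R^o) : R :=
  sup (range (fun k => `|u k|)).

Definition c0_unit (R : realType) (j : nat) : nat -> R^o :=
  fun k => (k == j)%:R.

Definition summing_basis (R : realType) (n : nat) : nat -> R^o :=
  \sum_(j < n.+1) c0_unit R j.

Definition equiv_summing_basis (R : realType) (X : normedModType R)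
    (w : nat -> X) : Prop :=
  seq_equiv_for (fun v : X => `|v|) (@c0_norm R) w (summing_basis R).

Definition complemented (R : realType) (X : normedModType R)
    (Y : set X) : Prop :=
  exists P : {linear X -> X},
    [/\ continuous P, forall v : X, P (P v) = P v & range P = Y].

(* Main.v *)
(* Work in an equivalent 1-spreading norm. Conditionality gives K such that, for finite
   combinations u < v of the basis, the sum functional at u and v and the norms of u and v
   are at most K times the norm of u + v. Let a_j be the limit of the j-th coordinate of x_i
   and Y_n = sum_(j < n) a_j e_j. A subsequence of x is, up to 2^-k, of the form Y_(n_k) + r_k
   with r_k supported in [n_k, n_(k+1)[, and the coordinate sums of Y_(n_k) and r_k converge
   to some sg and t. Split r_k as its coordinate sum times e_(n_k) plus a block of sum zero.
   Convex combinations of the zero-sum blocks can be made small: otherwise they would span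
   l_1, and a functional alternating in sign on them would contradict weak Cauchyness. Linear
   combinations of the Y_(n_k) are controlled by the tail sums of the coefficients. So, for
   suitable convex blocks w_j:
   - if t <> 0, the part t e_(n_k) dominates and w is equivalent to z; the increments of the
     sum functional along the blocks give the coefficients of a projection onto [w];
   - if t = 0 and (Y_(n_k)) is not Cauchy, then w behaves as (Y_(n_k)), hence as the summing
     basis, and functionals norming increments of (Y_(n_k)) give a projection onto [w];
   - if t = 0 and Y_(n_k) converges to y, then x converges weakly to y, which is excluded. *)
Require Import Defs.
From HB Require Import structures.
From mathcomp Require Import all_boot all_order all_algebra.
From mathcomp Require Import finmap.
From mathcomp Require Import all_classical all_reals all_analysis.
From mathcomp Require Import ring lra zify.

Set Implicit Arguments.
Unset Strict Implicit.
Unset Printing Implicit Defensive.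

Import Order.TTheory GRing.Theory Num.Theory.
Import numFieldNormedType.Exports.

Local Open Scope classical_set_scope.
Local Open Scope ring_scope.

(** * Spreading seminorms on finite combinations *)

(** The engine is a substitute for unconditionality. Spreading opens a gap around a block of sum
    zero; averaging the block over its translates in the gap telescopes to boundary terms divided by
    the number of translates, so deleting the block does not increase the norm. This gives
    multipliers on zero-sum blocks, hence the [l_1] alternatives. The constant [K] comes from two
    facts. If the averages of the basis tended to 0, every block could be deleted and the basis
    would be unconditional. If adjacent long averages approached each other, the averages would
    converge to a shift-invariant vector, which is 0. The partial sums [Y_n] are bounded but need
    not converge, so they are handled only through tail sums of coefficients, the coordinates of the
    summing basis. Comparison with [z] from above uses that the norm of [q] exceeds its homogeneous
    norm by at most the norm of the same combination of the differences e_(2i) - e_(2i+1). The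
    convex blocks must therefore also be small on these differences, which is possible because their
    averages tend to 0. The functionals found are biorthogonal to the blocks only up to small
    errors, so the projection is obtained by a Neumann series. *)

Definition seminorm (R : realType) (V : lmodType R) (p : V -> R) : Prop :=
  (forall u v, p (u + v) <= p u + p v) /\
  (forall (t : R) v, p (t *: v) = `|t| * p v).

Section SeminormTheory.
Variables (R : realType) (V : lmodType R) (p : V -> R).
Hypothesis hp : seminorm p.

Lemma semiD u v : p (u + v) <= p u + p v. Proof. exact: hp.1. Qed.

Lemma semiZ t v : p (t *: v) = `|t| * p v. Proof. exact: hp.2. Qed.

Lemma semi0 : p 0 = 0.
Proof. by rewrite -(scale0r (0 : V)) semiZ normr0 mul0r. Qed.

Lemma semiN v : p (- v) = p v.
Proof. by rewrite -scaleN1r semiZ normrN1 mul1r. Qed.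

Lemma semi_ge0 v : 0 <= p v.
Proof. by have := semiD v (- v); rewrite subrr semi0 semiN -mulr2n pmulrn_lge0. Qed.

Lemma semiB u v : p (u - v) <= p u + p v.
Proof. by rewrite (le_trans (semiD _ _))// semiN. Qed.

Lemma semi_distC u v : p (u - v) = p (v - u).
Proof. by rewrite -semiN opprB. Qed.

Lemma semi_le_dist u v : p u <= p v + p (u - v).
Proof. by rewrite -{1}(subrK v u) addrC; exact: semiD. Qed.

Lemma semi_sum (I : Type) (r : seq I) (P : pred I) (F : I -> V) :
  p (\sum_(i <- r | P i) F i) <= \sum_(i <- r | P i) p (F i).
Proof.
elim/big_ind2: _ => [|u a v b ua vb|//]; first by rewrite semi0.
by rewrite (le_trans (semiD _ _))// lerD.
Qed.

Lemma semi_sum_le (I : Type) (r : seq I) (P : pred I) (F : I -> V) (b : I -> R) :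
  (forall i, P i -> p (F i) <= b i) ->
  p (\sum_(i <- r | P i) F i) <= \sum_(i <- r | P i) b i.
Proof. by move=> Fb; rewrite (le_trans (semi_sum _ _ _))// ler_sum. Qed.

(* The maximum of a convex function over a simplex is attained at a vertex. *)
Lemma semi_convex_vertex (I : eqType) (s : seq I) (c : I -> R) (v : I -> V)
    (u : V) (b : R) :
  (forall i, i \in s -> 0 <= c i) -> \sum_(i <- s) c i = 1 ->
  exists2 i, i \in s &
    p (u + b *: \sum_(i <- s) c i *: v i) <= p (u + b *: v i).
Proof.
move=> c0 c1.
apply: contrapT => nex.
have H i : i \in s -> p (u + b *: v i) < p (u + b *: \sum_(i <- s) c i *: v i).
  move=> si; rewrite ltNge; apply/negP => le; apply: nex; by exists i.
set A := p (u + b *: \sum_(i <- s) c i *: v i) in H nex *.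
have : A < A; last by rewrite ltxx.
have {1}-> : A = p (\sum_(i <- s) c i *: (u + b *: v i)).
  congr p; rewrite scaler_sumr.
  under [in RHS]eq_bigr do rewrite scalerDr.
  rewrite big_split/= -scaler_suml c1 scale1r; congr (_ + _).
  by apply: eq_bigr => i _; rewrite !scalerA mulrC.
apply: (@le_lt_trans _ _ (\sum_(i <- s) c i * p (u + b *: v i))).
  rewrite (le_trans (semi_sum _ _ _))// big_seq [leRHS]big_seq ler_sum// => i si.
  by rewrite semiZ ger0_norm// c0.
have -> : A = \sum_(i <- s) c i * A by rewrite -mulr_suml c1 mul1r.
have [i0 si0 ci0] : exists2 i, i \in s & 0 < c i.
  apply: contrapT => nc; have : \sum_(i <- s) c i <= 0.
    rewrite big_seq sumr_le0// => i si; rewrite leNgt; apply/negP => ci.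
    by apply: nc; exists i.
  by rewrite c1 ler10.
rewrite -subr_gt0 -sumrB.
rewrite (perm_big _ (perm_to_rem si0))/= big_cons ltr_pwDl//.
  by rewrite -mulrBr mulr_gt0// subr_gt0 H.
rewrite big_seq sumr_ge0// => i /mem_rem si.
by rewrite -mulrBr mulr_ge0 ?c0// subr_ge0 ltW// H.
Qed.

End SeminormTheory.

Lemma increasing_ltn (phi : nat -> nat) :
  (forall i, phi i < phi i.+1)%N -> increasing_seq phi.
Proof.
move=> h.
have lt i j : (i < j)%N -> (phi i < phi j)%N.
  elim: j => [//|j IH]; rewrite ltnS leq_eqVlt => /orP[/eqP->//|/IH ij].
  exact: ltn_trans ij (h j).
apply/leq_mono => i j; exact: lt.
Qed.

(* A finite combination of the basis is encoded by the polynomial with the same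
   coefficients: ['X^i] stands for [e_i], multiplication by ['X^m] is a shift, and
   [q.[1]] is the sum of the coefficients of [q]. *)
Definition spread (R : realType) (phi : nat -> nat) (q : {poly R}) : {poly R} :=
  \sum_(i < size q) q`_i *: 'X^(phi i).

Definition spreading_seminorm (R : realType) (N : {poly R} -> R) : Prop :=
  seminorm N /\ forall phi, increasing_seq phi -> forall q, N (spread phi q) = N q.

HB.lock Definition avg (R : realType) (M : nat) : {poly R} :=
  M%:R^-1 *: \sum_(j < M) 'X^j.
Arguments avg {R} M.

Definition bsum (R : realType) (m : nat -> nat) (q : nat -> {poly R}) (n : nat)
  : {poly R} := \sum_(k < n) 'X^(m k) * q k.

Definition successive (R : realType) (m : nat -> nat) (q : nat -> {poly R}) :=
  forall k, (m k + size (q k) <= m k.+1)%N.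

Section Spread.
Variables (R : realType).
Implicit Types q f g : {poly R}.

Lemma spreadE phi n q : (size q <= n)%N ->
  spread phi q = \sum_(i < n) q`_i *: 'X^(phi i).
Proof.
move=> qn; rewrite /spread (big_ord_widen n (fun i => q`_i *: 'X^(phi i)))//.
rewrite big_mkcond; apply: eq_bigr => i _; case: ifPn => //.
by rewrite -leqNgt => h; rewrite nth_default ?scale0r.
Qed.

Lemma polyE n q : (size q <= n)%N -> q = \sum_(i < n) q`_i *: 'X^i.
Proof.
move=> qn; rewrite -poly_def; apply/polyP => i; rewrite coef_poly.
by case: ltnP => // ni; rewrite nth_default// (leq_trans qn).
Qed.

Lemma horner1_sum n q : (size q <= n)%N -> q.[1] = \sum_(i < n) q`_i.
Proof.
move=> qn; rewrite (horner_coef_wide _ qn); apply: eq_bigr => i _.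
by rewrite expr1n mulr1.
Qed.

Lemma spread_is_linear phi : linear (@spread R phi).
Proof.
move=> a f g; pose n := maxn (size f) (size g).
have sf : (size f <= n)%N by rewrite leq_maxl.
have sg : (size g <= n)%N by rewrite leq_maxr.
have sfg : (size (a *: f + g)%R <= n)%N.
  rewrite (leq_trans (size_polyD _ _))// geq_max sg andbT.
  by rewrite (leq_trans (size_scale_leq _ _)).
rewrite !(spreadE _ sf, spreadE _ sg, spreadE _ sfg) scaler_sumr -big_split/=.
by apply: eq_bigr => i _; rewrite coefD coefZ scalerDl scalerA.
Qed.

HB.instance Definition _ phi := GRing.isLinear.Build R {poly R} {poly R} _
  (@spread R phi) (spread_is_linear phi).

Lemma spreadXn phi n : spread phi 'X^n = 'X^(phi n) :> {poly R}.
Proof.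
rewrite (@spreadE _ n.+1) ?size_polyXn// big_ord_recr/= big1 ?add0r.
  by rewrite coefXn eqxx scale1r.
by move=> i _; rewrite coefXn (ltn_eqF (ltn_ord i)) scale0r.
Qed.

Lemma spread_sum phi I (r : seq I) (P : pred I) (a : I -> R) (m : I -> nat) :
  spread phi (\sum_(i <- r | P i) a i *: 'X^(m i)) =
  \sum_(i <- r | P i) a i *: 'X^(phi (m i)).
Proof. by rewrite linear_sum; apply: eq_bigr => i _; rewrite linearZ/= spreadXn. Qed.

Lemma horner_avg1 M : (0 < M)%N -> (avg M).[1] = 1 :> R.
Proof.
move=> M0; rewrite avg.unlock hornerZ horner_sum.
under eq_bigr do rewrite hornerXn expr1n.
by rewrite sumr_const card_ord mulVf// pnatr_eq0 -lt0n.
Qed.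

Lemma size_avg M : (size (@avg R M) <= M)%N.
Proof.
rewrite avg.unlock (leq_trans (size_scale_leq _ _))// (leq_trans (size_sum _ _ _))//.
by apply/bigmax_leqP => i _; rewrite size_polyXn.
Qed.

(* Averaging over the translates of a block leaves only its sum, up to boundary terms. *)
Lemma mul_avg q : exists h, forall M,
  q * avg M = q.[1] *: avg M + M%:R^-1 *: (h * ('X^M - 1)).
Proof.
have /factor_theorem[h qh] : root (q - q.[1]%:P) 1.
  by rewrite /root !hornerE subrr.
exists h => M; rewrite -{1}(subrK (q.[1]%:P) q) mulrDl mul_polyC addrC; congr (_ + _).
rewrite qh -mulrA avg.unlock -scalerAr -scalerAr subrX1.
congr (_ *: (_ * (_ * _))); apply: eq_bigr => i _; by [].
Qed.

End Spread.

Section SpreadingSeminorm.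
Variables (R : realType) (N : {poly R} -> R).
Hypothesis hN : spreading_seminorm N.
Implicit Types q f g : {poly R}.

Let sN : seminorm N := hN.1.

(** Spreading along the map that fixes the indices below [m] and adds [k] to the others. *)
Lemma sp_gap m k f g : (size f <= m)%N ->
  N (f + 'X^(m + k) * g) = N (f + 'X^m * g).
Proof.
move=> fm; pose phi i := if (i < m)%N then i else (i + k)%N.
have inc : increasing_seq phi.
  by apply: increasing_ltn => i; rewrite /phi; case: ifP; case: ifP; lia.
rewrite -[RHS](hN.2 _ inc) linearD/=; congr (N (_ + _)).
  rewrite [LHS](polyE fm) (spreadE _ fm); apply: eq_bigr => i _.
  by rewrite /phi ltn_ord.
rewrite {2}(polyE (leqnn (size g))) mulr_sumr.
under eq_bigr do rewrite -scalerAr -exprD.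
rewrite spread_sum [in LHS](polyE (leqnn (size g))) mulr_sumr.
apply: eq_bigr => i _; rewrite -scalerAr -exprD /phi ltnNge leq_addr/=.
by rewrite addnAC.
Qed.

Lemma sp_shift k g : N ('X^k * g) = N g.
Proof.
by have := @sp_gap 0 k 0 g; rewrite size_poly0 !add0r add0n expr0 mul1r; apply.
Qed.

Lemma spX k : N 'X^k = N 1.
Proof. by have := sp_shift k 1; rewrite mulr1. Qed.

Lemma sp_avg q M : N (q * avg M) <= N q.
Proof.
have [->|M0] := posnP M.
  by rewrite avg.unlock big_ord0 scaler0 mulr0 (semi0 sN) (semi_ge0 sN).
rewrite avg.unlock -scalerAr mulr_sumr (semiZ sN) ger0_norm ?invr_ge0//.
rewrite ler_pdivrMl ?ltr0n//.
apply: (le_trans (semi_sum sN _ _ _)).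
under eq_bigr do rewrite mulrC sp_shift.
by rewrite sumr_const card_ord mulr_natl.
Qed.

Lemma sp_avg_sum q : exists2 C, 0 <= C & forall M,
  N (q * avg M - q.[1] *: avg M) <= M%:R^-1 * C.
Proof.
have [h qh] := mul_avg q; exists (N h + N h) => [|M].
  by rewrite addr_ge0 ?(semi_ge0 sN).
rewrite qh addrAC subrr add0r (semiZ sN) ger0_norm ?invr_ge0//.
rewrite ler_wpM2l ?invr_ge0// mulrBr mulr1 (le_trans (semiB sN _ _))//.
by rewrite mulrC sp_shift.
Qed.

(** Covers both uses of averaging over translates: blocks of sum zero always, and all blocks in the
    hypothetical case where the averages of the basis tend to 0. *)
Definition suppressible q :=
  forall eps, 0 < eps -> exists2 M, (0 < M)%N & N (q * avg M) <= eps.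

Lemma eventually_invn (C eps : R) : 0 < eps -> exists M0, forall M, (M0 < M)%N ->
  M%:R^-1 * C <= eps.
Proof.
move=> e0; have [M0 hM0] : exists M0, C / eps < M0%:R.
  exists (Num.truncn (C / eps)).+1; rewrite truncnS_gt//.
exists M0 => M MM0; rewrite ler_pdivrMl; last by rewrite ltr0n (leq_trans _ MM0).
rewrite -ler_pdivrMr// (le_trans (ltW hM0))// ler_nat ltnW//.
Qed.

Lemma zero_sum_suppressible q : q.[1] = 0 -> suppressible q.
Proof.
move=> q0 eps e0; have [C C0 hC] := sp_avg_sum q.
have [M0 hM0] := eventually_invn C e0.
exists M0.+1 => //; apply: le_trans (hM0 _ (ltnSn _)).
by have := hC M0.+1; rewrite q0 scale0r subr0.
Qed.

(** A gap of length [M] lets [q] slide to [M] positions without changing the norm. The mean of these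
    vectors is the vector without [q], plus a translate of [q * avg M], which is small. *)
Lemma sp_suppress m w f q g : (size f <= m)%N -> (size q <= w)%N ->
  suppressible q ->
  N (f + 'X^(m + w) * g) <= N (f + 'X^m * (q + 'X^w * g)).
Proof.
move=> fm qw hq; apply/ler_addgt0Pr => eps e0.
have [M M0 hM] := hq _ e0.
set B := N (f + 'X^m * (q + 'X^w * g)).
have fq : (size (f + 'X^m * q)%R <= m + w)%N.
  rewrite (leq_trans (size_polyD _ _))// geq_max (leq_trans fm) ?leq_addr//=.
  by rewrite (leq_trans (size_polyMleq _ _))// size_polyXn/= leq_add2l.
rewrite -(@sp_gap _ M); last by rewrite (leq_trans fm) ?leq_addr.
have H (j : 'I_M) : N (f + 'X^(m + j) * q + 'X^(m + w + M) * g) <= B.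
  have -> : f + 'X^(m + j) * q + 'X^(m + w + M) * g =
            f + 'X^(m + j) * (q + 'X^(w + (M - j)) * g).
    rewrite mulrDr addrA mulrA -exprD; congr (_ + 'X^_ * _).
    by have := ltn_ord j; lia.
  rewrite sp_gap// mulrDr mulrA -exprD addrA addnA sp_gap//.
  by rewrite /B mulrDr mulrA -exprD addrA.
have E : f + 'X^(m + w + M) * g =
    M%:R^-1 *: (\sum_(j < M) (f + 'X^(m + j) * q + 'X^(m + w + M) * g))
    - 'X^m * (q * avg M).
  have Mn0 : M%:R != 0 :> R by rewrite pnatr_eq0 -lt0n.
  have K (v : {poly R}) : M%:R^-1 *: \sum_(j < M) v = v.
    by rewrite sumr_const card_ord -[v *+ M]scaler_nat scalerA mulVf// scale1r.
  have -> : 'X^m * (q * avg M) = M%:R^-1 *: \sum_(j < M) 'X^(m + j) * q.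
    rewrite avg.unlock -!scalerAr !mulr_sumr; congr (_ *: _).
    by apply: eq_bigr => j _; rewrite exprD -mulrA [q * _]mulrC.
  by rewrite big_split/= big_split/= scalerDr scalerDr !K addrAC addrK.
rewrite E (le_trans (semiB sN _ _))// lerD//; last by rewrite sp_shift.
rewrite (semiZ sN) ger0_norm ?invr_ge0// ler_pdivrMl ?ltr0n//.
rewrite (le_trans (semi_sum_le sN _ (fun j _ => H j)))//.
by rewrite sumr_const card_ord mulr_natl.
Qed.

Lemma size_bsum m (q : nat -> {poly R}) n : successive m q ->
  (size (bsum m q n) <= m n)%N.
Proof.
move=> mq; elim: n => [|n IH]; first by rewrite /bsum big_ord0 size_poly0.
rewrite /bsum big_ord_recr/= (leq_trans (size_polyD _ _))// geq_max.
have := mq n => h; rewrite (leq_trans IH)/=; last by lia.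
by rewrite (leq_trans (size_polyMleq _ _))// size_polyXn/=.
Qed.

Lemma bsumS m (q : nat -> {poly R}) n :
  bsum m q n.+1 = bsum m q n + 'X^(m n) * q n.
Proof. by rewrite /bsum big_ord_recr. Qed.

Lemma successive_leq m (q : nat -> {poly R}) i j : successive m q -> (i <= j)%N ->
  (m i <= m j)%N.
Proof.
move=> mq; elim: j => [|j IH]; first by rewrite leqn0 => /eqP->.
rewrite leq_eqVlt => /orP[/eqP->//|]; rewrite ltnS => /IH h.
by apply: (leq_trans h); have := mq j; lia.
Qed.

(** Only the order of the blocks matters, not their positions. The tail [g] holds the blocks still
    to be moved, which lets the induction shift one block at a time. *)
Lemma sp_multigap m m' (q : nat -> {poly R}) n g :
  successive m q -> successive m' q ->
  N (bsum m q n + 'X^(m n) * g) = N (bsum m' q n + 'X^(m' n) * g).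
Proof.
move=> mq mq'; elim: n g => [|n IH] g.
  by rewrite /bsum !big_ord0 !add0r !sp_shift.
have E (r : nat -> nat) g' : successive r q ->
    bsum r q n.+1 + 'X^(r n.+1) * g' =
    bsum r q n + 'X^(r n) * (q n + 'X^(r n.+1 - r n) * g').
  move=> rq; rewrite bsumS -addrA mulrDr mulrA -exprD subnKC//.
  exact: successive_leq rq _.
rewrite E// IH mulrDr addrA mulrA -exprD -bsumS.
have sz : (size (bsum m' q n.+1) <= m' n + size (q n))%N.
  rewrite bsumS (leq_trans (size_polyD _ _))// geq_max.
  rewrite (leq_trans (size_bsum n mq')) ?leq_addr//=.
  by rewrite (leq_trans (size_polyMleq _ _))// size_polyXn/=.
have G a : (m' n + size (q n) <= a)%N -> N (bsum m' q n.+1 + 'X^a * g) =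
    N (bsum m' q n.+1 + 'X^(m' n + size (q n)) * g).
  by move=> h; rewrite -(subnKC h) (sp_gap _ _ sz).
by rewrite !G//; have := mq n; lia.
Qed.

(** Scaling a block by a factor in [0, 1] is a convex combination of keeping it and deleting it, and
    [sp_suppress] bounds the second. The tail [g] again serves the induction. *)
Lemma sp_multipliers m (q : nat -> {poly R}) (th : nat -> R) n g :
  successive m q ->
  (forall k, suppressible (q k)) -> (forall k, 0 <= th k <= 1) ->
  N (bsum m (fun k => th k *: q k) n + 'X^(m n) * g) <= N (bsum m q n + 'X^(m n) * g).
Proof.
move=> mq hq hth; elim: n g => [|n IH] g; first by rewrite /bsum !big_ord0.
set f := bsum m (fun k => th k *: q k) n.
have sf : (size f <= m n)%N.
  apply: size_bsum => k; apply: leq_trans (mq k).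
  by rewrite leq_add2l size_scale_leq.
have mm : (m n <= m n.+1)%N by exact: successive_leq mq _.
pose w := (m n.+1 - m n)%N.
have mw : m n.+1 = (m n + w)%N by rewrite subnKC.
have qw : (size (q n) <= w)%N by rewrite /w; have := mq n; lia.
have E : bsum m q n.+1 + 'X^(m n.+1) * g =
    bsum m q n + 'X^(m n) * (q n + 'X^w * g).
  by rewrite bsumS -addrA mulrDr mulrA -exprD -mw.
rewrite E; apply: le_trans (IH _); rewrite -/f bsumS -/f.
have -> : f + 'X^(m n) * (th n *: q n) + 'X^(m n.+1) * g =
  th n *: (f + 'X^(m n) * (q n + 'X^w * g)) + (1 - th n) *: (f + 'X^(m n + w) * g).
  rewrite mw exprD -scalerAr -!mul_polyC rmorphB/=; ring.
have /andP[t0 t1] := hth n.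
rewrite (le_trans (semiD sN _ _))// !(semiZ sN) !ger0_norm// ?subr_ge0//.
set A := N _; have : N (f + 'X^(m n + w) * g) <= A by apply: sp_suppress.
by move=> ?; nra.
Qed.

End SpreadingSeminorm.

(* [blow M] replaces each ['X^i] by the average of the block [i * M, (i + 1) * M[, and
   [diff_poly] replaces it by ['X^(2 i) - 'X^(2 i + 1)]. *)
Definition blow (R : realType) (M : nat) (q : {poly R}) : {poly R} :=
  (q \Po 'X^M) * avg M.

Definition diff_poly (R : realType) (q : {poly R}) : {poly R} :=
  (1 - 'X) * (q \Po 'X^2).

Definition cblock (R : realType) (V : lmodType R) (l : nat -> nat) (c : nat -> R)
  (v : nat -> V) (j : nat) : V := \sum_(l j <= k < l j.+1) c k *: v k.

Definition convex_coefs (R : realType) (l : nat -> nat) (c : nat -> R) : Prop :=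
  (forall k, 0 <= c k) /\ forall j, \sum_(l j <= k < l j.+1) c k = 1.

Section Blow.
Variable R : realType.
Implicit Types q f g : {poly R}.

Lemma comp_polyXnE M n q : (size q <= n)%N ->
  q \Po 'X^M = \sum_(i < n) q`_i *: 'X^(i * M).
Proof.
move=> qn; rewrite {1}(polyE qn) linear_sum; apply: eq_bigr => i _.
by rewrite linearZ/= comp_Xn_poly -exprM mulnC.
Qed.

Lemma blowE M n q : (size q <= n)%N ->
  blow M q = bsum (fun i => i * M)%N (fun i => q`_i *: avg M) n.
Proof.
move=> qn; rewrite /blow /bsum (comp_polyXnE _ qn) mulr_suml; apply: eq_bigr => i _.
by rewrite -scalerAl -scalerAr.
Qed.

Lemma blow_is_linear M : linear (@blow R M).
Proof. by move=> a f g; rewrite /blow linearP mulrDl scalerAl. Qed.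

HB.instance Definition _ M := GRing.isLinear.Build R {poly R} {poly R} _
  (@blow R M) (blow_is_linear M).

Lemma blowXn M k : blow M 'X^k = 'X^(k * M) * avg M :> {poly R}.
Proof. by rewrite /blow comp_Xn_poly -exprM mulnC. Qed.

Lemma diff_poly_is_linear : linear (@diff_poly R).
Proof. by move=> a f g; rewrite /diff_poly linearP mulrDr scalerAr. Qed.

HB.instance Definition _ := GRing.isLinear.Build R {poly R} {poly R} _
  (@diff_poly R) diff_poly_is_linear.

Lemma diff_polyXn k : diff_poly 'X^k = 'X^(k.*2) - 'X^(k.*2.+1) :> {poly R}.
Proof. by rewrite /diff_poly comp_Xn_poly -exprM mul2n mulrBl mul1r exprS. Qed.

End Blow.

Section SpreadingConsequences.
Variables (R : realType) (N : {poly R} -> R).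
Hypothesis hN : spreading_seminorm N.
Implicit Types q f g : {poly R}.

Let sN : seminorm N := hN.1.

(** Averaging does not increase the norm of [q] and turns it into [q.[1] *: avg M] up to a vanishing
    error. *)
Lemma sp_sum_bound delta : (forall M, (0 < M)%N -> delta <= N (avg M)) ->
  forall q, `|q.[1]| * delta <= N q.
Proof.
move=> hd q; apply/ler_addgt0Pr => eps e0.
have [C C0 hC] := sp_avg_sum hN q.
have [M0 hM0] := eventually_invn C e0.
have := le_trans (hC M0.+1) (hM0 _ (ltnSn _)) => h.
have := semi_le_dist sN (q.[1] *: avg M0.+1) (q * avg M0.+1).
rewrite semi_distC// (semiZ sN) => h2.
apply: (le_trans _ (le_trans h2 (lerD (sp_avg hN _ _) h))).
by rewrite ler_wpM2l// hd.
Qed.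

(** By [semi_convex_vertex] each block can be traded for one of its own basis vectors without
    lowering the norm; the chosen vectors form a subsequence of the basis. *)
Lemma sp_convex_blocks (l : nat -> nat) (c : nat -> R) (a : nat -> R) n :
  (forall j, l j < l j.+1)%N -> convex_coefs l c ->
  N (\sum_(j < n) a j *: cblock l c (fun k => 'X^k) j) <= N (\sum_(j < n) a j *: 'X^j).
Proof.
move=> hl [c0 c1].
(* The extra vector [h] stands for the blocks not yet replaced. *)
have H h : exists2 i : nat -> nat, (forall j, l j <= i j < l j.+1)%N &
  N (\sum_(j < n) a j *: cblock l c (fun k => 'X^k) j + h) <=
  N (\sum_(j < n) a j *: 'X^(i j) + h).
  elim: n h => [|n IH] h.
    by exists l => [j|]; [rewrite leqnn hl|rewrite !big_ord0].
  have [i hi le] := IH (a n *: cblock l c (fun k => 'X^k) n + h).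
  set u := \sum_(j < n) a j *: 'X^(i j) + h.
  have c0' k : k \in index_iota (l n) (l n.+1) -> 0 <= c k by move=> _; exact: c0.
  have [k] := semi_convex_vertex sN (fun k => 'X^k) u (a n) c0' (c1 n).
  rewrite mem_index_iota => hk lek.
  exists (fun j => if j == n then k else i j) => [j|].
    by case: eqP => [->//|_]; exact: hi.
  rewrite !big_ord_recr/= eqxx -!addrA.
  apply: (le_trans le); rewrite [leLHS](_ : _ = N (u + a n *: cblock l c (fun k => 'X^k) n)); last first.
    by rewrite /u -[in RHS]addrA [h + _]addrC.
  apply: (le_trans lek); rewrite le_eqVlt; apply/orP; left; apply/eqP; congr N.
  rewrite /u -addrA [h + _]addrC; congr (_ + _); apply: eq_bigr => j _.
  by rewrite (ltn_eqF (ltn_ord j)).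
have [i hi] := H 0; rewrite !addr0 => /le_trans; apply.
have inc : increasing_seq i.
  apply: increasing_ltn => j; have /andP[_ h1] := hi j; have /andP[h2 _] := hi j.+1.
  exact: leq_trans h1 h2.
have -> : \sum_(j < n) a j *: 'X^(i j) = spread i (\sum_(j < n) a j *: 'X^j).
  by rewrite spread_sum.
by rewrite hN.2.
Qed.

Lemma diff_norm_spreading : spreading_seminorm (N \o @diff_poly R).
Proof.
split=> [|phi inc q /=].
  by split=> [u v|t v] /=; rewrite ?linearD ?linearZ/= ?(semiD sN) ?(semiZ sN).
(* Moves the pair of indices 2i, 2i + 1 rigidly to 2 phi(i), 2 phi(i) + 1. *)
pose psi m := ((phi m./2).*2 + odd m)%N.
have incp : increasing_seq psi.
  apply: increasing_ltn => m; rewrite /psi /= uphalf_half.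
  have h : (phi m./2 < phi m./2.+1)%N by have := leqW_mono inc m./2 m./2.+1; rewrite ltnSn.
  by case: (odd m); rewrite ?add0n ?add1n; lia.
rewrite -[RHS](hN.2 _ incp); congr N.
have -> : spread phi q = \sum_(i < size q) q`_i *: 'X^(phi i) by [].
rewrite [in RHS](polyE (leqnn (size q))) !linear_sum/=.
apply: eq_bigr => i _; rewrite [diff_poly (_ *: 'X^i)]linearZ/= [spread _ _]linearZ/=.
rewrite [diff_poly (_ *: _)]linearZ/= !diff_polyXn [spread _ _]linearB/= !spreadXn /psi.
by rewrite doubleK oddS odd_double/= uphalf_double addn0 addn1.
Qed.

Lemma diff_poly_bsum (a : nat -> R) n :
  diff_poly (\sum_(k < n) a k *: 'X^k) = bsum double (fun k => a k *: (1 - 'X)) n.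
Proof.
rewrite linear_sum /bsum; apply: eq_bigr => i _.
by rewrite linearZ/= diff_polyXn -scalerAr mulrBr mulr1 exprSr.
Qed.

Lemma successive_diff (a : nat -> R) :
  successive double (fun k => a k *: (1 - 'X : {poly R})).
Proof.
move=> k; rewrite doubleS -addn2 leq_add2l (leq_trans (size_scale_leq _ _))//.
by rewrite (leq_trans (size_polyD _ _))// size_polyN size_polyX size_poly1.
Qed.

Lemma diff_suppressible (a : R) : suppressible N (a *: (1 - 'X)).
Proof. by apply: zero_sum_suppressible; rewrite // !hornerE subrr mulr0. Qed.

Lemma bsum_multipliers m (q : nat -> {poly R}) (th : nat -> R) n :
  successive m q ->
  (forall k, suppressible N (q k)) -> (forall k, 0 <= th k <= 1) ->
  N (bsum m (fun k => th k *: q k) n) <= N (bsum m q n).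
Proof.
by move=> h1 h2 h3; have := sp_multipliers hN n 0 h1 h2 h3; rewrite mulr0 !addr0.
Qed.

Lemma diff_multipliers (a th : nat -> R) n : (forall k, 0 <= th k <= 1) ->
  N (diff_poly (\sum_(k < n) (th k * a k) *: 'X^k)) <=
  N (diff_poly (\sum_(k < n) a k *: 'X^k)).
Proof.
move=> hth; rewrite (diff_poly_bsum a) (diff_poly_bsum (fun k => th k * a k)).
have := bsum_multipliers n (successive_diff a) (fun k => diff_suppressible (a k)) hth.
rewrite [X in N X <= _ -> _](_ : _ = bsum double (fun k => (th k * a k) *: (1 - 'X)) n) //.
by rewrite /bsum; under eq_bigr do rewrite scalerA.
Qed.

Lemma bsum_bounded_multipliers m (q : nat -> {poly R}) (tau : nat -> R) B n :
  successive m q -> (forall k, suppressible N (q k)) ->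
  (forall k, (k < n)%N -> `|tau k| <= B) ->
  N (bsum m (fun k => tau k *: q k) n) <= 2 * B * N (bsum m q n).
Proof.
move=> mq hq htau.
have N0 := semi_ge0 sN (bsum m q n).
have ext (t t' : nat -> R) : (forall k, (k < n)%N -> t k = t' k) ->
    bsum m (fun k => t k *: q k) n = bsum m (fun k => t' k *: q k) n.
  by move=> h; rewrite /bsum; apply: eq_bigr => k _; rewrite h.
have [B0|B0] := ltP 0 B; last first.
  have [->|n0] := posnP n; first by rewrite /bsum !big_ord0 (semi0 sN) mulr0.
  have BE : B = 0.
    by apply/eqP; rewrite eq_le B0 (le_trans (normr_ge0 _) (htau 0 n0)).
  rewrite (ext tau (fun=> 0)) => [|k kn].
    rewrite /bsum big1 => [|i _]; last by rewrite scale0r mulr0.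
    by rewrite (semi0 sN) BE mulr0 mul0r.
  by apply/eqP; rewrite -normr_le0 -BE htau.
pose tp k := if (k < n)%N then Num.max (tau k) 0 / B else 0.
pose tn k := if (k < n)%N then Num.max (- tau k) 0 / B else 0.
have H t : (forall k, 0 <= t k <= 1) -> N (bsum m (fun k => t k *: q k) n) <= N (bsum m q n).
  exact: bsum_multipliers.
have H1 : forall k, 0 <= tp k <= 1.
  move=> k; rewrite /tp; case: ifPn => kn; last by rewrite lexx ler01.
  rewrite divr_ge0 ?le_max ?lexx ?orbT ?(ltW B0)//= ler_pdivrMr// mul1r.
  by rewrite ge_max (ltW B0) andbT (le_trans (ler_norm _)) ?htau.
have H2 : forall k, 0 <= tn k <= 1.
  move=> k; rewrite /tn; case: ifPn => kn; last by rewrite lexx ler01.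
  rewrite divr_ge0 ?le_max ?lexx ?orbT ?(ltW B0)//= ler_pdivrMr// mul1r.
  by rewrite ge_max (ltW B0) andbT (le_trans (ler_norm _)) ?normrN ?htau.
have -> : bsum m (fun k => tau k *: q k) n =
    B *: (bsum m (fun k => tp k *: q k) n - bsum m (fun k => tn k *: q k) n).
  rewrite /bsum -sumrB scaler_sumr; apply: eq_bigr => k _.
  rewrite -mulrBr -scalerBl -!scalerAr scalerA; congr (_ *: _).
  rewrite /tp /tn ltn_ord -mulrBl mulrC divfK ?gt_eqF//.
  by rewrite /Num.max; do 2 case: ifP; lra.
rewrite (semiZ sN) gtr0_norm// -mulrA mulrCA ler_pM2l//.
by rewrite (le_trans (semiB sN _ _))// mulr_natl mulr2n lerD// H.
Qed.

End SpreadingConsequences.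

(** * Lower [l_1] estimates *)

Section EllOne.
Variables (R : realType) (V : lmodType R) (p : V -> R) (v : nat -> V) (delta : R).
Hypothesis hp : seminorm p.
Hypothesis hmult : forall n (a th : nat -> R), (forall k, 0 <= th k <= 1) ->
  p (\sum_(k < n) (th k * a k) *: v k) <= p (\sum_(k < n) a k *: v k).
Hypothesis hpos : forall n (a : nat -> R), (forall k, 0 <= a k) ->
  delta * \sum_(k < n) a k <= p (\sum_(k < n) a k *: v k).

(** The multipliers that keep only the nonnegative, or only the nonpositive, coefficients reduce to
    [hpos]; adding the two estimates gives the factor 2. *)
Lemma ell1_lower n (a : nat -> R) :
  delta * \sum_(k < n) `|a k| <= 2 * p (\sum_(k < n) a k *: v k).
Proof.
have h1 : delta * \sum_(k < n) (Num.max (a k) 0) <= p (\sum_(k < n) a k *: v k).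
  apply: le_trans (hmult n a (th := fun k => (0 <= a k)%R%:R) _); last first.
    by move=> k; case: (0 <= a k); rewrite ?lexx ?ler01.
  apply: le_trans (hpos n (a := fun k => Num.max (a k) 0) _) _ => [k|].
    by rewrite le_max lexx orbT.
  rewrite le_eqVlt; apply/orP; left; apply/eqP; congr p; apply: eq_bigr => k _.
  by congr (_ *: _); case: (leP 0 (a k)) => h; rewrite ?mul1r ?mul0r.
have h2 : delta * \sum_(k < n) (Num.max (- a k) 0) <= p (\sum_(k < n) a k *: v k).
  apply: le_trans (hmult n a (th := fun k => (a k <= 0)%R%:R) _); last first.
    by move=> k; case: (a k <= 0); rewrite ?lexx ?ler01.
  apply: le_trans (hpos n (a := fun k => Num.max (- a k) 0) _) _ => [k|].
    by rewrite le_max lexx orbT.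
  rewrite -semiN// -sumrN le_eqVlt; apply/orP; left; apply/eqP; congr p.
  apply: eq_bigr => k _; rewrite -scaleNr.
  congr (_ *: _); rewrite -oppr_ge0; case: (leP 0 (- a k)) => h; rewrite ?mul1r ?mul0r ?opprK ?oppr0//.
rewrite mulr_natl mulr2n; apply: le_trans (lerD h1 h2).
rewrite -mulrDr -big_split/= le_eqVlt; apply/orP; left; apply/eqP; congr (_ * _).
apply: eq_bigr => k _; case: (leP 0 (a k)) => h.
  by rewrite ger0_norm//; case: leP => //; lra.
by rewrite ltr0_norm//; case: leP => //; lra.
Qed.

End EllOne.

(** * The norm of the convex block homogeneous part, as a limit over averages *)

Section HomogeneousPart.
Variables (R : realType) (N zN : {poly R} -> R).
Hypothesis hN : spreading_seminorm N.
Hypothesis hz : forall q eps, 0 < eps ->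
  exists M0, forall M, (M0 <= M)%N -> `|N (blow M q) - zN q| <= eps.
Implicit Types q f g : {poly R}.

Let sN : seminorm N := hN.1.

Lemma zN_le q b :
  (forall eps, 0 < eps -> exists M0, forall M, (M0 <= M)%N -> N (blow M q) <= b + eps) ->
  zN q <= b.
Proof.
move=> H; apply/ler_addgt0Pr => eps e0.
have e20 : 0 < eps / 2 by lra.
have [M1 h1] := H _ e20; have [M2 h2] := hz q e20.
have := h1 _ (leq_maxl M1 M2); have := h2 _ (leq_maxr M1 M2).
by rewrite ler_norml => /andP[]; lra.
Qed.

Lemma zN_lim q eps : 0 < eps -> exists M0, forall M, (M0 <= M)%N ->
  zN q - eps <= N (blow M q) <= zN q + eps.
Proof.
move=> e0; have [M0 h] := hz q e0; exists M0 => M /h.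
by rewrite ler_norml => /andP[]; lra.
Qed.

Lemma zN_seminorm : seminorm zN.
Proof.
split=> [u v|t v].
  apply: zN_le => eps e0; have e20 : 0 < eps / 2 by lra.
  have [M1 h1] := zN_lim u e20; have [M2 h2] := zN_lim v e20.
  exists (maxn M1 M2) => M; rewrite geq_max => /andP[/h1/andP[_ a1] /h2/andP[_ a2]].
  by rewrite linearD (le_trans (semiD sN _ _))//; lra.
have [t0|t0] := eqVneq t 0.
  rewrite t0 scale0r normr0 mul0r; apply/eqP; rewrite eq_le; apply/andP; split.
    by apply: zN_le => eps e0; exists 0%N => M _; rewrite linear0 (semi0 sN); lra.
  apply/ler_addgt0Pr => eps e0; have [M0 h] := zN_lim 0 e0.
  by have /andP[_] := h M0 (leqnn _); rewrite linear0 (semi0 sN).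
apply/eqP; rewrite eq_le; apply/andP; split.
  apply: zN_le => eps e0; have e20 : 0 < eps / `|t| by rewrite divr_gt0 ?normr_gt0.
  have [M0 h] := zN_lim v e20; exists M0 => M /h/andP[_ a].
  rewrite linearZ/= (semiZ sN) (le_trans (ler_wpM2l _ a))// mulrDr mulrCA divff ?normr_eq0//.
  by rewrite mulr1.
apply/ler_addgt0Pr => eps e0.
have e20 : 0 < eps / 2 / `|t| by rewrite !divr_gt0 ?normr_gt0.
have e30 : 0 < eps / 2 by lra.
have [M1 h1] := zN_lim v e20; have [M2 h2] := zN_lim (t *: v) e30.
have /andP[a1 _] := h1 _ (leq_maxl M1 M2).
have /andP[_ a2] := h2 _ (leq_maxr M1 M2).
move: a2; rewrite linearZ/= (semiZ sN) => a2.
have := ler_wpM2l (normr_ge0 t) a1.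
rewrite mulrBr mulrCA divff ?normr_eq0// mulr1; lra.
Qed.

(** The blocks may be moved to the positions [k * M]. Multiplying by [avg M] does not increase the
    norm and makes the [k]-th block close to its sum times an average, so the result is close to a
    blown-up polynomial. *)
Lemma zN_blocks m (q : nat -> {poly R}) n :
  (forall k, (k < n)%N -> (m k + size (q k) <= m k.+1)%N) ->
  zN (\sum_(k < n) (q k).[1] *: 'X^k) <= N (bsum m q n).
Proof.
(* Beyond [n] the blocks are replaced by 0, because [successive] speaks of all indices. *)
move=> mq; pose q' k := if (k < n)%N then q k else 0.
pose m' k := if (k <= n)%N then m k else m n.
have mq' : successive m' q'.
  move=> k; rewrite /m' /q'; case: (ltnP k n) => kn; first by rewrite (ltnW kn) mq.
  rewrite size_poly0 addn0; case: (leqP k n) => // nk.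
  by have -> : k = n by apply/eqP; rewrite eqn_leq kn nk.
have -> : bsum m q n = bsum m' q' n.
  by rewrite /bsum; apply: eq_bigr => k _; rewrite /m' /q' ltn_ord (ltnW (ltn_ord k)).
pose C k := projT1 (cid2 (sp_avg_sum hN (q' k))).
have C0 k : 0 <= C k by rewrite /C; case: cid2.
have hC k M : N (q' k * avg M - (q' k).[1] *: avg M) <= M%:R^-1 * C k.
  by rewrite /C; case: cid2.
pose s := (\max_(k < n) size (q k))%N.
apply: zN_le => eps e0.
have [M0 hM0] := eventually_invn (\sum_(k < n) C k) e0.
exists (maxn s M0.+1) => M; rewrite geq_max => /andP[sM M0M].
have succ : successive (fun k => k * M)%N q'.
  move=> k; rewrite mulSn addnC leq_add2r /q'; case: ifP => [kn|_]; last by rewrite size_poly0.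
  apply: leq_trans sM; exact: (@leq_bigmax _ (fun k : 'I_n => size (q k)) (Ordinal kn)).
have := sp_multigap hN n 0 mq' succ; rewrite !mulr0 !addr0 => ->.
set v := bsum _ q' n.
have E : blow M (\sum_(k < n) (q k).[1] *: 'X^k) = v * avg M -
    \sum_(k < n) 'X^(k * M) * (q' k * avg M - (q' k).[1] *: avg M).
  rewrite linear_sum /v /bsum mulr_suml -sumrB; apply: eq_bigr => k _.
  rewrite linearZ/= blowXn mulrBr mulrA subKr -scalerAr.
  by rewrite /q' ltn_ord.
rewrite E (le_trans (semiB sN _ _))// lerD ?sp_avg//.
apply: le_trans (hM0 _ M0M); rewrite mulr_sumr (semi_sum_le sN)// => k _.
by rewrite sp_shift.
Qed.

(** Spreading before blowing up only widens the gaps between the same averages, which [sp_multigap]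
    ignores. *)
Lemma zN_spreading : spreading_seminorm zN.
Proof.
split=> [|phi inc q]; first exact: zN_seminorm.
have E M : N (blow M (spread phi q)) = N (blow M q).
  rewrite (blowE _ (leqnn (size q))) /spread linear_sum/=.
  have -> : \sum_(i < size q) blow M (q`_i *: 'X^(phi i)) =
      bsum (fun i => phi i * M)%N (fun i => q`_i *: avg M) (size q).
    by rewrite /bsum; apply: eq_bigr => i _; rewrite linearZ/= blowXn -scalerAr.
  have s i : (size (q`_i *: avg M)%R <= M)%N.
    by rewrite (leq_trans (size_scale_leq _ _))// size_avg.
  have := @sp_multigap _ _ hN (fun i => phi i * M)%N (fun i => i * M)%N
    (fun i => q`_i *: avg M) (size q) 0.
  rewrite !mulr0 !addr0; apply => k; last by rewrite mulSn addnC leq_add2r.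
  apply: (@leq_trans ((phi k).+1 * M)); first by rewrite mulSn addnC leq_add2r.
  by rewrite leq_mul2r (leqW_mono inc) ltnSn orbT.
apply/eqP; rewrite eq_le; apply/andP; split; apply: zN_le => eps e0;
  [have [M0 h] := zN_lim q e0|have [M0 h] := zN_lim (spread phi q) e0];
  by exists M0 => M /h/andP[_]; rewrite ?E// -E.
Qed.

(* Each basis vector is replaced by the average of a later block; the difference
   is an average of copies of [diff_poly q]. *)
Lemma N_le_diff_zN q : N q <= N (diff_poly q) + zN q.
Proof.
apply/ler_addgt0Pr => eps e0.
have [M0 h] := zN_lim q e0.
have M1 : (0 < M0.+1)%N by [].
set M := M0.+1 in M1; have /andP[_ hM] := h M (leqnSn _).
(* The even index 2i goes to i (M + 1), and its partner 2i + 1 to the [j]-th of the [M] places that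
   follow. *)
pose phi j m := (m./2 * M.+1 + odd m * j.+1)%N.
have incphi (j : 'I_M) : increasing_seq (phi j).
  apply: increasing_ltn => m; rewrite /phi /= uphalf_half.
  by have := ltn_ord j; case: (odd m) => /=; nia.
have inc0 : increasing_seq (fun i => i * M.+1)%N.
  by apply: increasing_ltn => m; nia.
have inc1 : increasing_seq (fun i => i * M.+1 + 1)%N.
  by apply: increasing_ltn => m; nia.
rewrite -{1}(hN.2 _ inc0).
have E : spread (fun i => i * M.+1)%N q =
   M%:R^-1 *: (\sum_(j < M) spread (phi j) (diff_poly q)) +
   bsum (fun i => i * M.+1 + 1)%N (fun i => q`_i *: avg M) (size q).
  have Mn0 : M%:R != 0 :> R by rewrite pnatr_eq0.
  have D (j : 'I_M) : spread (phi j) (diff_poly q) =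
     spread (fun i => i * M.+1)%N q - \sum_(i < size q) q`_i *: 'X^(i * M.+1 + 1 + j).
    have -> : spread (phi j) (diff_poly q) =
        \sum_(i < size q) q`_i *: ('X^(i * M.+1) - 'X^(i * M.+1 + 1 + j)).
      rewrite {1}(polyE (leqnn (size q))) linear_sum linear_sum/=; apply: eq_bigr => i _.
      rewrite [diff_poly _]linearZ/= diff_polyXn [spread _ _]linearZ/= [spread _ _]linearB/= !spreadXn.
      rewrite /phi doubleK oddS odd_double/= uphalf_double mul0n addn0 mul1n.
      by rewrite -addnA add1n.
    by rewrite /spread -sumrB; apply: eq_bigr => i _; rewrite scalerBr.
  under eq_bigr do rewrite D.
  have K (v : {poly R}) : M%:R^-1 *: \sum_(j < M) v = v.
    by rewrite sumr_const card_ord -[v *+ M]scaler_nat scalerA mulVf// scale1r.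
  rewrite sumrB scalerBr K.
  rewrite -[LHS]addr0 -addrA; congr (_ + _); apply/esym/eqP; rewrite addrC subr_eq0; apply/eqP.
  rewrite exchange_big/= scaler_sumr /bsum; apply: eq_bigr => i _.
  rewrite -scalerAr avg.unlock -scalerAr scalerA mulrC -scalerA -scaler_sumr; congr (_ *: (_ *: _)).
  by rewrite mulr_sumr; apply: eq_bigr => j _; rewrite -exprD.
rewrite E (le_trans (semiD sN _ _))// -addrA lerD//.
  rewrite (semiZ sN) ger0_norm ?invr_ge0// ler_pdivrMl ?ltr0n//.
  apply: (le_trans (semi_sum sN _ _ _)).
  under eq_bigr => j _ do rewrite (hN.2 _ (incphi j)).
  by rewrite sumr_const card_ord mulr_natl.
apply: le_trans hM; rewrite (blowE _ (leqnn (size q))).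
have s i : (size (q`_i *: avg M)%R <= M)%N.
  by rewrite (leq_trans (size_scale_leq _ _))// size_avg.
have := @sp_multigap _ _ hN (fun i => i * M.+1 + 1)%N (fun i => i * M)%N
  (fun i => q`_i *: avg M) (size q) 0.
rewrite !mulr0 !addr0 => ->// k; have := s k; rewrite ?mulSn; lia.
Qed.

End HomogeneousPart.

(** * Hahn-Banach extension and boundedness of weakly Cauchy sequences *)

Lemma linear_pack (R : realType) (V W : lmodType R) (f : V -> W) :
  linear f -> exists F : {linear V -> W}, forall u, F u = f u.
Proof.
move=> lf.
pose g := GRing.isLinear.Build R V W *:%R f lf.
pose F : {linear V -> W} := HB.pack f g.
by exists F.
Qed.

Section HahnBanach.
Variables (R : realType) (V : lmodType R) (p : V -> R).
Hypothesis hp : seminorm p.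

(** Partial functionals dominated by [p] are kept as graphs, so that unions of chains make sense for
    Zorn's lemma. Single-valuedness is a consequence of the domination. *)
Definition linear_graph (G : set (V * R)) : Prop :=
  [/\ G (0, 0),
      forall t u w, G u -> G w -> G (t *: u.1 + w.1, t * u.2 + w.2) &
      forall u, G u -> u.2 <= p u.1].

(** Both (0, a - b) and (0, b - a) lie in the graph, and [p 0 = 0]. *)
Lemma linear_graph_fun G u a b : linear_graph G -> G (u, a) -> G (u, b) -> a = b.
Proof.
move=> [_ lin bd] ua ub.
have := bd _ (lin (-1) _ _ ub ua); have := bd _ (lin (-1) _ _ ua ub).
by rewrite /= scaleN1r addNr (semi0 hp); lra.
Qed.

Lemma linear_graph_extend G u0 : linear_graph G ->
  exists c, linear_graph [set w | exists t v, G v /\ w = (v.1 + t *: u0, v.2 + t * c)].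
Proof.
move=> [G0 lin bd].
(* The value at [u0] has to lie above all of [S] and below all [p (w.1 + u0) - w.2]; its supremum
   does. *)
pose S := [set v.2 - p (v.1 - u0) | v in G].
have le v w : G v -> G w -> v.2 - p (v.1 - u0) <= p (w.1 + u0) - w.2.
  move=> Gv Gw; have /= := bd _ (lin 1 _ _ Gv Gw); rewrite scale1r mul1r.
  have := semiD hp (v.1 - u0) (w.1 + u0); rewrite addrACA addNr addr0; lra.
have S0 : S !=set0 by exists (0 - p (0 - u0)); exists (0, 0).
have Sub : has_ubound S by exists (p (0 + u0) - 0) => _ [v Gv <-]; exact: le Gv G0.
pose c := sup S.
have c1 v : G v -> v.2 - p (v.1 - u0) <= c by move=> Gv; apply: ub_le_sup => //; exists v.
have c2 v : G v -> c <= p (v.1 + u0) - v.2.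
  by move=> Gv; apply: ge_sup => // _ [w Gw <-]; exact: le.
exists c; split.
- by exists 0, (0, 0); rewrite /= scale0r mul0r !addr0.
- move=> t _ _ [a [v [Gv ->]]] [b [w [Gw ->]]]; exists (t * a + b), (t *: v.1 + w.1, t * v.2 + w.2).
  split; first exact: lin.
  by rewrite /= scalerDr scalerA scalerDl addrACA; congr (_, _); ring.
- move=> _ [t [v [Gv ->]]] /=.
  have sc s : G (s *: v.1, s * v.2) by have := lin s _ _ Gv G0; rewrite /= !addr0.
  have [t0|t0|->] := ltgtP t 0.
  + have := c1 _ (sc (- t)^-1) => /=.
    have -> : (- t)^-1 *: v.1 - u0 = (- t)^-1 *: (v.1 + t *: u0).
      by rewrite scalerDr scalerA invrN mulNr mulVf ?lt_eqF// scaleN1r.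
    have tp : 0 < - t by rewrite oppr_gt0.
    rewrite (semiZ hp) gtr0_norm ?invr_gt0// -mulrBr ler_pdivrMl//; lra.
  + have := c2 _ (sc t^-1) => /=.
    have -> : t^-1 *: v.1 + u0 = t^-1 *: (v.1 + t *: u0).
      by rewrite scalerDr scalerA mulVf ?gt_eqF// scale1r.
    rewrite (semiZ hp) gtr0_norm ?invr_gt0// -mulrBr ler_pdivlMl//; lra.
  + by rewrite scale0r mul0r !addr0 bd.
Qed.

Lemma linear_graph_total G0 : linear_graph G0 ->
  exists f : V -> R, [/\ linear (f : V -> R^o), forall w, G0 w -> f w.1 = w.2 &
    forall u, f u <= p u].
Proof.
(* Adjoining [G0] inside [P] makes the empty chain harmless. *)
move=> gG0; pose P (G : set (V * R)) := linear_graph (G0 `|` G).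
have [F FP Ftot|A [PA maxA]] := @Zorn_bigcup (V * R)%type P.
  have H u w : (G0 `|` \bigcup_(X in F) X) u -> (G0 `|` \bigcup_(X in F) X) w ->
      exists G, [/\ linear_graph G, G `<=` G0 `|` \bigcup_(X in F) X, G u & G w].
    have aux X : F X -> G0 `|` X `<=` G0 `|` \bigcup_(X in F) X.
      by move=> FX y [|Xy]; [left|right; exists X].
    move=> [G0u|[X FX Xu]] [G0w|[Y FY Yw]].
    - by exists G0; split => //; exact: subsetUl.
    - by exists (G0 `|` Y); split; [exact: FP|exact: aux|left|right].
    - by exists (G0 `|` X); split; [exact: FP|exact: aux|right|left].
    - have [XY|YX] := Ftot _ _ FX FY.
        by exists (G0 `|` Y); split; [exact: FP|exact: aux|right; exact: XY|right].
      by exists (G0 `|` X); split; [exact: FP|exact: aux|right|right; exact: YX].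
  split.
  - by left; have [] := gG0.
  - move=> t u w hu hw; have [G [[_ lin _] sG Gu Gw]] := H _ _ hu hw.
    exact/sG/lin.
  - by move=> u hu; have [G [[_ _ bd] _ Gu _]] := H _ _ hu hu; exact: bd.
have tot u : exists a, (G0 `|` A) (u, a).
  apply: contrapT => nu.
  have [c gH] := linear_graph_extend u PA.
  set H := [set w | _] in gH.
  have AH : (G0 `|` A) `<=` H.
    by move=> [w b] Aw; exists 0, (w, b); rewrite /= scale0r mul0r !addr0.
  apply: (maxA H).
    split; first by move=> w Aw; apply: AH; right.
    move=> HA; apply: nu; exists c; right; apply: HA; exists 1, (0, 0).
    by rewrite /= scale1r mul1r !add0r; split => //; have [] := PA.
  rewrite /P setUidr//.
  by move=> w G0w; apply: AH; left.
pose f u := projT1 (cid (tot u)).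
have fP u : (G0 `|` A) (u, f u) by rewrite /f; case: cid.
exists f; split.
- move=> t u w; apply: (linear_graph_fun PA (fP _)).
  by have [_ lin _] := PA; exact: (lin t _ _ (fP u) (fP w)).
- move=> [w b] G0w; apply: (linear_graph_fun PA (fP _)); by left.
- by move=> u; have [_ _ bd] := PA; exact: (bd _ (fP u)).
Qed.

(* Helly's form of the Hahn-Banach theorem. *)
Lemma hahn_banach_moments (v : nat -> V) (theta : nat -> R) :
  (forall n (a : nat -> R), \sum_(k < n) a k * theta k <= p (\sum_(k < n) a k *: v k)) ->
  exists f : {linear V -> R^o}, (forall k, f (v k) = theta k) /\
    forall u, `|f u| <= p u.
Proof.
move=> H.
pose G0 := [set w : V * R | exists n (a : nat -> R),
   w = (\sum_(k < n) a k *: v k, \sum_(k < n) a k * theta k)].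
have pad n m (a : nat -> R) : (n <= m)%N -> exists b : nat -> R,
    \sum_(k < n) a k *: v k = \sum_(k < m) b k *: v k /\
    \sum_(k < n) a k * theta k = \sum_(k < m) b k * theta k.
  move=> nm; exists (fun k => if (k < n)%N then a k else 0).
  rewrite (big_ord_widen m (fun k => a k *: v k))// (big_ord_widen m (fun k => a k * theta k))//.
  split; rewrite big_mkcond; apply: eq_bigr => k _; case: ifP => //.
    by rewrite scale0r.
  by rewrite mul0r.
have gG0 : linear_graph G0.
  split.
  - by exists 0%N, (fun=> 0); rewrite !big_ord0.
  - move=> t _ _ [n [a ->]] [m [b ->]] /=.
    have [a' [-> ->]] := pad n (maxn n m) a (leq_maxl _ _).
    have [b' [-> ->]] := pad m (maxn n m) b (leq_maxr _ _).
    exists (maxn n m), (fun k => t * a' k + b' k); congr (_, _).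
      rewrite scaler_sumr -big_split/=; apply: eq_bigr => k _.
      by rewrite scalerDl scalerA.
    rewrite mulr_sumr -big_split/=; apply: eq_bigr => k _; ring.
  - by move=> _ [n [a ->]] /=; exact: H.
have [f [lf fG0 fp]] := linear_graph_total gG0.
have [F FE] := linear_pack lf.
exists F; split => [k|u].
  rewrite FE; apply: (fG0 (v k, theta k)); exists k.+1, (fun j => (j == k)%:R).
  rewrite !big_ord_recr/= eqxx scale1r mul1r !big1 ?add0r// => j _.
    by rewrite (ltn_eqF (ltn_ord j)) mul0r.
  by rewrite (ltn_eqF (ltn_ord j)) scale0r.
rewrite ler_norml; apply/andP; split; last by rewrite FE.
by rewrite lerNl -linearN/= FE (le_trans (fp _))// (semiN hp).
Qed.

Lemma norming_functional (v : V) : exists f : {linear V -> R^o},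
  f v = p v /\ forall u, `|f u| <= p u.
Proof.
have [|f [fv fp]] := @hahn_banach_moments (fun=> v) (fun=> p v).
  move=> n a; rewrite -mulr_suml -scaler_suml (semiZ hp).
  by rewrite ler_wpM2r ?(semi_ge0 hp)// ler_norm.
by exists f; split => //; exact: fv 0%N.
Qed.

End HahnBanach.

Lemma norm_seminorm (R : realType) (X : normedModType R) :
  seminorm (fun v : X => `|v|).
Proof. by split=> [u v|t v]; [exact: ler_normD|exact: normrZ]. Qed.

Lemma bounded_linear_cts (R : realType) (X Y : normedModType R)
    (f : {linear X -> Y}) (C : R) :
  (forall u, `|f u| <= C * `|u|) -> continuous f.
Proof.
move=> fC; apply/bounded_linear_continuous/linear_boundedP.
exists C; split => [|r Cr u]; first exact: num_real.
by rewrite (le_trans (fC u))// ler_wpM2r// ltW.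
Qed.

(** 3/2 is the sum of the powers of 1/3, so [u k] minus, respectively plus, the stated error is
    nondecreasing, respectively nonincreasing in [k]. *)
Lemma geometric_limit (R : realType) (u : nat -> R) (C : R) :
  (forall k, `|u k.+1 - u k| <= C * 3 ^- k) ->
  exists l, forall k, `|u k - l| <= 3 / 2 * C * 3 ^- k.
Proof.
move=> hu.
pose a k := u k - 3 / 2 * C * 3 ^- k; pose b k := u k + 3 / 2 * C * 3 ^- k.
have E k : 3 ^- k.+1 = 3^-1 * 3 ^- k :> R by rewrite exprS invfM.
have incr : {homo a : i j / (i <= j)%N >-> i <= j}.
  apply: homo_leq => [//|x y z|k]; first exact: le_trans.
  rewrite /a E; have := hu k; rewrite ler_norml => /andP[]; lra.
have decr : {homo b : i j / (i <= j)%N >-> j <= i}.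
  apply: homo_leq => [//|x y z|k]; first by move=> h1 h2; exact: le_trans h2 h1.
  rewrite /b E; have := hu k; rewrite ler_norml => /andP[]; lra.
have C0 k : 0 <= C * 3 ^- k by exact: le_trans (normr_ge0 _) (hu k).
have ab i j : a i <= b j.
  have h1 := incr _ _ (leq_maxl i j); have h2 := decr _ _ (leq_maxr i j).
  apply: (le_trans h1); apply: le_trans h2.
  by rewrite /a /b; have := C0 (maxn i j); lra.
have S0 : range a !=set0 by exists (a 0%N), 0%N.
have Sub : has_ubound (range a) by exists (b 0%N) => _ [i _ <-].
exists (sup (range a)) => k.
have h1 : a k <= sup (range a) by apply: ub_le_sup => //; exists k.
have h2 : sup (range a) <= b k by apply: ge_sup => // _ [i _ <-].
by rewrite ler_norml; move: h1 h2; rewrite /a /b => *; apply/andP; split; lra.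
Qed.

(* Gliding hump: functionals [h k] norming [x (i k)] are added with weights
   [3 ^- k] and signs for which no cancellation occurs at [x (i k)]. *)
Lemma weakly_cauchy_bounded (R : realType) (X : normedModType R) (x : nat -> X) :
  weakly_cauchy x -> exists M, forall i, `|x i| <= M.
Proof.
move=> wx; apply: contrapT => nb.
have unb (M : R) : exists i, M < `|x i|.
  apply: contrapT => h; apply: nb; exists M => i; rewrite leNgt; apply/negP => hi.
  by apply: h; exists i.
(* At [x (i k)] the weight [3 ^- k] contributes [3 ^- k] times the norm and all later terms at most
   half of that, so this choice makes the final functional at least [k] there in absolute value. *)
pose i (k : nat) := projT1 (cid (unb (2 * 3 ^+ k * k%:R))).
have hi k : 2 * 3 ^+ k * k%:R < `|x (i k)| by rewrite /i; case: cid.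
pose h (k : nat) := projT1 (cid (norming_functional (norm_seminorm X) (x (i k)))).
have [h1 h2] : (forall k, h k (x (i k)) = `|x (i k)|) /\ forall k u, `|h k u| <= `|u|.
  by split=> k; rewrite /h; case: cid => f [].
pose sg (a : R) : R := if 0 <= a then 1 else -1.
pose F := fix F (k : nat) : X -> R := if k is j.+1 then
  fun u => F j u + sg (F j (x (i j))) * 3 ^- j * h j u else fun=> 0.
have FS k u : F k.+1 u = F k u + sg (F k (x (i k))) * 3 ^- k * h k u by [].
have p3 k : 0 < 3 ^- k :> R by rewrite invr_gt0 exprn_gt0.
have sg1 a : `|sg a| = 1 by rewrite /sg; case: ifP; rewrite ?normrN normr1.
have Flin k t u w : F k (t *: u + w) = t * F k u + F k w.
  elim: k => [|k IH]; first by rewrite /= mulr0 addr0.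
  by rewrite !FS IH linearP/= -[_ *: _]/(_ * _); ring.
have step u k : `|F k.+1 u - F k u| <= `|u| * 3 ^- k.
  rewrite FS addrAC subrr add0r !normrM sg1 mul1r gtr0_norm// mulrC ler_pM2r//.
have lims u : exists l, forall k, `|F k u - l| <= 3 / 2 * `|u| * 3 ^- k.
  exact: geometric_limit.
pose f u := projT1 (cid (lims u)).
have fP u k : `|F k u - f u| <= 3 / 2 * `|u| * 3 ^- k by rewrite /f; case: cid.
have small (a C : R) : (forall k : nat, `|a| <= C * 3 ^- k) -> a = 0.
  move=> ha; apply/eqP; rewrite -normr_le0; apply/ler_addgt0Pr => eps e0.
  rewrite add0r; have := @eventually_invn R C eps e0 => -[M0 /(_ M0.+1 (ltnSn _)) hM].
  apply: le_trans hM; apply: (le_trans (ha M0.+1)); rewrite mulrC ler_wpM2r//.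
    by have := le_trans (normr_ge0 _) (ha 0%N); rewrite expr0 invr1 mulr1.
  rewrite lef_pV2 ?posrE ?exprn_gt0 ?ltr0n// -natrX ler_nat.
  by rewrite ltnW// ltn_expl.
have flin : linear (f : X -> R^o).
  move=> t u w; apply/eqP; rewrite -subr_eq0; apply/eqP.
  apply: (small _ (3 / 2 * `|t *: u + w| + `|t| * (3 / 2 * `|u|) + 3 / 2 * `|w|)) => k.
  have -> : f (t *: u + w) - ((t *: (f u : R^o)) + f w) =
    - (F k (t *: u + w) - f (t *: u + w)) + t * (F k u - f u) + (F k w - f w).
    rewrite Flin; change (t *: f u) with (t * f u); ring.
  rewrite (le_trans (ler_normD _ _))// mulrDl lerD ?fP//.
  rewrite (le_trans (ler_normD _ _))// mulrDl lerD ?normrN ?fP//.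
  by rewrite normrM -[leRHS]mulrA ler_wpM2l// fP.
have [G GE] := linear_pack flin.
have Gc : continuous G.
  apply: (@bounded_linear_cts _ _ _ G (3 / 2)) => u; rewrite GE.
  by have := fP u 0%N; rewrite /= sub0r normrN expr0 invr1 mulr1.
have := wx G Gc => /cvg_seq_bounded[B [_ hB]].
have {hB} hB j : `|f (x j)| <= B + 1 by rewrite -GE; apply: (hB (B + 1)) => //; lra.
have low k : k%:R <= `|f (x (i k))|.
  have := fP (x (i k)) k.+1; rewrite FS h1.
  have -> : 3 ^- k.+1 = 3^-1 * 3 ^- k :> R by rewrite exprS invfM.
  have : k%:R <= 3 ^- k * `|x (i k)| / 2.
    rewrite ler_pdivlMr// mulrC -ler_pdivrMl//.
    by rewrite invrK mulrCA mulrA ltW.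
  set y := x (i k); set T := 3 ^- k * `|y| => hk.
  rewrite (_ : 3 / 2 * `|y| * (3^-1 * 3 ^- k) = T / 2); last by rewrite /T; move: (3 ^- k) => d; field.
  rewrite -mulrA -/T /sg; case: ifPn => F0.
    rewrite ler_norml => /andP[h3 h4]; rewrite (le_trans _ (ler_norm _))//; lra.
  rewrite -ltNge in F0; rewrite ler_norml => /andP[h3 h4].
  rewrite -normrN (le_trans _ (ler_norm _))//; lra.
have [k hk] : exists k : nat, B + 1 < k%:R by exists (Num.truncn (B + 1)).+1; rewrite truncnS_gt.
by have := lt_le_trans hk (le_trans (low k) (hB (i k))); rewrite ltxx.
Qed.

(** * Limits in an equivalent norm and evaluation of polynomials on sequences *)

Section EpsilonLimits.
Variable R : realType.

Lemma cvg_epsP (V : normedModType R) (u : nat -> V) (l : V) :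
  u @ \oo --> l <->
  forall eps, 0 < eps -> exists n0, forall n, (n0 <= n)%N -> `|u n - l| <= eps.
Proof.
split=> [/cvgrPdist_le h eps e0|h].
  by have [n0 _ hn] := h _ e0; exists n0 => n nn; rewrite distrC hn.
apply/cvgrPdist_le => eps e0; have [n0 hn] := h _ e0.
by exists n0 => // n /= nn; rewrite distrC hn.
Qed.

Lemma cauchy_eps_cvg (V : completeNormedModType R) (u : nat -> V) :
  (forall eps, 0 < eps -> exists n0, forall n, (n0 <= n)%N -> `|u n - u n0| <= eps) ->
  cvgn u.
Proof.
move=> h; apply/cauchy_cvgP/cauchy_exP => eps e0.
have e20 : 0 < eps / 2 by lra.
have [n0 hn] := h _ e20; exists (u n0); exists n0 => // n /= nn.
by rewrite -ball_normE/= distrC (le_lt_trans (hn _ nn))//; lra.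
Qed.

End EpsilonLimits.

Section EquivalentNorm.
Variables (R : realType) (X : completeNormedModType R) (p : X -> R).
Hypothesis hp : equivalent_norm p.

Lemma equivalent_norm_seminorm : seminorm p.
Proof. by case: hp. Qed.

Lemma pcvgP (u : nat -> X) (l : X) :
  u @ \oo --> l <->
  forall eps, 0 < eps -> exists n0, forall n, (n0 <= n)%N -> p (u n - l) <= eps.
Proof.
have [_ _ [c [C [c0 C0 cC]]]] := hp.
split=> [/cvg_epsP h eps e0|h].
  have [n0 hn] := h _ (divr_gt0 e0 C0); exists n0 => n /hn.
  rewrite ler_pdivlMr// mulrC; apply: le_trans; by have /andP[] := cC (u n - l).
apply/cvg_epsP => eps e0; have [n0 hn] := h _ (mulr_gt0 c0 e0).
exists n0 => n /hn h1; rewrite -(ler_pM2l c0); apply: le_trans h1.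
by have /andP[] := cC (u n - l).
Qed.

Lemma pcauchy_cvg (u : nat -> X) :
  (forall eps, 0 < eps -> exists n0, forall n, (n0 <= n)%N -> p (u n - u n0) <= eps) ->
  cvgn u.
Proof.
have [_ _ [c [C [c0 C0 cC]]]] := hp.
move=> h; apply: cauchy_eps_cvg => eps e0; have [n0 hn] := h _ (mulr_gt0 c0 e0).
exists n0 => n /hn h1; rewrite -(ler_pM2l c0); apply: le_trans h1.
by have /andP[] := cC (u n - u n0).
Qed.

Lemma pcvg_le (u : nat -> X) (l : X) b n0 :
  u @ \oo --> l -> (forall n, (n0 <= n)%N -> p (u n) <= b) -> p l <= b.
Proof.
move=> /pcvgP h hb; apply/ler_addgt0Pr => eps e0.
have [n1 hn] := h _ e0.
apply: (le_trans (semi_le_dist equivalent_norm_seminorm l (u (maxn n0 n1)))).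
rewrite lerD ?hb ?leq_maxl//.
by rewrite (semi_distC equivalent_norm_seminorm) hn// leq_maxr.
Qed.

End EquivalentNorm.

(** One polynomial is evaluated along [e], along [z] and along the blocks [w], so that the same
    coefficients can be compared in different spaces. *)
Definition ev (R : realType) (V : lmodType R) (x : nat -> V) (q : {poly R}) : V :=
  lincomb (size q) (fun i => q`_i) x.

Section Ev.
Variables (R : realType) (V : lmodType R).
Implicit Types (x : nat -> V) (q : {poly R}).

Lemma evE x n q : (size q <= n)%N -> ev x q = \sum_(i < n) q`_i *: x i.
Proof.
move=> qn; rewrite /ev /lincomb (big_ord_widen n (fun i => q`_i *: x i))//.
rewrite big_mkcond; apply: eq_bigr => i _; case: ifPn => //.
by rewrite -leqNgt => h; rewrite nth_default ?scale0r.
Qed.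

Lemma ev_is_linear x : linear (ev x).
Proof.
move=> a f g; pose n := maxn (size f) (size g).
have sf : (size f <= n)%N by rewrite leq_maxl.
have sg : (size g <= n)%N by rewrite leq_maxr.
have sfg : (size (a *: f + g)%R <= n)%N.
  rewrite (leq_trans (size_polyD _ _))// geq_max sg andbT.
  by rewrite (leq_trans (size_scale_leq _ _)).
rewrite (evE x sf) (evE x sg) (evE x sfg) scaler_sumr -big_split/=.
by apply: eq_bigr => i _; rewrite coefD coefZ scalerDl scalerA.
Qed.

HB.instance Definition _ x := GRing.isLinear.Build R {poly R} V _
  (ev x) (ev_is_linear x).

Lemma evXn x n : ev x 'X^n = x n.
Proof.
rewrite (@evE x n.+1) ?size_polyXn// big_ord_recr/= big1 ?add0r.
  by rewrite coefXn eqxx scale1r.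
by move=> i _; rewrite coefXn (ltn_eqF (ltn_ord i)) scale0r.
Qed.

Lemma ev_sum x (I : Type) (r : seq I) (P : pred I) (a : I -> R) (m : I -> nat) :
  ev x (\sum_(i <- r | P i) a i *: 'X^(m i)) = \sum_(i <- r | P i) a i *: x (m i).
Proof. by rewrite linear_sum; apply: eq_bigr => i _; rewrite linearZ/= evXn. Qed.

Lemma ev_spread x phi q : ev x (spread phi q) = ev (x \o phi) q.
Proof. by rewrite /spread ev_sum. Qed.

Lemma ev_blow x M q : ev x (blow M q) = lincomb (size q) (fun i => q`_i) (block_average x M).
Proof.
rewrite (blowE M (leqnn (size q))) /bsum linear_sum; apply: eq_bigr => i _.
rewrite -scalerAr linearZ/=; congr (_ *: _).
rewrite avg.unlock -scalerAr linearZ/= /block_average; congr (_ *: _).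
rewrite mulr_sumr linear_sum/= -{2}[(i * M)%N]add0n big_addn mulSn addnK big_mkord.
by apply: eq_bigr => j _; rewrite -exprD evXn addnC.
Qed.

End Ev.

(** * Conditional spreading bases *)

Section ConditionalSpreading.
Variables (R : realType) (X : completeNormedModType R) (e : nat -> X).
Variables (p : X -> R) (zN : {poly R} -> R).
Hypothesis hp : equivalent_norm p.
Hypothesis hbasis : schauder_basis e.
Hypothesis hcond : ~ unconditional_basis e.
Let N (q : {poly R}) := p (ev e q).
Hypothesis hN : spreading_seminorm N.
Hypothesis hz : forall q eps, 0 < eps ->
  exists M0, forall M, (M0 <= M)%N -> `|N (blow M q) - zN q| <= eps.

Implicit Types u w q : {poly R}.

Let sp : seminorm p := equivalent_norm_seminorm hp.
Let sN : seminorm N := hN.1.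

Lemma spN1_ge0 : 0 <= N 1. Proof. exact: semi_ge0 sN _. Qed.

(** A far section of a rearranged series is a 0-1 mask of a section of the original series, hence
    small by the Cauchy criterion. *)
Lemma masks_unconditional (C : R) : 0 < C ->
  (forall n (a : nat -> R) (chi : nat -> bool),
    N (\sum_(i < n) ((chi i)%:R * a i) *: 'X^i) <= C * N (\sum_(i < n) a i *: 'X^i)) ->
  unconditional_basis e.
Proof.
move=> C0 H; split=> // a ca s bs.
have si : injective s by exact: bij_inj.
have [g sK gK] := bs.
pose l := limn (series (fun i => a i *: e i)).
have cl0 : series (fun i => a i *: e i) @ \oo --> l by [].
have /(pcvgP hp) cl := cl0.
apply: (pcauchy_cvg hp) => eps e0.
have e20 : 0 < eps / (2 * C) by rewrite divr_gt0// mulr_gt0.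
have [N0 hN0] := cl _ e20.
(* Past [n0], the permutation [s] avoids all indices below [N0]. *)
pose n0 := (\max_(j < N0) (g j).+1)%N.
have hn0 i : (n0 <= i)%N -> (N0 <= s i)%N.
  move=> n0i; rewrite leqNgt; apply/negP => sN0.
  have := @leq_bigmax _ (fun j : 'I_N0 => (g j).+1) (Ordinal sN0).
  by rewrite /= sK -/n0 ltnNge n0i.
exists n0 => n nn.
rewrite sub_series_geq//.
pose r := map s (index_iota n0 n).
pose L := (\max_(j <- r) j.+1 + N0)%N.
have rL j : j \in r -> (N0 <= j < L)%N.
  move=> jr; have jL : (j < L)%N.
    by apply: (leq_trans _ (leq_addr _ _)); rewrite (big_rem j)//= leq_max leqnn.
  rewrite jL andbT; move: jr => /mapP[i]; rewrite mem_index_iota => /andP[h _] ->.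
  exact: hn0.
have ur : uniq r by rewrite map_inj_uniq// iota_uniq.
pose b j := if (N0 <= j)%N then a j else 0.
have -> : \sum_(n0 <= k < n) a (s k) *: e (s k) =
    ev e (\sum_(j < L) ((nat_of_ord j \in r)%:R * b j) *: 'X^j).
  rewrite ev_sum -(big_map s xpredT (fun j => a j *: e j)) -/r.
  have pr : perm_eq r [seq j <- index_iota 0 L | j \in r].
    apply: uniq_perm; rewrite ?filter_uniq ?iota_uniq// => j.
    rewrite mem_filter mem_index_iota leq0n/=.
    by apply/idP/andP => [jr|[]//]; split=> //; have /andP[] := rL _ jr.
  rewrite (perm_big _ pr)/= big_filter big_mkord big_mkcond/=.
  apply: eq_bigr => j _; case: ifPn => jr; last by rewrite mul0r scale0r.
  by rewrite mul1r /b; have /andP[-> _] := rL _ jr.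
apply: (le_trans (H _ _ _)); rewrite -ler_pdivlMl//.
have -> : \sum_(i < L) b i *: 'X^i = \sum_(N0 <= i < L) a i *: 'X^i.
  rewrite -(big_mkord xpredT (fun i => b i *: 'X^i)).
  rewrite (big_cat_nat (n := N0)) ?leq_addl//= big_nat big1 ?add0r => [|i /andP[_ h]].
    rewrite big_nat [RHS]big_nat; apply: eq_bigr => i /andP[h _].
    by rewrite /b h.
  by rewrite /b leqNgt h scale0r.
rewrite /N ev_sum.
have -> : \sum_(N0 <= i < L) a i *: e i =
  (series (fun i => a i *: e i) L - l) - (series (fun i => a i *: e i) N0 - l).
  by rewrite opprB addrA subrK sub_series_geq// leq_addl.
apply: (le_trans (semiB sp _ _)).
have -> : C^-1 * eps = eps / (2 * C) + eps / (2 * C).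
  by field; rewrite gt_eqF.
by rewrite lerD// hN0// leq_addl.
Qed.

Lemma blow1 M : blow M 1 = avg M :> {poly R}.
Proof. by rewrite /blow comp_polyC mul1r. Qed.

(** If the averages tended to 0, every polynomial would be suppressible, in particular each single
    basis vector. All masks would then have norm at most 1, against conditionality. *)
Lemma zN1_gt0 : 0 < zN 1.
Proof.
have sz := zN_seminorm hN hz.
rewrite lt_def (semi_ge0 sz) andbT; apply/negP => /eqP z0.
apply: hcond; apply: (@masks_unconditional 1) => // n a chi; rewrite mul1r.
have sup q : suppressible N q.
  move=> eps e0; have [C C0 hC] := sp_avg_sum hN q.
  have e20 : 0 < eps / 2 by lra.
  have [M0 hM0] := eventually_invn C e20.
  have e30 : 0 < eps / 2 / (`|q.[1]| + 1) by rewrite divr_gt0// ltr_wpDl.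
  have [M1 hM1] := hz 1 e30.
  pose M := maxn M0.+1 M1; exists M; first by rewrite /M leq_max.
  have h1 := le_trans (hC M) (hM0 M (leq_maxl _ _)).
  have := hM1 M (leq_maxr _ _).
  rewrite blow1 z0 subr0 ger0_norm ?(semi_ge0 sN) => // h2.
  apply: (le_trans (semi_le_dist sN _ (q.[1] *: avg M))).
  have : N (q.[1] *: avg M) <= eps / 2.
    rewrite (semiZ sN); move: h2; rewrite ler_pdivlMr ?ltr_wpDl//.
    apply: le_trans; rewrite mulrC ler_wpM2l ?(semi_ge0 sN)//; lra.
  lra.
have E (b : nat -> R) : \sum_(i < n) b i *: 'X^i = bsum id (fun i => (b i)%:P) n.
  by rewrite /bsum; apply: eq_bigr => i _; rewrite mulrC mul_polyC.
rewrite (E a) (E (fun i => (chi i)%:R * a i)).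
have -> : bsum id (fun i => ((chi i)%:R * a i)%:P) n =
   bsum id (fun i => (chi i)%:R *: (a i)%:P) n.
  by rewrite /bsum; apply: eq_bigr => i _; rewrite -mul_polyC polyCM.
apply: (bsum_multipliers hN) => // k; last by case: (chi k); rewrite ?lexx ?ler01.
by rewrite -addn1 leq_add2l size_polyC leq_b1.
Qed.

Lemma bsum_avg M K : (0 < M)%N -> (0 < K)%N ->
  avg (M * K) = K%:R^-1 *: \sum_(i < K) 'X^(i * M) * avg M :> {poly R}.
Proof.
move=> M0 K0; rewrite -mulr_suml.
have Mn0 : M%:R != 0 :> R by rewrite pnatr_eq0 -lt0n.
have Kn0 : K%:R != 0 :> R by rewrite pnatr_eq0 -lt0n.
(* After multiplication by X - 1 both sides become the same multiple of X^(MK) - 1. *)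
have XM : ('X - 1 : {poly R}) != 0 by rewrite -size_poly_gt0 size_XsubC.
apply: (mulfI XM); rewrite avg.unlock -!scalerAr scalerA -invfM -natrM mulnC.
congr (_ *: _); rewrite -subrX1 mulrCA -subrX1 mulrC.
under [in RHS]eq_bigr do rewrite mulnC exprM.
by rewrite mulnC exprM subrX1.
Qed.

(** Otherwise adjacent long averages are close, so [avg M] is close to each [avg (M * K)] and the
    averages converge. Their limit is fixed by the shift, so its coordinates satisfy a_0 = 0 and
    a_(i+1) = a_i; it is 0, which contradicts [zN1_gt0]. *)
Lemma zN_diff_gt0 : 0 < zN (1 - 'X).
Proof.
have sz := zN_seminorm hN hz.
rewrite lt_def (semi_ge0 sz) andbT; apply/negP => /eqP z0.
have near1 eps : 0 < eps -> exists2 M0, (0 < M0)%N & forall M, (M0 <= M)%N ->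
    N (avg M - 'X^M * avg M) <= eps.
  move=> e0; have [M0 hM0] := hz (1 - 'X) e0; exists M0.+1 => // M /ltnW/hM0.
  by rewrite z0 subr0 ger0_norm ?(semi_ge0 sN)// linearB/= blow1 -['X]expr1 blowXn mul1n.
have near2 eps : 0 < eps -> exists2 M0, (0 < M0)%N & forall M K, (M0 <= M)%N -> (0 < K)%N ->
    N (avg M - avg (M * K)) <= eps.
  move=> e0; have [M0 M00 hM0] := near1 _ e0; exists M0 => // M K MM K0.
  have M0' : (0 < M)%N by exact: leq_trans MM.
  have Kn0 : K%:R != 0 :> R by rewrite pnatr_eq0 -lt0n.
  have {1}-> : avg M = K%:R^-1 *: \sum_(i < K) avg M :> {poly R}.
    by rewrite sumr_const card_ord -[avg M *+ K]scaler_nat scalerA mulVf// scale1r.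
  rewrite bsum_avg// -scalerBr -sumrB (semiZ sN) ger0_norm ?invr_ge0//.
  rewrite ler_pdivrMl ?ltr0n// (le_trans (semi_sum sN _ _ _))//.
  apply: (@le_trans _ _ (\sum_(i < K) eps)); last by rewrite sumr_const card_ord mulr_natl.
  apply: ler_sum => i _; have [->|i0] := posnP i.
    by rewrite mul0n expr0 mul1r subrr (semi0 sN) ltW.
  have := hM0 M MM; rewrite -!mulrN.
  by rewrite -(sp_gap hN (i.-1 * M) _ (size_avg R M)) -mulSn prednK.
pose v M := ev e (avg M).
have cv : cvgn v.
  apply: (pcauchy_cvg hp) => eps e0; have e20 : 0 < eps / 2 by lra.
  have [M0 M00 hM0] := near2 _ e20; exists M0 => M MM.
  have M0' : (0 < M)%N by exact: leq_trans MM.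
  rewrite /v -linearB/= -/(N _).
  (* Two lengths are compared through their product. *)
  have -> : avg M - avg M0 = (avg M - avg (M * M0)) - (avg M0 - avg (M0 * M)) :> {poly R}.
    by rewrite [in avg (M0 * M)]mulnC opprB addrA subrK.
  rewrite (le_trans (semiB sN _ _))//.
  have := hM0 M M0 MM M00; have := hM0 M0 M (leqnn _) M0'; lra.
pose c := limn v.
have /(pcvgP hp) vc : v @ \oo --> c by [].
have [a [ha ua]] := hbasis c.
have /(pcvgP hp) ha' := ha.
pose Q n : {poly R} := \sum_(i < n) a i *: 'X^i.
have evQ n : ev e (Q n) = series (fun i => a i *: e i) n.
  by rewrite /Q ev_sum /series/= big_mkord.
(* Coefficients of the shifted series; it also converges to [c], so uniqueness of coordinates gives
   [a = a']. *)
pose a' j := if j is i.+1 then a i else 0.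
have evXQ n : ev e ('X * Q n) = series (fun i => a' i *: e i) n.+1.
  rewrite /series/= big_mkord big_ord_recl/= scale0r add0r /Q mulr_sumr.
  under [in ev e _]eq_bigr do rewrite -scalerAr -exprS.
  by rewrite ev_sum.
have ha2 : series (fun i => a' i *: e i) @ \oo --> c.
  rewrite -cvg_shiftS; apply/(pcvgP hp) => eps e0.
  have e40 : 0 < eps / 4 by lra.
  have [n0 hn0] := ha' _ e40; exists n0 => n /hn0 hn /=.
  have [M0 hM0] := vc _ e40.
  have [M1 hM1] := eventually_invn (2 * N 1) e40.
  pose M := maxn M0 M1.+1.
  have h1 := hM0 M (leq_maxl _ _); have h2 := hM1 M (leq_maxr _ _).
  have M00 : (0 < M)%N by rewrite leq_max orbT.
  have Mn0 : M%:R != 0 :> R by rewrite pnatr_eq0 -lt0n.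
  rewrite -evXQ.
  have h3 : N ('X * avg M - avg M) <= eps / 4.
    apply: le_trans h2; rewrite -{2}[avg M]mul1r -mulrBl avg.unlock -scalerAr -subrX1.
    rewrite (semiZ sN) ger0_norm ?invr_ge0// ler_wpM2l ?invr_ge0//.
    by rewrite (le_trans (semiB sN _ _))// spX// mulr_natl mulr2n.
  have h4 : N ('X * (Q n - avg M)) <= eps / 2.
    rewrite -['X]expr1 sp_shift// /N linearB/= evQ -[ev e _]/(v M).
    have -> : series (fun i => a i *: e i) n - v M =
      (series (fun i => a i *: e i) n - c) - (v M - c) by rewrite opprB addrA subrK.
    by rewrite (le_trans (semiB sp _ _))//; lra.
  have -> : ev e ('X * Q n) - c = ev e ('X * (Q n - avg M)) +
      ev e ('X * avg M - avg M) + (v M - c).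
    by rewrite mulrBr !linearB/= /v !addrA !subrK.
  rewrite (le_trans (semiD sp _ _))//.
  have := semiD sp (ev e ('X * (Q n - avg M))) (ev e ('X * avg M - avg M)).
  by move: h3 h4; rewrite /N; lra.
have aE : a = a' by exact: ua.
have a0 i : a i = 0 by elim: i => [|i IH]; rewrite aE.
have c0 : c = 0.
  apply: (@cvg_unique _ (@norm_hausdorff _ X) _ _ _ _ ha).
  rewrite (_ : series _ = fun=> 0); first exact: cvg_cst.
  by apply/funext => n; rewrite /series/= big1// => i _; rewrite a0 scale0r.
have : zN 1 <= 0.
  apply: (zN_le hz) => eps e0; have [M0 hM0] := vc _ e0.
  by exists M0 => M /hM0; rewrite c0 subr0 add0r blow1.
by rewrite leNgt zN1_gt0.
Qed.

Lemma sp_avg_tail m u w M : (0 < M)%N -> (size u <= m)%N ->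
  N (u + 'X^m * (w * avg M)) <= N (u + 'X^m * w).
Proof.
move=> M0 um.
have Mn0 : M%:R != 0 :> R by rewrite pnatr_eq0 -lt0n.
have -> : u + 'X^m * (w * avg M) = M%:R^-1 *: \sum_(j < M) (u + 'X^(m + j) * w).
  rewrite big_split/= sumr_const card_ord scalerDr -[u *+ M]scaler_nat scalerA mulVf// scale1r.
  congr (_ + _); rewrite avg.unlock -!scalerAr !mulr_sumr; congr (_ *: _).
  by apply: eq_bigr => j _; rewrite exprD -mulrA [w * _]mulrC.
rewrite (semiZ sN) ger0_norm ?invr_ge0// ler_pdivrMl ?ltr0n//.
rewrite (le_trans (semi_sum sN _ _ _))//.
under eq_bigr => j _ do rewrite (sp_gap hN _ _ um).
by rewrite sumr_const card_ord mulr_natl.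
Qed.

(** Apply [zN_blocks] to the whole vector as one block, which bounds its sum, and to [u], [w] as two
    blocks. Subtracting leaves [u.[1] *: (1 - 'X)], and [zN (1 - 'X) > 0] bounds [u.[1]]. For the
    norm of [u], the tail is averaged until only its sum, already bounded, survives. *)
Lemma prefix_bounds : exists2 K, 0 < K & forall m u w, (size u <= m)%N ->
  [/\ `|u.[1]| <= K * N (u + 'X^m * w), `|w.[1]| <= K * N (u + 'X^m * w),
      N u <= K * N (u + 'X^m * w) & N w <= K * N (u + 'X^m * w)].
Proof.
have sz := zN_seminorm hN hz.
have k0 := zN1_gt0; have l0 := zN_diff_gt0.
set ka := zN 1 in k0; set la := zN (1 - 'X) in l0.
have N10 := spN1_ge0.
pose K1 := 2 / la; pose K2 := ka^-1 + K1; pose K3 := 1 + K2 * N 1.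
have K10 : 0 < K1 by rewrite divr_gt0.
have ki0 : 0 < ka^-1 by rewrite invr_gt0.
have K20 : 0 < K2 by rewrite addr_gt0.
have K30 : 0 < K3 by rewrite ltr_pwDl// mulr_ge0// ltW.
(* [K3] is counted twice because the norm of [w] needs [1 + K3], and [K3 >= 1]. *)
exists (K1 + K2 + K3 + K3) => [|m u w um]; first by lra.
set v := u + _.
have Nv0 : 0 <= N v by exact: semi_ge0 sN _.
have hv : v.[1] = u.[1] + w.[1] by rewrite /v !hornerE expr1n mul1r.
have h1 : `|v.[1]| * ka <= N v.
  have := @zN_blocks _ _ _ hN hz (fun k => k * size v)%N (fun=> v) 1.
  rewrite /bsum !big_ord1 expr0 mul1r -mul_polyC mulr1 -[_%:P]mulr1 mul_polyC (semiZ sz).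
  by apply => k; rewrite mulSn addnC.
have h2 : zN (u.[1] *: 1 + w.[1] *: 'X) <= N v.
  have := @zN_blocks _ _ _ hN hz (fun k => if k is j.+1 then m + j * size w else 0)%N
    (fun k => if k is j.+1 then w else u) 2.
  rewrite /bsum !big_ord_recl !big_ord0/= !addr0 !expr0 mul1r mul0n addn0.
  rewrite -[bump 0 0]/1%N expr1 => h; apply: h => -[|k] _ //=; rewrite ?addn0// mulSn; lia.
have h3 : `|u.[1]| * la <= 2 * N v.
  rewrite -(semiZ sz).
  have -> : u.[1] *: (1 - 'X) = (u.[1] *: 1 + w.[1] *: 'X) - v.[1] *: 'X.
    by rewrite hv scalerDl scalerBr opprD addrACA addrAC; rewrite -!mul_polyC; ring.
  rewrite (le_trans (semiB sz _ _))// (semiZ sz) -['X]expr1 (spX (zN_spreading hN hz)).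
  by move: h1 h2; rewrite -['X]expr1 /ka; lra.
have u1 : `|u.[1]| <= K1 * N v by rewrite /K1 mulrAC ler_pdivlMr.
have v1 : `|v.[1]| <= ka^-1 * N v by rewrite mulrC ler_pdivlMr.
have w1 : `|w.[1]| <= K2 * N v.
  have -> : w.[1] = v.[1] - u.[1] by rewrite hv addrAC subrr add0r.
  by rewrite (le_trans (ler_normB _ _))// /K2 mulrDl lerD.
have Nu : N u <= K3 * N v.
  apply/ler_addgt0Pr => eps e0.
  have [C C0 hC] := sp_avg_sum hN w.
  have [M0 hM0] := eventually_invn C e0.
  have h4 := sp_avg_tail w (ltn0Sn M0) um; rewrite -/v in h4.
  have h5 := le_trans (hC M0.+1) (hM0 _ (ltnSn _)).
  have E : u = (u + 'X^m * (w * avg M0.+1)) - 'X^m * (w * avg M0.+1 - w.[1] *: avg M0.+1)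
     - 'X^m * (w.[1] *: avg M0.+1).
    by rewrite mulrBr opprB addrA addrAC -addrA addrAC; rewrite -!mul_polyC; ring.
  have h6 : N ('X^m * (w.[1] *: avg M0.+1)) <= K2 * N v * N 1.
    rewrite (sp_shift hN) (semiZ sN) ler_pM ?(semi_ge0 sN)//.
    by have := sp_avg hN 1 M0.+1; rewrite mul1r.
  rewrite E (le_trans (semiB sN _ _))//.
  have := semiB sN (u + 'X^m * (w * avg M0.+1)) ('X^m * (w * avg M0.+1 - w.[1] *: avg M0.+1)).
  rewrite (sp_shift hN m (_ - _)) /K3 mulrDl mul1r mulrAC; lra.
have Nw : N w <= (1 + K3) * N v.
  rewrite -(sp_shift hN m).
  have -> : 'X^m * w = v - u by rewrite /v addrAC subrr add0r.
  by rewrite (le_trans (semiB sN _ _))// mulrDl mul1r lerD.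
have mono (A B : R) : A <= B -> A * N v <= B * N v by move=> AB; rewrite ler_wpM2r.
have N1K : 0 <= K2 * N 1 by rewrite mulr_ge0// ltW.
split.
- by apply: (le_trans u1); apply: mono; lra.
- by apply: (le_trans w1); apply: mono; lra.
- by apply: (le_trans Nu); apply: mono; lra.
- by apply: (le_trans Nw); apply: mono; rewrite /K3 in K30 *; lra.
Qed.

Lemma N_diff_le q : N (diff_poly q) <= 2 * N q.
Proof.
have inc0 : increasing_seq (fun i => i.*2) by apply: increasing_ltn => i; lia.
have inc1 : increasing_seq (fun i => i.*2.+1) by apply: increasing_ltn => i; lia.
have -> : diff_poly q = spread double q - spread (fun i => i.*2.+1) q.
  rewrite {1}(polyE (leqnn (size q))) linear_sum/= /spread -sumrB.
  by apply: eq_bigr => i _; rewrite linearZ/= diff_polyXn scalerBr.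
by rewrite (le_trans (semiB sN _ _))// !hN.2// mulr_natl mulr2n.
Qed.

(* Otherwise [(e_i)] would be equivalent to the unit vector basis of [l_1]. *)
Lemma diff_avg_small eps : 0 < eps ->
  exists2 M, (0 < M)%N & N (diff_poly (avg M)) <= eps.
Proof.
move=> e0; apply: contrapT => ne.
have low M : (0 < M)%N -> eps <= N (diff_poly (avg M)).
  by move=> M0; rewrite leNgt; apply/negP => h; apply: ne; exists M => //; exact: ltW.
have sb := sp_sum_bound (diff_norm_spreading hN) low.
have E n (a : nat -> R) : \sum_(k < n) a k *: diff_poly 'X^k =
    diff_poly (\sum_(k < n) a k *: 'X^k).
  by rewrite linear_sum; apply: eq_bigr => k _; rewrite linearZ.
have sum1 n (a : nat -> R) : (\sum_(k < n) a k *: 'X^k).[1] = \sum_(k < n) a k.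
  by rewrite horner_sum; apply: eq_bigr => k _; rewrite !hornerE expr1n mulr1.
have l1 n (a : nat -> R) :
    eps * \sum_(k < n) `|a k| <= 2 * N (\sum_(k < n) a k *: diff_poly 'X^k).
  apply: (ell1_lower (p := N) (v := fun k => diff_poly 'X^k)) => // {}n {}a.
    by move=> th hth; rewrite (E n a) (E n (fun k => th k * a k)); exact: (diff_multipliers hN).
  move=> a0; rewrite E; have := sb (\sum_(k < n) a k *: 'X^k).
  by rewrite sum1 ger0_norm ?sumr_ge0// mulrC.
(* [l1] and [N_diff_le] give [eps] times the sum of absolute values at most 4 times the norm, and a
   masked vector has norm at most [N 1] times that sum; adding 1 keeps the constant positive. *)
apply: hcond; apply: (@masks_unconditional (4 * (N 1 + 1) / eps)).
  by have h := spN1_ge0; rewrite divr_gt0// mulr_gt0//; lra.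
move=> n a chi.
have := l1 n a; rewrite E => h; have h2 := N_diff_le (\sum_(k < n) a k *: 'X^k).
set B := N (\sum_(i < n) a i *: 'X^i) in h2 *.
have h3 : eps * \sum_(k < n) `|a k| <= 4 * B by lra.
apply: (@le_trans _ _ (N 1 * \sum_(k < n) `|a k|)).
  rewrite mulr_sumr; apply: (semi_sum_le sN) => k _.
  rewrite (semiZ sN) (spX hN) mulrC ler_wpM2l ?spN1_ge0// normrM.
  by case: (chi k); rewrite ?normr1 ?mul1r// normr0 mul0r.
rewrite mulrAC ler_pdivlMr// mulrAC -mulrA.
have S0 : 0 <= \sum_(k < n) `|a k| by apply: sumr_ge0.
have B0 : 0 <= B by exact: semi_ge0 sN _.
have N10 := spN1_ge0.
nra.
Qed.

End ConditionalSpreading.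

(** * Geometric sums, subsequences and gluing of blocks *)

Lemma geometric_sum_le (R : realType) m : \sum_(k < m) (2 ^- k : R) <= 2.
Proof.
have -> : \sum_(k < m) (2 ^- k : R) = 2 - 2 * 2 ^- m.
  elim: m => [|m IH]; first by rewrite big_ord0 expr0 invr1; lra.
  by rewrite big_ord_recr/= IH exprS invfM; lra.
by rewrite gerBl mulr_ge0// invr_ge0 exprn_ge0.
Qed.

Lemma exp2V_gt0 (R : realType) k : 0 < 2 ^- k :> R.
Proof. by rewrite invr_gt0 exprn_gt0. Qed.

Lemma exp2V_le (R : realType) i j : (i <= j)%N -> 2 ^- j <= 2 ^- i :> R.
Proof.
by move=> ij; rewrite lef_pV2 ?posrE ?exprn_gt0// ler_eXn2l// ltr1n.
Qed.

Lemma exp2V_small (R : realType) (eps : R) : 0 < eps -> exists k0, forall k, (k0 <= k)%N ->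
  2 ^- k <= eps.
Proof.
move=> e0; have [M0 hM] := eventually_invn 1 e0; exists M0.+1 => k kM.
apply: le_trans (hM k kM); rewrite mulr1 lef_pV2 ?posrE ?exprn_gt0 ?ltr0n//.
  by rewrite -natrX ler_nat ltnW// ltn_expl.
exact: leq_trans kM.
Qed.

(** Abel summation written with tail sums, since these are the coordinates with respect to the
    summing basis. *)
Lemma summation_by_parts (R : realType) (V : lmodType R) (g : nat -> R) (y : nat -> V) m :
  \sum_(k < m) g k *: y k = (\sum_(0 <= k < m) g k) *: y 0%N +
  \sum_(i < m) (\sum_(i.+1 <= k < m) g k) *: (y i.+1 - y i).
Proof.
pose T i := \sum_(i <= k < m) g k.
have gT k : (k < m)%N -> g k = T k - T k.+1.
  by move=> km; rewrite /T big_ltn// addrK.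
under eq_bigr => k _ do rewrite gT//.
rewrite -/(T 0%N); under [in RHS]eq_bigr => k _ do rewrite -/(T k.+1).
apply/eqP; rewrite -subr_eq -sumrB.
under eq_bigr => k _ do rewrite scalerBl scalerBr opprB addrA subrK.
have Tm : T m = 0 by rewrite /T big_geq.
have := telescope_sumr (fun k => T k *: y k) (leq0n m).
rewrite Tm scale0r sub0r big_mkord => h; apply/eqP/oppr_inj; rewrite -h -sumrN.
by apply: eq_bigr => k _; rewrite opprB.
Qed.

Lemma strictly_increasing_geq (phi : nat -> nat) :
  (forall k, phi k < phi k.+1)%N -> forall k, (k <= phi k)%N.
Proof. by move=> h; elim=> // k IH; exact: leq_ltn_trans IH (h k). Qed.

Lemma strictly_increasing_ltn (phi : nat -> nat) :
  (forall k, phi k < phi k.+1)%N -> forall i j, (i < j)%N -> (phi i < phi j)%N.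
Proof. by move=> h i j; rewrite (leqW_mono (increasing_ltn h)). Qed.

Lemma strictly_increasing_leq (phi : nat -> nat) :
  (forall k, phi k < phi k.+1)%N -> forall i j, (i <= j)%N -> (phi i <= phi j)%N.
Proof. by move=> h i j; have := increasing_ltn h i j; rewrite leEnat => ->. Qed.

Lemma bounded_pair_subseq (R : realType) (u v : nat -> R) (B : R) :
  (forall k, `|u k| <= B) -> (forall k, `|v k| <= B) ->
  exists phi sg t, [/\ (forall k, phi k < phi k.+1)%N,
    forall k, `|u (phi k) - sg| <= 2 ^- k & forall k, `|v (phi k) - t| <= 2 ^- k].
Proof.
move=> hu hv.
have bw (w : nat -> R) : (forall k, `|w k| <= B) ->
    exists f (l : R), increasing_seq f /\ (w \o f) @ \oo --> l.
  move=> hw; have [|f f1 f2] := @bolzano_weierstrass R w.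
    by exists B; split => [|y By k _ /=]; [exact: num_real|exact: le_trans (hw k) (ltW By)].
  by exists f, (limn (w \o f)).
have [f [sg [f1 /cvg_epsP fu]]] := bw u hu.
have [g [t [g1 /cvg_epsP gv]]] := bw (v \o f) (fun k => hv (f k)).
have inc (h : nat -> nat) : increasing_seq h -> forall k, (h k < h k.+1)%N.
  by move=> hh k; rewrite (leqW_mono hh).
have H (k0 k : nat) : exists m, [/\ (k0 <= m)%N, `|u (f (g m)) - sg| <= 2 ^- k &
    `|v (f (g m)) - t| <= 2 ^- k].
  have [n1 h1] := fu _ (exp2V_gt0 R k); have [n2 h2] := gv _ (exp2V_gt0 R k).
  exists (maxn k0 (maxn n1 n2)); split; first by rewrite leq_maxl.
    apply: h1; apply: (leq_trans _ (strictly_increasing_geq (inc _ g1) _)).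
    by rewrite !leq_max leqnn ?orbT.
  by apply: h2; rewrite !leq_max leqnn ?orbT.
pose ch k0 k := projT1 (cid (H k0 k)).
have chP k0 k : [/\ (k0 <= ch k0 k)%N, `|u (f (g (ch k0 k))) - sg| <= 2 ^- k &
    `|v (f (g (ch k0 k))) - t| <= 2 ^- k] by rewrite /ch; case: cid.
pose m := fix m (k : nat) : nat := if k is j.+1 then ch (m j).+1 k else ch 0%N 0%N.
have mP k : `|u (f (g (m k))) - sg| <= 2 ^- k /\ `|v (f (g (m k))) - t| <= 2 ^- k.
  by case: k => [|k] /=; [have [_] := chP 0%N 0%N|have [_] := chP (m k).+1 k.+1].
have mS k : (m k < m k.+1)%N by have [] := chP (m k).+1 k.+1.
exists (f \o g \o m), sg, t; split => k /=; [|exact: (mP k).1|exact: (mP k).2].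
by rewrite (leqW_mono f1) (leqW_mono g1).
Qed.

(* [Q j k0 k1 c] is a property of the restriction of [c] to [k0, k1[. *)
Lemma glue_blocks (R : realType) (Q : nat -> nat -> nat -> (nat -> R) -> Prop) :
  (forall j k0 k1 c c', (forall k, (k0 <= k < k1)%N -> c k = c' k) ->
    Q j k0 k1 c -> Q j k0 k1 c') ->
  (forall j k0, exists k1 c, [/\ (k0 < k1)%N, forall k, 0 <= c k & Q j k0 k1 c]) ->
  forall k0, exists l c, [/\ l 0%N = k0, (forall j, l j < l j.+1)%N,
    forall k, 0 <= c k & forall j, Q j (l j) (l j.+1) c].
Proof.
move=> ext ex k0.
have ex' j k : exists s : nat * (nat -> R),
    [/\ (k < s.1)%N, forall i, 0 <= s.2 i & Q j k s.1 s.2].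
  by have [k1 [c h]] := ex j k; exists (k1, c).
pose k1 j k := (projT1 (cid (ex' j k))).1.
pose cc j k := (projT1 (cid (ex' j k))).2.
have P j k : [/\ (k < k1 j k)%N, forall i, 0 <= cc j k i & Q j k (k1 j k) (cc j k)].
  by rewrite /cc /k1; case: cid.
pose l := fix l (j : nat) : nat := if j is i.+1 then k1 i (l i) else k0.
have lS j : (l j < l j.+1)%N by have [] := P j (l j).
have lt := strictly_increasing_ltn lS.
(* The intervals are disjoint, so at most one local choice of coefficients applies at [k]; the value
   0 is used below [l 0]. *)
have C k : exists a : R, 0 <= a /\ forall j, (l j <= k < l j.+1)%N -> a = cc j (l j) k.
  have [[j hj]|nj] := pselect (exists j, (l j <= k < l j.+1)%N); last first.
    by exists 0; split => // j hj; case: nj; exists j.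
  exists (cc j (l j) k); split; first by have [_] := P j (l j).
  move=> i hi; suff -> : i = j by [].
  move: hi hj => /andP[i1 i2] /andP[j1 j2].
  case: (ltngtP i j) => // ij.
    have : (l i.+1 <= l j)%N by move: ij; rewrite leq_eqVlt => /orP[/eqP->//|/lt/ltnW].
    by move=> h; move: (leq_trans i2 (leq_trans h j1)); rewrite ltnn.
  have : (l j.+1 <= l i)%N by move: ij; rewrite leq_eqVlt => /orP[/eqP->//|/lt/ltnW].
  by move=> h; move: (leq_trans j2 (leq_trans h i1)); rewrite ltnn.
pose c k := projT1 (cid (C k)).
exists l, c; split => // [k|j].
  by rewrite /c; case: cid => a [].
have [_ _] := P j (l j); apply: ext => k hk.
by have [_ hc] := projT2 (cid (C k)); rewrite /c (hc _ hk).
Qed.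

(** * Coordinates and the splitting of a weakly Cauchy sequence *)

Definition prefix_poly (R : realType) (a : nat -> R) (n : nat) : {poly R} :=
  \poly_(i < n) a i.

Lemma size_prefix_poly (R : realType) (a : nat -> R) n : (size (prefix_poly a n) <= n)%N.
Proof. exact: size_poly. Qed.

Lemma prefix_poly_split (R : realType) (a : nat -> R) n m : (n <= m)%N ->
  prefix_poly a m = prefix_poly a n + 'X^n * \poly_(j < m - n) a (n + j)%N.
Proof.
move=> nm; apply/polyP => i; rewrite coefD coefXnM !coef_poly.
case: (ltnP i n) => h; first by rewrite (leq_trans h nm) addr0.
by rewrite ltn_sub2rE// subnKC// add0r.
Qed.

Section Coordinates.
Variables (R : realType) (X : completeNormedModType R) (e : nat -> X) (p : X -> R) (K : R).
Hypothesis hp : equivalent_norm p.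
Hypothesis hbasis : schauder_basis e.
Let N (q : {poly R}) := p (ev e q).
Hypothesis hN : spreading_seminorm N.
Hypothesis K0 : 0 < K.
Hypothesis hK : forall m (u w : {poly R}), (size u <= m)%N ->
  [/\ `|u.[1]| <= K * N (u + 'X^m * w), `|w.[1]| <= K * N (u + 'X^m * w),
      N u <= K * N (u + 'X^m * w) & N w <= K * N (u + 'X^m * w)].

Let sp : seminorm p := equivalent_norm_seminorm hp.
Let sN : seminorm N := hN.1.

Definition coords (v : X) : nat -> R := projT1 (cid (hbasis v)).

Definition partial (n : nat) (v : X) : {poly R} := prefix_poly (coords v) n.

Lemma coords_cvg v : series (fun i => coords v i *: e i) @ \oo --> v.
Proof. by rewrite /coords; case: cid => a []. Qed.

Lemma coords_unique v a : series (fun i => a i *: e i) @ \oo --> v -> coords v = a.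
Proof. by have [_ hb] := projT2 (cid (hbasis v)); exact: hb. Qed.

Lemma ev_partial n v : ev e (partial n v) = series (fun i => coords v i *: e i) n.
Proof. by rewrite /partial /prefix_poly poly_def ev_sum /series/= big_mkord. Qed.

Lemma partial_cvg v eps : 0 < eps -> exists n0, forall n, (n0 <= n)%N ->
  p (v - ev e (partial n v)) <= eps.
Proof.
have /(pcvgP hp) h := @coords_cvg v.
by move=> /h[n0 hn]; exists n0 => n /hn; rewrite (semi_distC sp) ev_partial.
Qed.

Lemma coords_lin t u w i : coords (t *: u + w) i = t * coords u i + coords w i.
Proof.
suff -> : coords (t *: u + w) = fun i => t * coords u i + coords w i by [].
apply: coords_unique.
have -> : series (fun i => (t * coords u i + coords w i) *: e i) =
   t \*: series (fun i => coords u i *: e i) + series (fun i => coords w i *: e i).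
  apply/funext => n; rewrite /series/= fctE/= scaler_sumr -big_split/=.
  by apply: eq_bigr => j _; rewrite scalerDl scalerA.
apply: cvgD; last exact: coords_cvg.
by apply: cvgZr; exact: coords_cvg.
Qed.

Lemma partial_lin n t u w : partial n (t *: u + w) = t *: partial n u + partial n w.
Proof.
apply/polyP => i; rewrite coefD coefZ !coef_poly coords_lin.
by case: ifP => _ //; rewrite mulr0 addr0.
Qed.

Lemma coords_ev q i : coords (ev e q) i = q`_i.
Proof.
suff -> : coords (ev e q) = fun i => q`_i by [].
apply: coords_unique; apply/(pcvgP hp) => eps e0; exists (size q) => n nq.
rewrite /series/= big_mkord -(evE e nq) subrr (semi0 sp); exact: ltW.
Qed.

(** A partial sum of [v] is a prefix of a longer one that approximates [v], to which the prefix
    estimates [hK] apply. *)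
Lemma partial_bounds n v :
  `|(partial n v).[1]| <= K * p v /\ N (partial n v) <= K * p v.
Proof.
suff H eps : 0 < eps -> `|(partial n v).[1]| <= K * (p v + eps) /\
    N (partial n v) <= K * (p v + eps).
  split; apply/ler_addgt0Pr => eps e0; have [] := H _ (divr_gt0 e0 K0);
  by rewrite mulrDr [K * (_ / _)]mulrC divfK// gt_eqF.
move=> e0; have [n0 hn] := partial_cvg v e0.
pose m := maxn n n0.
have nm : (n <= m)%N by exact: leq_maxl.
have h : N (partial m v) <= p v + eps.
  rewrite /N (le_trans (semi_le_dist sp _ v))// lerD// (semi_distC sp) hn//.
  exact: leq_maxr.
have [h1 _ h2 _] := hK (\poly_(j < m - n) coords v (n + j)%N) (size_prefix_poly (coords v) n).
rewrite -prefix_poly_split// in h1 h2.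
by split; [apply: (le_trans h1)|apply: (le_trans h2)]; rewrite ler_wpM2l// ltW.
Qed.

Lemma continuous_le_p (f : {linear X -> R^o}) (D : R) : 0 <= D ->
  (forall u, `|f u| <= D * p u) -> continuous f.
Proof.
move=> D0 fD; have [_ _ [c [C [c0 C0 cC]]]] := hp.
apply: (@bounded_linear_cts _ _ _ f (D * C)) => u.
by rewrite (le_trans (fD u))// -mulrA ler_wpM2l//; have /andP[] := cC u.
Qed.

Lemma coords_bound v i : `|coords v i| <= 2 * K * p v.
Proof.
have h1 := (partial_bounds i v).1; have h2 := (partial_bounds i.+1 v).1.
have E : coords v i = (partial i.+1 v).[1] - (partial i v).[1].
  rewrite (horner1_sum (size_prefix_poly _ _)) (horner1_sum (size_prefix_poly _ _)).
  rewrite big_ord_recr/= coef_poly ltnSn addrC.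
  rewrite (eq_bigr (fun j : 'I_i => (partial i v)`_j)) ?addrK// => j _.
  by rewrite !coef_poly ltn_ord (ltn_trans (ltn_ord j)).
by rewrite E (le_trans (ler_normB _ _))//; lra.
Qed.

Section WeakCauchySequence.
Variable x : nat -> X.
Hypothesis wx : weakly_cauchy x.

Lemma coords_limit j : exists a : R, (fun i => coords (x i) j) @ \oo --> a.
Proof.
have lf : linear ((fun v => coords v j) : X -> R^o) by move=> t u w; exact: coords_lin.
have [f fE] := linear_pack lf.
have fc : continuous f.
  apply: (@continuous_le_p f (2 * K)) => [|u]; first by rewrite mulr_ge0// ltW.
  by rewrite fE coords_bound.
have cf := wx fc; exists (limn (f \o x)).
by rewrite (_ : (fun i => _) = f \o x)//; apply/funext => i /=; rewrite fE.
Qed.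

Definition limit_coords (j : nat) : R := projT1 (cid (coords_limit j)).

Local Notation Y := (prefix_poly limit_coords).

Lemma limit_partial_cvg n eps : 0 < eps ->
  exists i0, forall i, (i0 <= i)%N -> N (partial n (x i) - Y n) <= eps.
Proof.
have N10 : 0 < N 1 + 1 by have := semi_ge0 sN 1; lra.
elim: n eps => [|n IH] eps e0.
  exists 0%N => i _; rewrite (_ : _ - _ = 0) ?(semi0 sN) ?ltW//.
  by apply/polyP => j; rewrite coefB !coef_poly/= subrr coef0.
have e20 : 0 < eps / 2 by lra.
have [i1 h1] := IH _ e20.
have /cvg_epsP h2 : (fun i => coords (x i) n) @ \oo --> limit_coords n.
  by rewrite /limit_coords; case: cid.
have [i2 {}h2] := h2 _ (divr_gt0 e20 N10).
exists (maxn i1 i2) => i; rewrite geq_max => /andP[/h1 {}h1 /h2 {}h2].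
have -> : partial n.+1 (x i) - Y n.+1 = (partial n (x i) - Y n) +
    (coords (x i) n - limit_coords n) *: 'X^n.
  rewrite /partial /prefix_poly !poly_def !big_ord_recr/= opprD addrACA; congr (_ + _).
  by rewrite scalerBl.
rewrite (le_trans (semiD sN _ _))// (semiZ sN) (spX hN).
move: h2; rewrite ler_pdivlMr// => h2.
have : `|coords (x i) n - limit_coords n| * N 1 <= eps / 2.
  by apply: le_trans h2; rewrite ler_wpM2l//; lra.
lra.
Qed.

(** [Y n] is the limit of the truncations of [x i], and weak Cauchyness bounds [x] in norm.
    Boundedness is all that is obtained here: the series with coefficients [limit_coords] need not
    converge. *)
Lemma limit_partial_bound : exists2 B, 0 < B &
  [/\ forall i, p (x i) <= B, forall n, N (Y n) <= B & forall n, `|(Y n).[1]| <= B].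
Proof.
have [M hM] := weakly_cauchy_bounded wx.
have [_ _ [c [C [c0 C0 cC]]]] := hp.
pose B0 := C * `|M| + 1.
have B00 : 0 < B0 by rewrite ltr_wpDl// mulr_ge0// ltW.
have px i : p (x i) <= B0.
  have /andP[_ h] := cC (x i); rewrite (le_trans h)// /B0.
  have : C * `|x i| <= C * `|M| by rewrite ler_pM2l// (le_trans (hM i))// ler_norm.
  lra.
have NY n : N (Y n) <= K * B0.
  apply/ler_addgt0Pr => eps e0; have [i0 h] := limit_partial_cvg n e0.
  rewrite (le_trans (semi_le_dist sN _ (partial n (x i0))))// lerD//.
    by rewrite (le_trans (partial_bounds _ _).2)// ler_pM2l.
  by rewrite (semi_distC sN) h.
have SY n : `|(Y n).[1]| <= K * (K * B0).
  have [h _ _ _] := hK 0 (size_prefix_poly limit_coords n).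
  by rewrite mulr0 addr0 in h; rewrite (le_trans h)// ler_pM2l.
have KB : 0 < K * B0 by rewrite mulr_gt0.
have KKB : 0 < K * (K * B0) by rewrite mulr_gt0.
exists (B0 + K * B0 + K * (K * B0)); first by lra.
split=> [i|n|n].
- by rewrite (le_trans (px i))//; lra.
- by rewrite (le_trans (NY n))//; lra.
- by rewrite (le_trans (SY n))//; lra.
Qed.

(** The rates [2 ^- k] are summable and survive passing to a subsequence. *)
Definition block_splitting (iota n : nat -> nat) (r : nat -> {poly R}) (sg t : R) : Prop :=
  [/\ (forall k, iota k < iota k.+1)%N, (forall k, n k < n k.+1)%N, successive n r,
      forall k, `|(Y (n k)).[1] - sg| <= 2 ^- k /\ `|(r k).[1] - t| <= 2 ^- k &
      forall k, p (x (iota k) - ev e (Y (n k) + 'X^(n k) * r k)) <= 2 ^- k].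

Lemma block_splitting_subseq iota n r sg t phi : (forall k, phi k < phi k.+1)%N ->
  block_splitting iota n r sg t -> block_splitting (iota \o phi) (n \o phi) (r \o phi) sg t.
Proof.
move=> hphi [g1 g2 g3 g4 g5].
have ge k : 2 ^- phi k <= 2 ^- k :> R by apply: exp2V_le; exact: strictly_increasing_geq.
split=> k /=.
- exact: strictly_increasing_ltn.
- exact: strictly_increasing_ltn.
- apply: (leq_trans (g3 (phi k))).
  exact: strictly_increasing_leq.
- by have [h1 h2] := g4 (phi k); split; [apply: (le_trans h1)|apply: (le_trans h2)].
- by apply: le_trans (ge k).
Qed.

(** First [i] is taken so late that the first [n0] coordinates of [x i] are almost those of [Y],
    then [n1] so large that [x i] is almost supported below it. *)
Lemma block_splitting_step n0 i0 eps : 0 < eps -> exists i n1 (r : {poly R}),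
  [/\ (i0 <= i)%N, (n0 < n1)%N, (n0 + size r <= n1)%N &
      p (x i - ev e (Y n0 + 'X^n0 * r)) <= eps].
Proof.
move=> e0; have e20 : 0 < eps / 2 by lra.
have [i1 h1] := limit_partial_cvg n0 e20.
pose i := maxn i0 i1.
have [n2 h2] := partial_cvg (x i) e20.
pose n1 := maxn n0.+1 n2.
have nn : (n0 <= n1)%N by rewrite /n1 leq_max leqnSn.
exists i, n1, (\poly_(j < n1 - n0) coords (x i) (n0 + j)%N); split.
- exact: leq_maxl.
- by rewrite leq_max ltnSn.
- by rewrite -leq_subRL// size_poly.
- have -> : x i - ev e (Y n0 + 'X^n0 * \poly_(j < n1 - n0) coords (x i) (n0 + j)%N) =
     (x i - ev e (partial n1 (x i))) + ev e (partial n0 (x i) - Y n0).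
    rewrite [partial n1 _](prefix_poly_split _ nn) !linearD/= linearN/=.
    by rewrite -[RHS]addrA; congr (_ + _); rewrite addrACA addNr add0r addrC.
  rewrite (le_trans (semiD sp _ _))//.
  have a1 := h2 n1 (leq_maxr _ _); have a2 := h1 i (leq_maxr _ _).
  by move: a1 a2; rewrite /N; lra.
Qed.

Lemma block_splitting_exists : exists iota n r sg t, block_splitting iota n r sg t.
Proof.
pose Q (s : nat * nat) k (s' : nat * nat * {poly R}) :=
  [/\ (s.1 < s'.1.1)%N, (s.2 < s'.1.2)%N, (s.2 + size s'.2 <= s'.1.2)%N &
      p (x s'.1.1 - ev e (Y s.2 + 'X^(s.2) * s'.2)) <= 2 ^- k].
have ex s k : exists s', Q s k s'.
  case: s => i0 n0; have [i [n1 [r h]]] := block_splitting_step n0 i0.+1 (exp2V_gt0 R k).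
  by exists (i, n1, r).
pose ch s k := projT1 (cid (ex s k)).
have chP s k : Q s k (ch s k) by rewrite /ch; case: cid.
pose st := fix st (k : nat) : nat * nat := if k is j.+1 then (ch (st j) j).1 else (0%N, 0%N).
(* The term of [x] chosen at step [k] is stored in the state [k.+1], while the index at which its
   block starts is in the state [k]. *)
pose io k := (st k.+1).1; pose n k := (st k).2; pose r k := (ch (st k) k).2.
have H k : [/\ ((st k).1 < io k)%N, (n k < n k.+1)%N, (n k + size (r k) <= n k.+1)%N &
      p (x (io k) - ev e (Y (n k) + 'X^(n k) * r k)) <= 2 ^- k].
  exact: chP (st k) k.
have [B B0 [hB1 hB2 hB3]] := limit_partial_bound.
(* One bound has to serve both this sequence and the sums of [Y (n k)], as [bounded_pair_subseq]
   takes a common bound. *)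
have hr k : `|(r k).[1]| <= K * (B + 1) + B.
  have [_ h _ _] := hK (r k) (size_prefix_poly limit_coords (n k)).
  have h2 : N (Y (n k) + 'X^(n k) * r k) <= B + 1.
    rewrite /N (le_trans (semi_le_dist sp _ (x (io k))))// lerD//.
    rewrite (semi_distC sp); have [_ _ _ h3] := H k; apply: (le_trans h3).
    by have := @exp2V_le R 0 k (leq0n _); rewrite expr0 invr1.
  apply: (le_trans h); apply: (@le_trans _ _ (K * (B + 1))); first by rewrite ler_pM2l.
  by rewrite lerDl ltW.
have hY k : `|(Y (n k)).[1]| <= K * (B + 1) + B.
  by rewrite (le_trans (hB3 _))// lerDr mulr_ge0// ltW//; lra.
have [phi [sg [t [p1 p2 p3]]]] := bounded_pair_subseq hY hr.
have ioS k : (io k < io k.+1)%N by have [] := H k.+1.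
have nS k : (n k < n k.+1)%N by have [] := H k.
exists (io \o phi), (n \o phi), (r \o phi), sg, t; split => k /=.
- exact: strictly_increasing_ltn.
- exact: strictly_increasing_ltn.
- have [_ _ h _] := H (phi k); apply: (leq_trans h).
  exact: strictly_increasing_leq.
- by split.
- have [_ _ _ h] := H (phi k); apply: (le_trans h).
  by apply: exp2V_le; exact: strictly_increasing_geq.
Qed.

End WeakCauchySequence.
End Coordinates.

Lemma eq_combination (R : realType) (V : lmodType R) (w : nat -> V) i j (c c' : nat -> R) :
  (forall k, (i <= k < j)%N -> c k = c' k) ->
  \sum_(i <= k < j) c k *: w k = \sum_(i <= k < j) c' k *: w k.
Proof. by move=> h; apply: eq_big_nat => k /h ->. Qed.

(** * Convex block combinations *)

Section BlockCombinations.
Variables (R : realType) (V : lmodType R) (e : nat -> V) (p : V -> R).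
Hypothesis sp : seminorm p.
Let N (q : {poly R}) := p (ev e q).
Hypothesis hN : spreading_seminorm N.
Hypothesis hphi : forall eps, 0 < eps ->
  exists2 M, (0 < M)%N & N (diff_poly (avg M)) <= eps.

Let sN : seminorm N := hN.1.
Let N10 : 0 <= N 1 := semi_ge0 sN 1.

Variables (a : nat -> R) (sg B : R).
Local Notation Y := (prefix_poly a).
Hypothesis hB : forall n, N (Y n) <= B.

(* The increments of [Y] along [n] are zero-sum blocks up to a summable error, so
   their linear combinations are controlled by the supremum of the coefficients. *)
Lemma prefix_combination_bound (n : nat -> nat) (g : nat -> R) m A :
  (forall k, n k < n k.+1)%N -> (forall k, `|(Y (n k)).[1] - sg| <= 2 ^- k) ->
  (forall i, (i <= m)%N -> `|\sum_(i <= k < m) g k| <= A) ->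
  N (\sum_(k < m) g k *: Y (n k)) <= (5 * B + 12 * N 1) * A.
Proof.
move=> hn hsg hA.
pose bl k : {poly R} := \poly_(j < n k.+1 - n k) a (n k + j)%N.
have YS k : Y (n k.+1) - Y (n k) = 'X^(n k) * bl k.
  by rewrite (prefix_poly_split a (ltnW (hn k))) addrAC subrr add0r.
have Sb k : `|(bl k).[1]| <= 2 * 2 ^- k.
  have -> : (bl k).[1] = ((Y (n k.+1)).[1] - sg) - ((Y (n k)).[1] - sg).
    rewrite opprB addrA subrK -hornerN -hornerD YS.
    by rewrite !hornerE expr1n mul1r.
  rewrite (le_trans (ler_normB _ _))//.
  have h1 := hsg k; have h2 := hsg k.+1; have h3 := @exp2V_le R k k.+1 (leqnSn _).
  lra.
pose zb k := bl k - (bl k).[1]%:P.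
have zb1 k : suppressible N (zb k).
  by apply: (zero_sum_suppressible hN); rewrite /zb !hornerE subrr.
have succ : successive n zb.
  move=> k; rewrite -leq_subRL; last exact: ltnW.
  rewrite /zb (leq_trans (size_polyD _ _))// geq_max size_poly size_polyN.
  rewrite (leq_trans (size_polyC_leq1 _))// subn_gt0; exact: hn.
have split (tau : nat -> R) : \sum_(i < m) tau i *: (Y (n i.+1) - Y (n i)) =
    bsum n (fun i => tau i *: zb i) m + \sum_(i < m) (tau i * (bl i).[1]) *: 'X^(n i).
  rewrite /bsum -big_split/=; apply: eq_bigr => i _.
  by rewrite YS /zb -!mul_polyC !polyCM; ring.
have err (tau : nat -> R) A' : 0 <= A' -> (forall i, (i < m)%N -> `|tau i| <= A') ->
    N (\sum_(i < m) (tau i * (bl i).[1]) *: 'X^(n i)) <= 4 * N 1 * A'.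
  move=> A0 htau.
  apply: (@le_trans _ _ (\sum_(i < m) (2 * N 1 * A') * 2 ^- i)).
    apply: (semi_sum_le sN) => i _; rewrite (semiZ sN) (spX hN) normrM.
    have h1 := htau i (ltn_ord i); have h2 := Sb i.
    have : `|tau i| * `|(bl i).[1]| <= A' * (2 * 2 ^- i) by rewrite ler_pM.
    move=> h; have := ler_wpM2r N10 h; lra.
  rewrite -mulr_sumr; have h := geometric_sum_le R m.
  have h0 : 0 <= 2 * N 1 * A' by rewrite !mulr_ge0.
  by have := ler_wpM2l h0 h; lra.
have A0 : 0 <= A by apply: le_trans (hA m (leqnn m)).
have hzb : N (bsum n zb m) <= 2 * B + 4 * N 1.
  have h1 : N (\sum_(i < m) (1 * (bl i).[1]) *: 'X^(n i)) <= 4 * N 1 * 1.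
    by apply: (err (fun=> 1)) => // i _; rewrite normr1.
  have -> : bsum n zb m = (Y (n m) - Y (n 0%N)) -
      \sum_(i < m) (1 * (bl i).[1]) *: 'X^(n i).
    have := split (fun=> 1); rewrite (eq_bigr (fun i : 'I_m => Y (n i.+1) - Y (n i))).
      rewrite -(big_mkord xpredT (fun i => Y (n i.+1) - Y (n i))) telescope_sumr// => ->.
      rewrite addrK /bsum; apply: eq_bigr => i _; by rewrite scale1r.
    by move=> i _; rewrite scale1r.
  rewrite (le_trans (semiB sN _ _))//.
  have := semiB sN (Y (n m)) (Y (n 0%N)); have := hB (n m); have := hB (n 0%N); lra.
have hT i : (i < m)%N -> `|\sum_(i.+1 <= k < m) g k| <= A by move=> im; exact: hA.
(* The leading term costs [A * B], the zero-sum blocks [2 * A * (2 * B + 4 * N 1)] and their sums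
   [4 * N 1 * A]. *)
rewrite (summation_by_parts g (fun k => Y (n k))).
rewrite (split (fun i => \sum_(i.+1 <= k < m) g k)).
rewrite (le_trans (semiD sN _ _))// (semiZ sN).
have h1 : `|\sum_(0 <= k < m) g k| * N (Y (n 0%N)) <= A * B by rewrite ler_pM ?(semi_ge0 sN)// hA.
have h2 := bsum_bounded_multipliers hN succ zb1 hT.
have h3 := err _ _ A0 hT.
have h4 := semiD sN (bsum n (fun i => (\sum_(i.+1 <= k < m) g k) *: zb i) m)
  (\sum_(i < m) ((\sum_(i.+1 <= k < m) g k) * (bl i).[1]) *: 'X^(n i)).
have h5 : 2 * A * N (bsum n zb m) <= 2 * A * (2 * B + 4 * N 1).
  by rewrite ler_wpM2l// mulr_ge0.
lra.
Qed.

(** A longer average is a mean of translates of the shorter one; this allows arbitrarily long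
    averages without losing smallness. *)
Lemma diff_avg_mul M K : (0 < M)%N -> (0 < K)%N ->
  N (diff_poly (avg (M * K))) <= N (diff_poly (avg M)).
Proof.
move=> M0 K0; rewrite bsum_avg// linearZ/= (semiZ sN) ger0_norm ?invr_ge0//.
rewrite ler_pdivrMl ?ltr0n// linear_sum/= (le_trans (semi_sum sN _ _ _))//.
under eq_bigr => i _ do rewrite [N _](sp_shift (diff_norm_spreading hN)).
by rewrite sumr_const card_ord mulr_natl.
Qed.

Lemma alternating_sum m : \sum_(k < m) (-1) ^+ k = (odd m)%:R :> R.
Proof.
elim: m => [|m IH]; first by rewrite big_ord0.
rewrite big_ord_recr/= IH -signr_odd.
by case: (odd m); rewrite ?expr1 ?expr0/= ?subrr ?add0r.
Qed.

Lemma alternating_poly L :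
  \sum_(k < L.*2) (-1) ^+ k *: 'X^k = diff_poly (\sum_(j < L) 'X^j) :> {poly R}.
Proof.
elim: L => [|L IH]; first by rewrite !big_ord0 linear0.
rewrite doubleS !big_ord_recr/= IH linearD/= diff_polyXn -addrA.
by rewrite -(signr_odd _ L.*2) exprS -(signr_odd _ L.*2) odd_double expr0 mulr1 scale1r scaleN1r.
Qed.

Variables (n : nat -> nat) (r : nat -> {poly R}) (t : R).
Hypothesis hn : forall k, (n k < n k.+1)%N.
Hypothesis hr : successive n r.
Hypothesis hsg : forall k, `|(Y (n k)).[1] - sg| <= 2 ^- k.
Hypothesis ht : forall k, `|(r k).[1] - t| <= 2 ^- k.
Hypothesis hweak : forall f : {linear V -> R^o}, (forall u, `|f u| <= p u) ->
  exists l : R, (fun k => f (ev e (Y (n k) + 'X^(n k) * r k))) @ \oo --> l.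

(** After the shift by ['X^(n k)] the subtracted constant sits at [e (n k)], inside the interval of
    the [k]-th block because [n] is strictly increasing. *)
Definition zero_sum_part (k : nat) : {poly R} := r k - (r k).[1]%:P.
Local Notation q := zero_sum_part.

Lemma successive_zero_sum_part : successive n q.
Proof.
move=> k; have := hr k; have := hn k => h1 h2.
rewrite -leq_subRL; last exact: ltnW.
rewrite /q (leq_trans (size_polyD _ _))// geq_max size_polyN.
rewrite (leq_trans (size_polyC_leq1 _)) ?subn_gt0// andbT.
by rewrite leq_subRL// ltnW.
Qed.

(* If the averages stayed away from [0], then [(q k)] would span [l_1]; a functional
   alternating in sign on it contradicts weak Cauchyness, since the alternating sums
   of the remaining part have norm of smaller order than their length. *)
Lemma small_convex_combination k0 eps : 0 < eps -> exists k1 c,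
  [/\ (k0 < k1)%N, forall k, 0 <= c k, \sum_(k0 <= k < k1) c k = 1 &
      N (\sum_(k0 <= k < k1) c k *: ('X^(n k) * q k)) <= eps].
Proof.
move=> e0; apply: contrapT => ne.
have low k1 c : (k0 < k1)%N -> (forall k, 0 <= c k) -> \sum_(k0 <= k < k1) c k = 1 ->
    eps <= N (\sum_(k0 <= k < k1) c k *: ('X^(n k) * q k)).
  move=> h1 h2 h3; rewrite leNgt; apply/negP => h; apply: ne; exists k1, c.
  by split => //; exact: ltW.
pose v k : {poly R} := 'X^(n (k0 + k)%N) * q (k0 + k)%N.
have pos m (b : nat -> R) : (forall k, 0 <= b k) ->
    eps * \sum_(k < m) b k <= N (\sum_(k < m) b k *: v k).
  move=> b0; set S := \sum_(k < m) b k.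
  have S0 : 0 <= S by exact: sumr_ge0.
  have [->|Sn0] := eqVneq S 0; first by rewrite mulr0 (semi_ge0 sN).
  have Sp : 0 < S by rewrite lt_def Sn0.
  have m0 : (0 < m)%N.
    rewrite lt0n; apply/eqP => m0; move/eqP: Sn0; apply.
    by rewrite /S m0 big_ord0.
  have := low (m + k0)%N (fun k => b (k - k0)%N / S) _ _ _.
  have shift (W : nmodType) (F : nat -> W) :
      \sum_(k0 <= k < m + k0) F k = \sum_(i < m) F (i + k0)%N.
    by rewrite -{1}[k0]add0n big_addn addnK big_mkord.
  rewrite !shift.
  have -> : \sum_(i < m) b (i + k0 - k0)%N / S = 1.
    by under eq_bigr do rewrite addnK; rewrite -mulr_suml divff.
  rewrite -{1}[k0]add0n ltn_add2r => /(_ m0 (fun k => divr_ge0 (b0 _) S0) erefl).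
  have -> : \sum_(i < m) (b (i + k0 - k0)%N / S) *: ('X^(n (i + k0)%N) * q (i + k0)%N) =
      S^-1 *: \sum_(k < m) b k *: v k.
    rewrite scaler_sumr; apply: eq_bigr => k _.
    by rewrite addnK scalerA mulrC /v addnC.
  by rewrite (semiZ sN) gtr0_norm ?invr_gt0// ler_pdivlMl// mulrC.
have nS i j : (i <= j)%N -> (n i <= n j)%N by exact: strictly_increasing_leq.
have mult m (b th : nat -> R) : (forall k, 0 <= th k <= 1) ->
    N (\sum_(k < m) (th k * b k) *: v k) <= N (\sum_(k < m) b k *: v k).
  move=> hth.
  have E (c : nat -> R) : \sum_(k < m) c k *: v k =
      bsum (fun k => n (k0 + k)%N) (fun k => c k *: q (k0 + k)%N) m.
    by rewrite /bsum; apply: eq_bigr => k _; rewrite /v scalerAr.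
  rewrite (E b) (E (fun k => th k * b k)).
  have -> : bsum (fun k => n (k0 + k)%N) (fun k => (th k * b k) *: q (k0 + k)%N) m =
    bsum (fun k => n (k0 + k)%N) (fun k => th k *: (b k *: q (k0 + k)%N)) m.
    by rewrite /bsum; apply: eq_bigr => k _; rewrite scalerA.
  apply: (bsum_multipliers hN) => // k.
    apply: (@leq_trans (n (k0 + k) + size (q (k0 + k)))%N).
      by rewrite leq_add2l size_scale_leq.
    by rewrite addnS; exact: successive_zero_sum_part.
  by apply: (zero_sum_suppressible hN); rewrite /q !hornerE subrr mulr0.
have l1 m (b : nat -> R) := @ell1_lower R _ N v eps sN mult pos m b.
(* The moments are [eps / 2] because [ell1_lower] loses a factor 2. *)
have [|f [fv fp]] := @hahn_banach_moments R V p sp (fun k => ev e (v k))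
    (fun k => (-1) ^+ k * (eps / 2)).
  move=> m b; have -> : \sum_(k < m) b k *: ev e (v k) = ev e (\sum_(k < m) b k *: v k).
    by rewrite linear_sum; apply: eq_bigr => k _; rewrite linearZ.
  have := l1 m b; rewrite -/(N _) => h.
  have : \sum_(k < m) b k * ((-1) ^+ k * (eps / 2)) <= eps / 2 * \sum_(k < m) `|b k|.
    rewrite mulr_sumr; apply: ler_sum => k _.
    rewrite (le_trans (ler_norm _))// normrM normrM normrX normrN1 expr1n mul1r.
    by rewrite (gtr0_norm (divr_gt0 e0 (ltr0Sn R 1))) mulrC.
  lra.
have [l /cvg_epsP hl] := hweak fp.
pose eta := eps / 16; have eta0 : 0 < eta by rewrite divr_gt0.
have [k2 {}hl] := hl _ eta0.
have N10' : 0 <= N 1 by exact: N10.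
have N11 : 0 < N 1 + 1 by lra.
have [k3 hk3] := exp2V_small (divr_gt0 eta0 N11).
(* The offset beyond [k0] is even, so the signs of the moments are those of [k]. *)
pose j0 := maxn k2 k3; pose s := (k0 + j0.*2)%N.
have sj k : (j0 <= s + k)%N by rewrite /s; lia.
pose y k : {poly R} := Y (n (s + k)%N) + t *: 'X^(n (s + k)%N).
have fy k : `|f (ev e (y k)) - (l - (-1) ^+ k * (eps / 2))| <= 2 * eta.
  have h1 := hl (s + k)%N (leq_trans (leq_maxl _ _) (sj k)).
  have h2 := hk3 (s + k)%N (leq_trans (leq_maxr _ _) (sj k)).
  have h3 := fv (j0.*2 + k)%N.
  rewrite exprD -signr_odd odd_double mul1r /v addnA -/s in h3.
  have E : Y (n (s + k)%N) + 'X^(n (s + k)%N) * r (s + k)%N = y k +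
      'X^(n (s + k)%N) * q (s + k)%N + ((r (s + k)%N).[1] - t) *: 'X^(n (s + k)%N).
    by rewrite /y /q -!mul_polyC polyCB; ring.
  move: (y k) E => yk E.
  rewrite E !linearD/= h3 linearZ/= evXn linearZ/= in h1.
  have h4 : `|((r (s + k)%N).[1] - t) * f (e (n (s + k)%N))| <= eta.
    rewrite normrM; have := ht (s + k)%N; have := fp (e (n (s + k)%N)).
    rewrite -evXn -/(N _) (spX hN) => h5 h6.
    have : `|(r (s + k)%N).[1] - t| * `|f (ev e 'X^(n (s + k)%N))| <= eta / (N 1 + 1) * N 1.
      by rewrite ler_pM// (le_trans h6).
    move=> h7; apply: (le_trans h7); rewrite mulrAC ler_pdivrMr//.
    by rewrite ler_wpM2l ?ltW//; lra.
  move: h1 h4; rewrite -[_ *: f _]/(_ * f _) !ler_norml => /andP[h1 h1'] /andP[h4 h4'].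
  by apply/andP; split; lra.
pose D := (5 * B + 12 * N 1) * 1 : R.
(* The limits [l] cancel over 2L alternating terms, and [f] gains at least [eps / 4] on each. The
   alternating sum of the [Y] has tails of size at most 1, hence norm at most [D]; that of the basis
   vectors is [L] times a difference average. *)
have main L : L%:R * (eps / 2) <= D + `|t| * (L%:R * N (diff_poly (avg L))).
  pose G := \sum_(k < L.*2) (-1) ^+ k *: y k.
  have lowG : L%:R * (eps / 2) <= - f (ev e G).
    have -> : - f (ev e G) = \sum_(k < L.*2) - ((-1) ^+ k * f (ev e (y k))).
      rewrite sumrN; congr (- _); rewrite /G [ev e _]linear_sum [LHS]linear_sum.
      by apply: eq_bigr => k _; rewrite /= [ev e (_ *: _)]linearZ/= linearZ.
    apply: (@le_trans _ _ (\sum_(k < L.*2) (eps / 2 - 2 * eta - (-1) ^+ k * l))).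
      rewrite sumrB -mulr_suml alternating_sum odd_double mul0r subr0 sumr_const card_ord.
      rewrite -[leRHS]mulr_natl -muln2 natrM -mulrA; apply: ler_wpM2l => //.
      by rewrite /eta; lra.
    apply: ler_sum => k _; have := fy k; rewrite ler_norml -(signr_odd _ k).
    by case: (odd k); rewrite ?expr1 ?expr0 => /andP[]; lra.
  apply: (le_trans lowG); apply: (le_trans (ler_norm _)); rewrite normrN.
  apply: (le_trans (fp _)); rewrite -/(N _).
  have -> : G = \sum_(k < L.*2) (-1) ^+ k *: Y (n (s + k)%N) +
      t *: spread (fun k => n (s + k)%N) (\sum_(k < L.*2) (-1) ^+ k *: 'X^k).
    rewrite spread_sum scaler_sumr /G -big_split/=; apply: eq_bigr => k _.
    by rewrite scalerDr !scalerA mulrC.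
  rewrite (le_trans (semiD sN _ _))// lerD//.
    apply: (@prefix_combination_bound (fun k => n (s + k)%N) (fun k => (-1) ^+ k)) => [k|k|i iL].
    - by rewrite addnS; exact: hn.
    - by apply: (le_trans (hsg _)); apply: exp2V_le; rewrite leq_addl.
    - have -> : \sum_(i <= k < L.*2) (-1) ^+ k =
          \sum_(k < L.*2) (-1) ^+ k - \sum_(k < i) (-1) ^+ k :> R.
        apply/eqP; rewrite eq_sym subr_eq addrC.
        by rewrite -!(big_mkord xpredT (fun k => (-1) ^+ k)) -big_cat_nat.
      rewrite !alternating_sum odd_double sub0r normrN.
      by case: (odd i); rewrite ?normr1 ?normr0.
  rewrite (semiZ sN) hN.2; last first.
    by apply: increasing_ltn => k; rewrite addnS; exact: hn.
  rewrite alternating_poly; apply: ler_wpM2l => //.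
  have [->|L0] := posnP L; first by rewrite big_ord0 linear0 (semi0 sN) mul0r.
  have -> : \sum_(j < L) 'X^j = L%:R *: avg L :> {poly R}.
    by rewrite avg.unlock scalerA mulfV ?scale1r// pnatr_eq0 -lt0n.
  by rewrite linearZ/= (semiZ sN) ger0_norm.
have t10 : 0 < 4 * (`|t| + 1) by rewrite mulr_gt0// ltr_wpDl.
have [M M0 hM] := hphi (divr_gt0 e0 t10).
(* With [L = M * K] the term in [t] is at most [L * eps / 4], which forces [L <= 4 * D / eps]; this
   [K] makes [L] larger. *)
pose K := (Num.truncn (4 * D / eps)).+1.
have hKD : 4 * D / eps < K%:R by rewrite truncnS_gt.
have := main (M * K)%N; have := diff_avg_mul M0 (ltn0Sn (Num.truncn (4 * D / eps))).
rewrite -/K => h1 h2; have h3 := le_trans h1 hM.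
have : `|t| * N (diff_poly (avg (M * K))) <= eps / 4.
  apply: (@le_trans _ _ (`|t| * (eps / (4 * (`|t| + 1))))); first exact: ler_wpM2l.
  rewrite mulrA ler_pdivrMr//; have := normr_ge0 t; nra.
set P := `|t| * N _; set L := (M * K)%:R in h2 *.
move=> hP.
have L0 : 0 <= L by [].
have LK : K%:R <= L by rewrite ler_nat leq_pmull.
have h4 : L * P <= L * (eps / 4) by exact: ler_wpM2l.
have h5 : L * (eps / 2) <= D + L * P by rewrite /P [L * (`|t| * _)]mulrCA.
have h6 : L * eps <= 4 * D by lra.
have : L <= 4 * D / eps by rewrite ler_pdivlMr.
by move=> h7; have := lt_le_trans hKD (le_trans LK h7); rewrite ltxx.
Qed.

(** [M] successive combinations with small zero-sum part are averaged. The triangle inequality keeps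
    that part small, and [sp_convex_blocks] in the difference seminorm compares the average with
    [avg M]. *)
Lemma small_convex_combination_diff k0 eps : 0 < eps -> exists k1 c,
  [/\ (k0 < k1)%N, forall k, 0 <= c k & [/\ \sum_(k0 <= k < k1) c k = 1,
      N (\sum_(k0 <= k < k1) c k *: ('X^(n k) * q k)) <= eps &
      N (diff_poly (\sum_(k0 <= k < k1) c k *: 'X^k)) <= eps]].
Proof.
move=> e0.
pose Q (j k0 k1 : nat) (c : nat -> R) := \sum_(k0 <= k < k1) c k = 1 /\
  N (\sum_(k0 <= k < k1) c k *: ('X^(n k) * q k)) <= eps.
have [||l [c [l0 lS c0 lQ]]] := @glue_blocks R Q _ _ k0.
- move=> j i1 i2 c c' cc' [h1 h2]; split.
    by rewrite -h1; apply: eq_big_nat => k /cc' ->.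
  by rewrite -(eq_combination _ cc').
- move=> j i; have [k1 [c [h1 h2 h3 h4]]] := small_convex_combination i e0.
  by exists k1, c.
have [M M0 hM] := hphi e0.
have cc : convex_coefs l c by split => // j; have [] := lQ j.
have Mn0 : M%:R != 0 :> R by rewrite pnatr_eq0 -lt0n.
have E (W : lmodType R) (w : nat -> W) :
    \sum_(k0 <= k < l M) (M%:R^-1 * c k) *: w k = M%:R^-1 *: \sum_(j < M) cblock l c w j.
  rewrite -l0; elim: M {M0 hM Mn0} (M%:R^-1) => [|M IH] b.
    by rewrite big_geq// big_ord0 scaler0.
  rewrite (big_cat_nat (n := l M))//=; last 2 first.
  - exact: strictly_increasing_leq.
  - exact: ltnW.
  rewrite IH big_ord_recr/= scalerDr; congr (_ + _).
  by rewrite /cblock scaler_sumr; apply: eq_bigr => k _; rewrite scalerA.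
exists (l M), (fun k => M%:R^-1 * c k); split.
- by rewrite -l0; exact: strictly_increasing_ltn.
- by move=> k; rewrite mulr_ge0// invr_ge0.
split.
(* At the constant family 1, the identity [E] computes the total of the coefficients. *)
- have := E R^o (fun=> 1).
  rewrite (eq_bigr (fun k => M%:R^-1 * c k)) => [->|k _]; last exact: mulr1.
  rewrite (eq_bigr (fun=> 1)) => [|j _]; last first.
    by apply: etrans (cc.2 j); apply: eq_bigr => k _; exact: mulr1.
  by rewrite sumr_const card_ord -[_ *: _]/(_ * _) mulVf.
- rewrite E (semiZ sN) ger0_norm ?invr_ge0// ler_pdivrMl ?ltr0n//.
  apply: (@le_trans _ _ (\sum_(j < M) eps)); last by rewrite sumr_const card_ord mulr_natl.
  by apply: (semi_sum_le sN) => j _; have [] := lQ j.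
- rewrite E; apply: le_trans hM.
  have := sp_convex_blocks (diff_norm_spreading hN) (fun=> M%:R^-1) M lS cc.
  by rewrite -!scaler_sumr avg.unlock.
Qed.

Lemma small_block_selection L0 (eps : nat -> R) : (forall j, 0 < eps j) ->
  exists l c, [/\ l 0%N = L0, (forall j, l j < l j.+1)%N, convex_coefs l c,
    forall j, N (cblock l c (fun k => 'X^(n k) * q k) j) <= eps j &
    forall j, N (diff_poly (cblock l c (fun k => 'X^k) j)) <= eps j].
Proof.
move=> e0.
pose Q (j k0 k1 : nat) (c : nat -> R) := [/\ \sum_(k0 <= k < k1) c k = 1,
  N (\sum_(k0 <= k < k1) c k *: ('X^(n k) * q k)) <= eps j &
  N (diff_poly (\sum_(k0 <= k < k1) c k *: 'X^k)) <= eps j].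
have [||l [c [l0 lS c0 lQ]]] := @glue_blocks R Q _ _ L0.
- move=> j i1 i2 c c' cc' [h1 h2 h3]; split.
  + by rewrite -h1; apply: eq_big_nat => k /cc' ->.
  + by rewrite -(eq_combination _ cc').
  + by rewrite -(eq_combination _ cc').
- by move=> j i; exact: small_convex_combination_diff.
exists l, c; split => //; last 2 first.
- by move=> j; have [] := lQ j.
- by move=> j; have [] := lQ j.
- by split => // j; have [] := lQ j.
Qed.

End BlockCombinations.

(** * Complemented closed spans *)

Section Span.
Variables (R : realType) (X : completeNormedModType R) (p : X -> R) (w : nat -> X).
Hypothesis hp : equivalent_norm p.
Let sp : seminorm p := equivalent_norm_seminorm hp.

Lemma lincomb_ev n (a : nat -> R) : lincomb n a w = ev w (\sum_(i < n) a i *: 'X^i).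
Proof. by rewrite ev_sum. Qed.

Lemma closed_spanP v :
  closed_span w v <-> forall eps, 0 < eps -> exists q, p (v - ev w q) <= eps.
Proof.
have [_ _ [c [C [c0 C0 cC]]]] := hp.
split=> [cv eps e0|h].
  have [_ [[n [a ->]]]] := cv _ (nbhsx_ballx v _ (divr_gt0 e0 C0)).
  rewrite -ball_normE/= => h; exists (\sum_(i < n) a i *: 'X^i).
  rewrite -lincomb_ev; have /andP[_ h1] := cC (v - lincomb n a w).
  by rewrite (le_trans h1)// mulrC -ler_pdivlMr// ltW.
move=> B /nbhs_ballP[d /= d0 dB].
have [q hq] := h _ (mulr_gt0 c0 (divr_gt0 d0 (ltr0Sn R 1))).
exists (ev w q); split; first by exists (size q), (fun i => q`_i).
apply: dB; rewrite -ball_normE/=.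
have /andP[h1 _] := cC (v - ev w q).
have := le_trans h1 hq; rewrite ler_pM2l// => /le_lt_trans; apply.
by rewrite ltr_pdivrMr//; lra.
Qed.

Lemma closed_span_ev q : closed_span w (ev w q).
Proof.
by apply/closed_spanP => eps e0; exists q; rewrite subrr (semi0 sp) ltW.
Qed.

Lemma closed_span_lin t u v :
  closed_span w u -> closed_span w v -> closed_span w (t *: u + v).
Proof.
move=> /closed_spanP hu /closed_spanP hv; apply/closed_spanP => eps e0.
have e20 : 0 < eps / 2 by lra.
have t0 : 0 < `|t| + 1 by rewrite ltr_wpDl.
have [q hq] := hu _ (divr_gt0 e20 t0); have [q' hq'] := hv _ e20.
exists (t *: q + q').
have -> : t *: u + v - ev w (t *: q + q') = t *: (u - ev w q) + (v - ev w q').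
  by rewrite linearP scalerBr opprD addrACA.
rewrite (le_trans (semiD sp _ _))// (semiZ sp).
have : `|t| * p (u - ev w q) <= eps / 2.
  apply: (@le_trans _ _ ((`|t| + 1) * p (u - ev w q))).
    by rewrite ler_wpM2r ?(semi_ge0 sp)//; lra.
  by rewrite mulrC -ler_pdivlMr.
lra.
Qed.

Lemma closed_span_lim (u : nat -> X) (l : X) :
  u @ \oo --> l -> (forall k, closed_span w (u k)) -> closed_span w l.
Proof.
move=> /(pcvgP hp) ul hu; apply/closed_spanP => eps e0.
have e20 : 0 < eps / 2 by lra.
have [n0 hn] := ul _ e20.
have /closed_spanP/(_ _ e20)[q hq] := hu n0; exists q.
have := hn n0 (leqnn _); rewrite (semi_distC sp) => h.
have -> : l - ev w q = (l - u n0) + (u n0 - ev w q) by rewrite addrA subrK.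
by rewrite (le_trans (semiD sp _ _))//; lra.
Qed.

Lemma pcvg_unique (u : nat -> X) (l l' : X) : u @ \oo --> l -> u @ \oo --> l' -> l = l'.
Proof. exact: (@cvg_unique _ (@norm_hausdorff _ X)). Qed.

(* The pointwise limit [T] of the operators [Q m] maps [X] into the closed span [W] of
   [w] and is within [1/2] of the identity there; a projection onto [W] is then
   [sum_j (1 - T)^j T]. *)
Lemma almost_projection (Q : nat -> X -> X) (C : R) : 0 <= C ->
  (forall m t u v, Q m (t *: u + v) = t *: Q m u + Q m v) ->
  (forall m v, p (Q m v) <= C * p v) ->
  (forall m v, exists q, Q m v = ev w q) ->
  (forall v, cvgn (fun m => Q m v)) ->
  (forall q, exists M, forall m, (M <= m)%N ->
    p (Q m (ev w q) - ev w q) <= 2^-1 * p (ev w q)) ->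
  complemented (closed_span w).
Proof.
move=> C0 Qlin QC Qspan Qcvg Qhalf.
pose T v := limn (fun m => Q m v).
have QT v : (fun m => Q m v) @ \oo --> T v by exact: Qcvg.
have Tlin t u v : T (t *: u + v) = t *: T u + T v.
  apply: (pcvg_unique (QT _)).
  rewrite (_ : (fun m => _) = t \*: (fun m => Q m u) + (fun m => Q m v)); last first.
    by apply/funext => m; rewrite Qlin.
  by apply: cvgD; [apply: cvgZr; exact: QT|exact: QT].
have TC v : p (T v) <= C * p v.
  by apply: (pcvg_le hp (n0 := 0%N) (QT v)) => m _; exact: QC.
have TW v : closed_span w (T v).
  apply: (closed_span_lim (QT v)) => m; have [q ->] := Qspan m v; exact: closed_span_ev.
pose E v := v - T v.
have Elin t u v : E (t *: u + v) = t *: E u + E v.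
  by rewrite /E Tlin scalerBr opprD addrACA.
have EW v : closed_span w v -> closed_span w (E v).
  by move=> vW; rewrite /E -scaleN1r addrC; apply: closed_span_lin.
have EC v : p (E v) <= (1 + C) * p v.
  by rewrite (le_trans (semiB sp _ _))// mulrDl mul1r lerD2l.
have Ehalf v : closed_span w v -> p (E v) <= 2^-1 * p v.
  move=> /closed_spanP vW; apply/ler_addgt0Pr => eps e0.
  have C30 : 0 < 2 + C by lra.
  have [q hq] := vW _ (divr_gt0 e0 C30).
  have h1 : p (E (ev w q)) <= 2^-1 * p (ev w q).
    have [M hM] := Qhalf q; rewrite /E (semi_distC sp).
    have cv : (fun m => Q m (ev w q) - ev w q) @ \oo --> T (ev w q) - ev w q.
      by apply: cvgB; [exact: QT|exact: cvg_cst].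
    exact: (pcvg_le hp (n0 := M) cv).
  have h2 : E v = 1 *: E (v - ev w q) + E (ev w q) by rewrite -Elin scale1r subrK.
  rewrite h2 scale1r (le_trans (semiD sp _ _))//.
  have h3 := EC (v - ev w q).
  have h4 : p (ev w q) <= p v + p (v - ev w q).
    by rewrite (semi_distC sp) semi_le_dist.
  have h5 : (2 + C) * p (v - ev w q) <= eps by rewrite mulrC -ler_pdivlMr.
  have h6 := semi_ge0 sp (v - ev w q).
  by lra.
pose D j v := iter j E (T v).
have DW j v : closed_span w (D j v) by elim: j => [|j IH]; [exact: TW|exact: EW].
have Dlin j t u v : D j (t *: u + v) = t *: D j u + D j v.
  by elim: j => [|j IH]; [exact: Tlin|rewrite /D /= -!/(D j _) IH Elin].
have Dle j v : p (D j v) <= 2 ^- j * (C * p v).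
  elim: j => [|j IH]; first by rewrite expr0 invr1 mul1r; exact: TC.
  rewrite exprS invfM -mulrA (le_trans (Ehalf _ (DW j v)))// ler_wpM2l// invr_ge0//.
pose S k v := \sum_(j < k) D j v.
have Slin k t u v : S k (t *: u + v) = t *: S k u + S k v.
  by rewrite /S scaler_sumr -big_split/=; apply: eq_bigr => j _; exact: Dlin.
have SW k v : closed_span w (S k v).
  elim: k => [|k IH]; first by rewrite /S big_ord0 -(linear0 (ev w)); exact: closed_span_ev.
  by rewrite /S big_ord_recr/= addrC -[D k v]scale1r; exact: closed_span_lin.
have Stail k m v : p (S (k + m)%N v - S k v) <= 2 * 2 ^- k * (C * p v).
  rewrite /S big_split_ord/= addrAC subrr add0r.
  apply: (@le_trans _ _ (\sum_(j < m) 2 ^- j * (2 ^- k * (C * p v)))).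
    by apply: (semi_sum_le sp) => j _; rewrite (le_trans (Dle _ _))// exprD invfM -mulrA mulrCA.
  rewrite -mulr_suml -mulrA ler_wpM2r ?geometric_sum_le//.
  by rewrite mulr_ge0 ?(ltW (exp2V_gt0 R k))// mulr_ge0// semi_ge0.
have Scvg v : cvgn (fun k => S k v).
  apply: (pcauchy_cvg hp) => eps e0.
  have Cp : 0 < 2 * (C * p v) + 1 by rewrite ltr_wpDl// !mulr_ge0// semi_ge0.
  have [k0 hk] := exp2V_small (divr_gt0 e0 Cp).
  exists k0 => k kk; rewrite -(subnKC kk) (le_trans (Stail _ _ _))//.
  have := hk k0 (leqnn _); rewrite ler_pdivlMr// => h.
  have := exp2V_gt0 R k0; lra.
pose P v := limn (fun k => S k v).
have SP v : (fun k => S k v) @ \oo --> P v by exact: Scvg.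
have Plin : linear P.
  move=> t u v; apply: (pcvg_unique (SP _)).
  rewrite (_ : (fun k => _) = t \*: (fun k => S k u) + (fun k => S k v)); last first.
    by apply/funext => k; rewrite Slin.
  by apply: cvgD; [apply: cvgZr; exact: SP|exact: SP].
have PW v : closed_span w (P v) by exact: (closed_span_lim (SP v)).
have PC v : p (P v) <= 2 * C * p v.
  apply: (pcvg_le hp (n0 := 0%N) (SP v)) => k _.
  by have := Stail 0%N k v; rewrite add0n /S big_ord0 subr0 expr0 invr1; lra.
have Pid v : closed_span w v -> P v = v.
  move=> vW; apply: (pcvg_unique (SP v)).
  have itW j : closed_span w (iter j E v) by elim: j => //= j IH; exact: EW.
  have itle j : p (iter j E v) <= 2 ^- j * p v.
    elim: j => [|j IH]; first by rewrite expr0 invr1 mul1r.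
    by rewrite exprS invfM -mulrA (le_trans (Ehalf _ (itW j)))// ler_wpM2l// invr_ge0.
  (* On the closed span [T] is [1 - E], so the series telescopes. *)
  have Sv k : S k v = v - iter k E v.
    have itlin j u u' : iter j E (u - u') = iter j E u - iter j E u'.
      elim: j => //= j ->; have := Elin (-1) (iter j E u') (iter j E u).
      by rewrite !scaleN1r ![- _ + _]addrC.
    elim: k => [|k IH]; first by rewrite /S big_ord0 subrr.
    rewrite /S big_ord_recr/= -/(S k v) IH /D.
    have -> : T v = v - E v by rewrite /E subKr.
    by rewrite itlin -iterSr/= addrA subrK.
  apply/(pcvgP hp) => eps e0.
  have p0 : 0 < p v + 1 by rewrite ltr_wpDl// semi_ge0.
  have [k0 hk] := exp2V_small (divr_gt0 e0 p0).
  exists k0 => k /hk; rewrite Sv addrAC subrr add0r (semiN sp) ler_pdivlMr// => h.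
  apply: (le_trans (itle k)); apply: le_trans h.
  by rewrite ler_wpM2l ?ltW ?exp2V_gt0//; lra.
have [F FE] := linear_pack Plin.
exists F; split.
- have [_ _ [c [C' [c0 C'0 cC]]]] := hp.
  apply: (@bounded_linear_cts _ _ _ F (c^-1 * (2 * C * C'))) => u; rewrite FE.
  rewrite -[leRHS]mulrA ler_pdivlMl//; have /andP[h _] := cC (P u); apply: (le_trans h).
  rewrite (le_trans (PC u))// -[leRHS]mulrA ler_wpM2l ?mulr_ge0//.
  by have /andP[] := cC u.
- by move=> v; rewrite !FE Pid.
- apply/seteqP; split => [_ [v _ <-]|v vW]; first by rewrite FE.
  by exists v => //; rewrite FE Pid.
Qed.

End Span.

(** * The summing basis, and sums over convex blocks *)

Lemma lincomb_summing (R : realType) n (a : nat -> R) k :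
  lincomb n a (summing_basis R) k = \sum_(k <= i < n) a i.
Proof.
rewrite /lincomb fct_sumE.
have E (i : nat) : (a i *: summing_basis R i) k = if (k <= i)%N then a i else 0.
  change (a i * summing_basis R i k = if (k <= i)%N then a i else 0).
  rewrite /summing_basis fct_sumE /c0_unit.
  have -> : \sum_(j < i.+1) (k == j)%:R = (k <= i)%:R :> R.
    case: leqP => h.
      rewrite (bigD1 (Ordinal (n := i.+1) (m := k) h))//= eqxx big1 ?addr0// => j jk.
      by apply/eqP; rewrite pnatr_eq0 eqb0; apply: contra jk => /eqP kj; apply/eqP/val_inj.
    by rewrite big1// => j _; rewrite gtn_eqF// (leq_trans _ h).
  by case: leqP => _; rewrite ?mulr1 ?mulr0.
under eq_bigr do rewrite E.
rewrite -(big_mkord xpredT (fun i => if (k <= i)%N then a i else 0)) -big_mkcond/=.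
by rewrite [RHS](big_nat_widenl k 0).
Qed.

Lemma c0_norm_tail (R : realType) n (a : nat -> R) k :
  `|\sum_(k <= i < n) a i| <= c0_norm (lincomb n a (summing_basis R)).
Proof.
rewrite -lincomb_summing; apply: ub_le_sup; last by exists k.
exists (\sum_(i < n) `|a i|) => _ [i _ <-]; rewrite lincomb_summing.
rewrite (le_trans (ler_norm_sum _ _ _))//.
rewrite -(big_mkord xpredT (fun i => `|a i|)) [leRHS](big_cat_nat (n := minn i n))//=; last exact: geq_minr.
case: (leqP i n) => h; first by rewrite lerDr sumr_ge0.
by rewrite (big_geq (ltnW h)) addr_ge0// sumr_ge0.
Qed.

Lemma c0_norm_le (R : realType) n (a : nat -> R) b :
  (forall k, `|\sum_(k <= i < n) a i| <= b) ->
  c0_norm (lincomb n a (summing_basis R)) <= b.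
Proof.
move=> h; apply: ge_sup; first by exists `|lincomb n a (summing_basis R) 0%N|, 0%N.
by move=> _ [k _ <-]; rewrite lincomb_summing.
Qed.

Lemma cblock_convex_block_sequence (R : realType) (V : lmodType R) (x : nat -> V)
    (iota l : nat -> nat) (c : nat -> R) :
  (forall k, iota k < iota k.+1)%N -> (forall j, l j < l j.+1)%N -> convex_coefs l c ->
  convex_block_sequence x (cblock l c (x \o iota)).
Proof.
move=> hi hl [c0 c1].
have inj : injective iota.
  move=> i j; case: (ltngtP i j) => // h ij; have := strictly_increasing_ltn hi h;
  by rewrite ij ltnn.
(* The coefficients are carried along the injective [iota], with value 0 off its range. *)
have C i : exists b : R, 0 <= b /\ forall k, iota k = i -> b = c k.
  have [[k hk]|nk] := pselect (exists k, iota k = i); last first.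
    by exists 0; split => // k hk; case: nk; exists k.
  by exists (c k); split => // k' hk'; congr c; apply: inj; rewrite hk hk'.
pose c' i := projT1 (cid (C i)).
have c'0 i : 0 <= c' i by have [] := projT2 (cid (C i)).
have c'E k : c' (iota k) = c k.
  by have [_ h] := projT2 (cid (C (iota k))); rewrite /c' (h k).
pose F j := seq_fset tt [seq iota k | k <- index_iota (l j) (l j.+1)].
have FE (W : nmodType) (G : nat -> W) j :
    \sum_(i <- F j) G i = \sum_(l j <= k < l j.+1) G (iota k).
  rewrite -(big_map iota xpredT G); apply: perm_big; apply: uniq_perm; first exact: fset_uniq.
    by rewrite map_inj_uniq// iota_uniq.
  by move=> i; rewrite seq_fsetE.
exists F, c'; split.
  move=> k i j; rewrite !seq_fsetE => /mapP[i' hi' ->] /mapP[j' hj' ->].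
  apply: (strictly_increasing_ltn hi); move: hi' hj'; rewrite !mem_index_iota.
  by move=> /andP[_ h1] /andP[h2 _]; exact: leq_trans h1 h2.
move=> j; split => //.
  by rewrite FE -(c1 j); apply: eq_bigr => k _; rewrite c'E.
by rewrite FE; apply: eq_bigr => k _; rewrite c'E.
Qed.

Section BlockSums.
Variables (R : realType) (l : nat -> nat) (c : nat -> R).
Hypothesis hl : forall j, (l j < l j.+1)%N.
Hypothesis hc : convex_coefs l c.

Lemma cblock_le (V : lmodType R) (p : V -> R) (v : nat -> V) j b : seminorm p ->
  (forall k, (l j <= k < l j.+1)%N -> p (v k) <= b) -> p (cblock l c v j) <= b.
Proof.
move=> sp h; rewrite /cblock big_nat (le_trans (semi_sum sp _ _ _))//.
rewrite -[leRHS]mul1r -(hc.2 j) mulr_suml [leRHS]big_nat; apply: ler_sum => k hk.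
by rewrite (semiZ sp) ger0_norm ?(hc.1 k)// ler_wpM2l ?(hc.1 k)// h.
Qed.

Lemma cblockD (V : lmodType R) (u v : nat -> V) j :
  cblock l c (fun k => u k + v k) j = cblock l c u j + cblock l c v j.
Proof. by rewrite /cblock -big_split/=; apply: eq_bigr => k _; rewrite scalerDr. Qed.

Lemma cblockZ (V : lmodType R) (t : R) (u : nat -> V) j :
  cblock l c (fun k => t *: u k) j = t *: cblock l c u j.
Proof.
by rewrite /cblock scaler_sumr; apply: eq_bigr => k _; rewrite !scalerA mulrC.
Qed.

Lemma cblock_linear (V W : lmodType R) (F : {linear V -> W}) (u : nat -> V) j :
  F (cblock l c u j) = cblock l c (F \o u) j.
Proof. by rewrite /cblock linear_sum; apply: eq_bigr => k _; rewrite linearZ. Qed.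

Lemma tails_coef (b : nat -> R) m A :
  (forall i, (i <= m)%N -> `|\sum_(i <= k < m) b k| <= A) ->
  forall i, (i < m)%N -> `|b i| <= 2 * A.
Proof.
move=> hA i im.
have -> : b i = \sum_(i <= k < m) b k - \sum_(i.+1 <= k < m) b k.
  by rewrite big_ltn// addrK.
rewrite (le_trans (ler_normB _ _))//.
by have := hA i (ltnW im); have := hA i.+1 im; lra.
Qed.

(** Each coefficient is a difference of two tails, hence at most [2 * A]; the geometric series gives
    the other factor 2. *)
Lemma tails_weighted_sum (V : lmodType R) (p : V -> R) (v : nat -> V)
    (b : nat -> R) m A beta : seminorm p ->
  (forall i, (i <= m)%N -> `|\sum_(i <= k < m) b k| <= A) ->
  (forall j, p (v j) <= beta * 2 ^- j) ->
  p (\sum_(j < m) b j *: v j) <= 4 * beta * A.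
Proof.
move=> sp hA hv.
have A0 : 0 <= A by apply: le_trans (hA m (leqnn m)).
have b0 : 0 <= beta.
  have := le_trans (semi_ge0 sp (v 0%N)) (hv 0%N).
  by rewrite expr0 invr1 mulr1.
apply: (@le_trans _ _ (\sum_(j < m) (2 * A * beta) * 2 ^- j)).
  apply: (semi_sum_le sp) => j _; rewrite (semiZ sp) -mulrA.
  by rewrite ler_pM ?(semi_ge0 sp)//; exact: (tails_coef hA).
rewrite -mulr_sumr; have := geometric_sum_le R m.
have h0 : 0 <= 2 * A * beta by rewrite !mulr_ge0.
by move=> /(ler_wpM2l h0); lra.
Qed.

(** The coefficients [g] are chosen before [V] and [v], so one [g] can be tested on scalars and used
    on vectors. *)
Lemma flatten_blocks (b : nat -> R) m : exists g : nat -> R,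
  forall (V : lmodType R) (v : nat -> V),
    \sum_(j < m) b j *: cblock l c v j = \sum_(k < l m) g k *: v k.
Proof.
elim: m => [|m [g IH]].
  by exists (fun=> 0) => V v; rewrite big_ord0 big1// => k _; rewrite scale0r.
exists (fun k => if (k < l m)%N then g k else b m * c k) => V v.
rewrite big_ord_recr/= IH -[RHS](big_mkord xpredT
  (fun k => (if (k < l m)%N then g k else b m * c k) *: v k)).
rewrite (big_cat_nat (n := l m))//=; last exact: ltnW.
rewrite big_mkord; congr (_ + _).
  by apply: eq_bigr => k _; rewrite ltn_ord.
rewrite /cblock scaler_sumr; apply: eq_big_nat => k /andP[h _].
by rewrite ltnNge h scalerA.
Qed.

(** A tail of [g] is the sum of [b j] times the mass [th j] of block [j] from [i] on. These masses
    increase within [0, 1], so Abel summation bounds the tail by [A]. *)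
Lemma flatten_tails (b : nat -> R) m A :
  (forall i, (i <= m)%N -> `|\sum_(i <= k < m) b k| <= A) ->
  exists g : nat -> R,
  (forall (V : lmodType R) (v : nat -> V),
    \sum_(j < m) b j *: cblock l c v j = \sum_(k < l m) g k *: v k) /\
  forall i, (i <= l m)%N -> `|\sum_(i <= k < l m) g k| <= A.
Proof.
move=> hA; have [g hg] := flatten_blocks b m; exists g; split => // i il.
have A0 : 0 <= A by apply: le_trans (hA m (leqnn m)).
pose v k : R^o := (i <= k)%:R.
have -> : \sum_(i <= k < l m) g k = \sum_(k < l m) g k *: v k.
  rewrite (big_nat_widenl i 0)//= big_mkcond big_mkord; apply: eq_bigr => k _.
  change ((if (i <= k)%N then g k else 0) = g k * (i <= k)%:R).
  by case: (i <= k)%N; rewrite ?mulr1 ?mulr0.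
rewrite -hg; pose th j : R := cblock l c v j.
have thE j : th j = \sum_(l j <= k < l j.+1) c k * (i <= k)%:R by [].
have th01 j : 0 <= th j <= 1.
  apply/andP; split; first by rewrite thE; apply: sumr_ge0 => k _; rewrite mulr_ge0 ?(hc.1 k).
  apply: (@le_trans _ _ (\sum_(l j <= k < l j.+1) c k)); last by rewrite hc.2.
  rewrite thE; apply: ler_sum => k _.
  by case: (i <= k)%N; rewrite ?mulr1 ?mulr0 ?(hc.1 k).
have thS j : th j <= th j.+1.
  case: (leqP i (l j.+1)) => h.
    have -> : th j.+1 = 1; last by have /andP[] := th01 j.
    apply: etrans (hc.2 j.+1); rewrite thE; apply: eq_big_nat => k /andP[hk _].
    by rewrite (leq_trans h hk) mulr1.
  have -> : th j = 0; last by have /andP[] := th01 j.+1.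
  rewrite thE big_nat big1// => k /andP[_ hk].
  by rewrite leqNgt (ltn_trans hk h) mulr0.
have -> : \sum_(j < m) b j *: cblock l c v j = (\sum_(0 <= k < m) b k) * th 0%N +
    \sum_(j < m) (\sum_(j.+1 <= k < m) b k) * (th j.+1 - th j).
  exact: (@summation_by_parts R R^o b th m).
rewrite (le_trans (ler_normD _ _))//.
apply: (@le_trans _ _ (A * th 0%N + \sum_(j < m) A * (th j.+1 - th j))).
  have /andP[h0 _] := th01 0%N.
  apply: lerD; first by rewrite normrM (ger0_norm h0) ler_wpM2r// hA.
  rewrite (le_trans (ler_norm_sum _ _ _))// ler_sum// => j _.
  rewrite normrM [X in _ * X]ger0_norm ?subr_ge0// ler_wpM2r ?subr_ge0//.
  exact: hA.
rewrite -mulr_sumr -mulrDr -(big_mkord xpredT (fun j => th j.+1 - th j)) telescope_sumr//.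
by rewrite addrC subrK -[leRHS]mulr1 ler_wpM2l//; have /andP[] := th01 m.
Qed.

End BlockSums.

Section HomogeneousTails.
Variables (R : realType) (N zN : {poly R} -> R) (K : R).
Hypothesis hN : spreading_seminorm N.
Hypothesis hz : forall q eps, 0 < eps ->
  exists M0, forall M, (M0 <= M)%N -> `|N (blow M q) - zN q| <= eps.
Hypothesis K0 : 0 < K.
Hypothesis hK : forall m (u w : {poly R}), (size u <= m)%N ->
  [/\ `|u.[1]| <= K * N (u + 'X^m * w), `|w.[1]| <= K * N (u + 'X^m * w),
      N u <= K * N (u + 'X^m * w) & N w <= K * N (u + 'X^m * w)].

Lemma size_blow M n (q : {poly R}) : (size q <= n)%N -> (size (blow M q) <= n * M)%N.
Proof.
move=> qn; rewrite (blowE M qn).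
apply: (@size_bsum _ (fun i => i * M)%N) => k.
by rewrite mulSn addnC leq_add2r (leq_trans (size_scale_leq _ _))// size_avg.
Qed.

(** In a blown-up polynomial the terms from [i] on form a tail whose coordinate sum is the tail of
    [b], as [avg] has sum 1. Thus [hK] applies before passing to the limit. *)
Lemma homogeneous_tail_bound (b : nat -> R) m i : (i <= m)%N ->
  `|\sum_(i <= k < m) b k| <= K * zN (\sum_(k < m) b k *: 'X^k).
Proof.
move=> im; set q := \sum_(k < m) _.
suff H eps : 0 < eps -> `|\sum_(i <= k < m) b k| <= K * (zN q + eps).
  apply/ler_addgt0Pr => eps e0; have := H _ (divr_gt0 e0 K0).
  by rewrite mulrDr [K * (_ / _)]mulrC divfK// gt_eqF.
move=> e0; have [M0 hM] := zN_lim hz q e0.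
have /andP[_ {}hM] := hM M0.+1 (leqnSn _).
pose f : {poly R} := \sum_(k < i) b k *: 'X^k.
pose g : {poly R} := \sum_(k < m - i) b (i + k)%N *: 'X^k.
have qE : q = f + 'X^i * g.
  rewrite /q /f /g -(big_mkord xpredT (fun k => b k *: 'X^k)).
  rewrite (big_cat_nat (n := i))//= big_mkord; congr (_ + _).
  rewrite -{1}[i]add0n big_addn big_mkord mulr_sumr; apply: eq_bigr => k _.
  by rewrite -scalerAr -exprD addnC.
have bE : blow M0.+1 q = blow M0.+1 f + 'X^(i * M0.+1) * blow M0.+1 g.
  rewrite qE linearD/=; congr (_ + _).
  by rewrite /blow comp_polyM comp_Xn_poly -exprM [(M0.+1 * i)%N]mulnC mulrA.
have sf : (size (blow M0.+1 f) <= i * M0.+1)%N.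
  apply: size_blow; rewrite (leq_trans (size_sum _ _ _))//.
  by apply/bigmax_leqP => k _; rewrite (leq_trans (size_scale_leq _ _))// size_polyXn.
have [_ h _ _] := hK (blow M0.+1 g) sf.
rewrite -bE in h; apply: (le_trans _ (le_trans h _)); last by rewrite ler_pM2l.
rewrite le_eqVlt; apply/orP; left; apply/eqP; congr (`| _ |).
rewrite /blow hornerM horner_avg1// mulr1 horner_comp hornerXn expr1n /g horner_sum.
rewrite -{1}[i]add0n big_addn big_mkord; apply: eq_bigr => k _.
by rewrite !hornerE expr1n mulr1 addnC.
Qed.

End HomogeneousTails.

(** * Estimates for the convex blocks *)

Section BlockEstimates.
Variables (R : realType) (X : completeNormedModType R) (e : nat -> X) (p : X -> R) (K : R).
Hypothesis hp : equivalent_norm p.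
Hypothesis hbasis : schauder_basis e.
Let N (q : {poly R}) := p (ev e q).
Hypothesis hN : spreading_seminorm N.
Hypothesis K0 : 0 < K.
Hypothesis hK : forall m (u w : {poly R}), (size u <= m)%N ->
  [/\ `|u.[1]| <= K * N (u + 'X^m * w), `|w.[1]| <= K * N (u + 'X^m * w),
      N u <= K * N (u + 'X^m * w) & N w <= K * N (u + 'X^m * w)].
Variables (x : nat -> X) (a : nat -> R) (sg t B : R).
Local Notation Y := (prefix_poly a).
Hypothesis hB : forall n, N (Y n) <= B.
Variables (iota n : nat -> nat) (r : nat -> {poly R}).
Hypothesis hn : forall k, (n k < n k.+1)%N.
Hypothesis hr : successive n r.
Hypothesis hsg : forall k, `|(Y (n k)).[1] - sg| <= 2 ^- k.
Hypothesis ht : forall k, `|(r k).[1] - t| <= 2 ^- k.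
Hypothesis hx : forall k, p (x (iota k) - ev e (Y (n k) + 'X^(n k) * r k)) <= 2 ^- k.
Variables (l : nat -> nat) (c : nat -> R) (eta : R).
Hypothesis eta0 : 0 < eta.
Hypothesis hl : forall j, (l j < l j.+1)%N.
Hypothesis hc : convex_coefs l c.
Hypothesis hl0 : 2 ^- l 0%N <= eta.
Hypothesis hd : forall j,
  N (cblock l c (fun k => 'X^(n k) * zero_sum_part r k) j) <= eta * 2 ^- j.
Hypothesis hu : forall j, N (diff_poly (cblock l c (fun k => 'X^k) j)) <= eta * 2 ^- j.

Let sp : seminorm p := equivalent_norm_seminorm hp.
Let sN : seminorm N := hN.1.
Let N10 : 0 <= N 1 := semi_ge0 sN 1.
Let x' k : {poly R} := Y (n k) + 'X^(n k) * r k.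
Let w := cblock l c (x \o iota).
Let D := 5 * B + 12 * N 1.

Definition tails_le (b : nat -> R) (m : nat) (A : R) :=
  forall i, (i <= m)%N -> `|\sum_(i <= k < m) b k| <= A.

(** [l j >= l 0 + j], and [hl0] bounds [2 ^- l 0]. *)
Let exp2V_l j k : (l j <= k)%N -> 2 ^- k <= eta * 2 ^- j.
Proof.
move=> lk; have ge : (l 0%N + j <= l j)%N.
  by elim: (j) => [|i IH]; rewrite ?addn0// addnS (leq_ltn_trans IH).
apply: (le_trans (exp2V_le R (leq_trans ge lk))).
by rewrite exprD invfM ler_wpM2r// ltW// exp2V_gt0.
Qed.

Lemma block_approx (b : nat -> R) m A : tails_le b m A ->
  p (lincomb m b w - ev e (\sum_(j < m) b j *: cblock l c x' j)) <= 4 * eta * A.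
Proof.
move=> hA.
have -> : lincomb m b w - ev e (\sum_(j < m) b j *: cblock l c x' j) =
    \sum_(j < m) b j *: cblock l c (fun k => x (iota k) - ev e (x' k)) j.
  rewrite /lincomb [ev e _]linear_sum/= -sumrB; apply: eq_bigr => j _.
  rewrite linearZ/= -scalerBr cblock_linear; congr (_ *: _).
  rewrite /w /cblock -sumrB; apply: eq_bigr => k _; by rewrite scalerBr.
apply: (tails_weighted_sum sp hA) => j; apply: (cblock_le hc sp) => k /andP[lk _].
exact: le_trans (hx k) (exp2V_l lk).
Qed.

(** What remains of [x' k] is its zero-sum part, small on blocks by [hd], and the deviation of its
    sum from [t], placed at [e (n k)]. *)
Lemma block_decomposition (b : nat -> R) m A : tails_le b m A ->
  N (\sum_(j < m) b j *: cblock l c x' j - \sum_(j < m) b j *: cblock l c (Y \o n) j -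
     t *: \sum_(j < m) b j *: cblock l c (fun k => 'X^(n k)) j) <= 4 * ((1 + N 1) * eta) * A.
Proof.
move=> hA.
have -> : \sum_(j < m) b j *: cblock l c x' j - \sum_(j < m) b j *: cblock l c (Y \o n) j -
     t *: \sum_(j < m) b j *: cblock l c (fun k => 'X^(n k)) j =
    \sum_(j < m) b j *: (cblock l c (fun k => 'X^(n k) * zero_sum_part r k) j +
       cblock l c (fun k => ((r k).[1] - t) *: 'X^(n k)) j).
  rewrite scaler_sumr -!sumrB; apply: eq_bigr => j _.
  rewrite scalerA [t * b j]mulrC -scalerA -!scalerBr; congr (_ *: _).
  rewrite -cblockZ -cblockD /cblock -!sumrB; apply: eq_bigr => k _.
  rewrite -!scalerBr; congr (_ *: _).
  by rewrite /x' /zero_sum_part /= -!mul_polyC polyCB; ring.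
apply: (@tails_weighted_sum _ _ N
  (fun j => cblock l c (fun k => 'X^(n k) * zero_sum_part r k) j +
     cblock l c (fun k => ((r k).[1] - t) *: 'X^(n k)) j) b m A _ sN hA) => j.
rewrite (le_trans (semiD sN _ _))//.
have h : N (cblock l c (fun k => ((r k).[1] - t) *: 'X^(n k)) j) <= eta * 2 ^- j * N 1.
  apply: (cblock_le hc sN) => k /andP[lk _].
  by rewrite (semiZ sN) (spX hN) ler_wpM2r// (le_trans (ht k))// exp2V_l.
by have := hd j; lra.
Qed.

Lemma block_prefix_bound (b : nat -> R) m A : tails_le b m A ->
  N (\sum_(j < m) b j *: cblock l c (Y \o n) j) <= D * A.
Proof.
move=> hA; have [g [hg gA]] := flatten_tails hl hc hA.
rewrite hg; exact: (prefix_combination_bound hN hB hn hsg gA).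
Qed.

(** [N_le_diff_zN] splits the norm: the difference term is small by [hu], and convex blocks do not
    increase the homogeneous seminorm, which is itself spreading. *)
Lemma block_sum_bound (zN : {poly R} -> R) (b : nat -> R) m A :
  (forall q eps, 0 < eps ->
    exists M0, forall M, (M0 <= M)%N -> `|N (blow M q) - zN q| <= eps) ->
  tails_le b m A ->
  N (\sum_(j < m) b j *: cblock l c (fun k => 'X^(n k)) j) <=
    4 * eta * A + zN (\sum_(j < m) b j *: 'X^j).
Proof.
move=> hz hA; have [g hg] := flatten_blocks c hl b m.
have -> : \sum_(j < m) b j *: cblock l c (fun k => 'X^(n k)) j =
    spread n (\sum_(k < l m) g k *: 'X^k).
  by rewrite hg spread_sum.
rewrite (hN.2 n (increasing_ltn hn)) (le_trans (N_le_diff_zN hN hz _))// -hg lerD//.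
  rewrite linear_sum/=.
  under eq_bigr do rewrite linearZ/=.
  exact: (@tails_weighted_sum _ _ N (fun j => diff_poly (cblock l c (fun k => 'X^k) j))
    b m A _ sN hA hu).
exact: (sp_convex_blocks (zN_spreading hN hz)).
Qed.

Lemma partial_ev m q : partial hbasis m (ev e q) = prefix_poly (fun i => q`_i) m.
Proof. by apply/polyP => i; rewrite !coef_poly (coords_ev hp). Qed.

Lemma prefix_poly_id m (q : {poly R}) : (size q <= m)%N -> prefix_poly (fun i => q`_i) m = q.
Proof.
move=> qm; apply/polyP => i; rewrite coef_poly; case: ltnP => // mi.
by rewrite nth_default// (leq_trans qm).
Qed.

Lemma prefix_poly_low m m' (q : {poly R}) : (m <= m')%N ->
  prefix_poly (fun i => (Y m' + 'X^m' * q)`_i) m = Y m.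
Proof.
move=> mm; apply/polyP => i; rewrite !coef_poly; case: ltnP => // im.
by rewrite coefD coefXnM coef_poly (leq_trans im mm) addr0.
Qed.

Lemma size_x' k : (size (x' k) <= n k.+1)%N.
Proof.
rewrite /x' (leq_trans (size_polyD _ _))// geq_max.
rewrite (leq_trans (size_prefix_poly _ _) (ltnW (hn k)))/=.
by rewrite (leq_trans (size_polyMleq _ _))// size_polyXn/=.
Qed.

Let nle := strictly_increasing_leq hn.

(** * Case of a nonzero limit sum: blocks equivalent to the homogeneous part *)

Section HomogeneousCase.
Variable zN : {poly R} -> R.
Hypothesis hz : forall q eps, 0 < eps ->
  exists M0, forall M, (M0 <= M)%N -> `|N (blow M q) - zN q| <= eps.
Hypothesis t0 : t != 0.
(** Tails are at most [K] times the homogeneous norm. [D] comes from the [Y] part, [4 * (2 + N 1)]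
    from the approximation errors, and the terms in [t] from [block_sum_bound]. *)
Let C1 := (D + 4 * `|t| + 4 * (2 + N 1)) * K + `|t|.
Let C2 := (16 * zN 1 + 8 * K * (2 + N 1)) * K.
Hypothesis eta1 : eta <= 1.
Hypothesis eta2 : C2 * eta <= `|t| / 2.
Hypothesis eta3 : `|t|^-1 * C1 * (C2 * eta) * (4 * K / `|t|) <= 2^-1.

Let sz : seminorm zN := zN_seminorm hN hz.
Let tp : 0 < `|t|. Proof. by rewrite normr_gt0. Qed.

Lemma homogeneous_tails (b : nat -> R) m :
  tails_le b m (K * zN (\sum_(j < m) b j *: 'X^j)).
Proof. by move=> i im; exact: (homogeneous_tail_bound hz K0 hK). Qed.

Lemma homogeneous_upper (b : nat -> R) m :
  p (lincomb m b w) <= C1 * zN (\sum_(j < m) b j *: 'X^j).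
Proof.
have hA := @homogeneous_tails b m; set zb := zN _ in hA *.
have zb0 : 0 <= zb by exact: semi_ge0 sz _.
have h1 := block_approx hA; have h2 := block_decomposition hA.
have h3 := block_prefix_bound hA; have h4 := block_sum_bound hz hA.
rewrite -/zb in h4.
set u1 := lincomb m b w in h1 *.
set q2 := \sum_(j < m) b j *: cblock l c x' j in h1 h2.
set q3 := \sum_(j < m) b j *: cblock l c (Y \o n) j in h2 h3.
set q4 := \sum_(j < m) b j *: cblock l c (fun k => 'X^(n k)) j in h2 h4.
have h5 := semi_le_dist sp u1 (ev e q2).
have h6 := semi_le_dist sN q2 (q3 + t *: q4).
have h7 := semiD sN q3 (t *: q4); rewrite (semiZ sN) in h7.
rewrite opprD addrA in h6.
have h8 : `|t| * N q4 <= `|t| * (4 * eta * (K * zb) + zb) by rewrite ler_pM2l.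
have Kz : 0 <= K * zb by rewrite mulr_ge0// ltW.
have h9 : eta * (K * zb) <= K * zb by rewrite ler_piMl.
have h10 : `|t| * (eta * (K * zb)) <= `|t| * (K * zb) by rewrite ler_pM2l.
have h11 : N 1 * (eta * (K * zb)) <= N 1 * (K * zb) by rewrite ler_wpM2l.
rewrite -/(N q2) in h5; rewrite /C1; lra.
Qed.

Definition seg (j : nat) (v : X) : R :=
  (partial hbasis (n (l j.+1)) v).[1] - (partial hbasis (n (l j)) v).[1].

Lemma seg_lin j : linear (seg j : X -> R^o).
Proof.
move=> s u v; suff : seg j (s *: u + v) = s * seg j u + seg j v by [].
by rewrite /seg !partial_lin !hornerD !hornerZ opprD addrACA mulrBr.
Qed.

Definition seg_poly (m : nat) (v : X) : {poly R} := \sum_(j < m) seg j v *: 'X^j.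

Lemma seg_poly_lin m s u v : seg_poly m (s *: u + v) = s *: seg_poly m u + seg_poly m v.
Proof.
rewrite /seg_poly scaler_sumr -big_split/=; apply: eq_bigr => j _.
by rewrite (seg_lin j) scalerDl scalerA.
Qed.

(** The section of [v] is cut into consecutive blocks whose coordinate sums are the [seg], so that
    [zN_blocks] applies. *)
Lemma seg_poly_tail j0 m v : zN (seg_poly (j0 + m) v - seg_poly j0 v) <=
  N (partial hbasis (n (l (j0 + m)%N)) v - partial hbasis (n (l j0)) v).
Proof.
pose mm k := n (l (j0 + k)%N).
have mmS k : (mm k <= mm k.+1)%N by apply: nle; rewrite addnS ltnW.
pose q k : {poly R} := \poly_(i < mm k.+1 - mm k) coords hbasis v (mm k + i)%N.
have qE k : 'X^(mm k) * q k = partial hbasis (mm k.+1) v - partial hbasis (mm k) v.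
  by rewrite [partial _ (mm k.+1) v](prefix_poly_split _ (mmS k)) addrAC subrr add0r.
have q1 k : (q k).[1] = seg (j0 + k)%N v.
  have -> : (q k).[1] = ('X^(mm k) * q k).[1] by rewrite hornerM hornerXn expr1n mul1r.
  by rewrite qE hornerD hornerN /seg /mm addnS.
have -> : seg_poly (j0 + m) v - seg_poly j0 v = 'X^j0 * \sum_(k < m) (q k).[1] *: 'X^k.
  rewrite /seg_poly big_split_ord/= addrAC subrr add0r mulr_sumr; apply: eq_bigr => k _.
  by rewrite q1 -scalerAr -exprD.
rewrite (sp_shift (zN_spreading hN hz)).
have -> : partial hbasis (n (l (j0 + m)%N)) v - partial hbasis (n (l j0)) v = bsum mm q m.
  rewrite /bsum (eq_bigr (fun k : 'I_m => partial hbasis (mm k.+1) v - partial hbasis (mm k) v)).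
    rewrite -(big_mkord xpredT (fun k => partial hbasis (mm k.+1) v - partial hbasis (mm k) v)).
    by rewrite telescope_sumr// /mm addn0.
  by move=> k _; rewrite qE.
apply: (zN_blocks hN hz) => k _.
by rewrite -leq_subRL// size_poly.
Qed.

Lemma seg_poly_le m v : zN (seg_poly m v) <= 2 * K * p v.
Proof.
have := seg_poly_tail 0 m v; rewrite add0n /seg_poly big_ord0 subr0 => /le_trans; apply.
rewrite (le_trans (semiB sN _ _))//.
have := (partial_bounds hp hbasis K0 hK (n (l m)) v).2.
have := (partial_bounds hp hbasis K0 hK (n (l 0%N)) v).2.
by rewrite -!/(N _); lra.
Qed.

Let lle := strictly_increasing_leq hl.

(** The cut at [n (l i)] falls either within the [Y] part of [x' k] or beyond its whole support. *)
Lemma partial_x' i k : (partial hbasis (n (l i)) (ev e (x' k))).[1] =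
  if (l i <= k)%N then (Y (n (l i))).[1] else (Y (n k)).[1] + (r k).[1].
Proof.
rewrite partial_ev; case: leqP => h; first by rewrite /x' prefix_poly_low// nle.
rewrite prefix_poly_id; last by rewrite (leq_trans (size_x' k))// nle.
by rewrite /x' !hornerE expr1n mul1r.
Qed.

Lemma seg_cblock i j u : seg i (ev e (cblock l c u j)) =
  \sum_(l j <= k < l j.+1) c k * seg i (ev e (u k)).
Proof.
have [F FE] := linear_pack (seg_lin i).
by rewrite -FE !cblock_linear /cblock; apply: eq_bigr => k _; rewrite /= FE.
Qed.

Let et i := (Y (n (l i.+1))).[1] - (Y (n (l i))).[1].
Let th i := seg i (ev e (cblock l c x' i)) - t.

(** The matrix is triangular: a later block shows only the increment of [Y] on the section, an
    earlier one is already exhausted, and the diagonal is [t] up to an error. *)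
Lemma seg_block i j : seg i (ev e (cblock l c x' j)) =
  et i * (i < j)%:R + (i == j)%:R * (t + th i).
Proof.
have [ij|ji|<-] := ltngtP i j.
- rewrite mul0r addr0 mulr1 seg_cblock.
  have -> : et i = \sum_(l j <= k < l j.+1) c k * et i by rewrite -mulr_suml hc.2 mul1r.
  apply: eq_big_nat => k /andP[lk _]; rewrite /seg !partial_x'.
  by rewrite (leq_trans (lle ij) lk) (leq_trans (lle (ltnW ij)) lk).
- rewrite mul0r addr0 mulr0 seg_cblock big_nat big1// => k /andP[_ kl].
  rewrite /seg !partial_x' [(l i <= k)%N]leqNgt [(l i.+1 <= k)%N]leqNgt.
  rewrite (leq_trans kl (lle ji)) (leq_trans kl (lle (leq_trans ji (leqnSn i)))).
  by rewrite subrr mulr0.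
- by rewrite mulr0 add0r mul1r /th addrC subrK.
Qed.

Lemma et_le i : `|et i| <= 2 * eta * 2 ^- i.
Proof.
have -> : et i = ((Y (n (l i.+1))).[1] - sg) - ((Y (n (l i))).[1] - sg).
  by rewrite opprB addrA subrK.
rewrite (le_trans (ler_normB _ _))//.
have h1 := le_trans (hsg (l i)) (exp2V_l (leqnn (l i))).
have h2 := le_trans (hsg (l i.+1)) (exp2V_l (ltnW (hl i))).
lra.
Qed.

Lemma th_le i : `|th i| <= 3 * eta * 2 ^- i.
Proof.
have -> : th i = cblock l c (fun k => seg i (ev e (x' k)) - t : R^o) i.
  rewrite /th seg_cblock /cblock.
  under [RHS]eq_bigr do rewrite [_ *: _]mulrBr.
  by rewrite sumrB -mulr_suml hc.2 mul1r.
apply: (cblock_le hc (norm_seminorm R^o)) => k /andP[lk kl].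
rewrite /seg !partial_x' lk leqNgt kl/=.
have h1 := le_trans (hsg (l i)) (exp2V_l (leqnn (l i))).
have h2 := le_trans (hsg k) (exp2V_l lk).
have h3 := le_trans (ht k) (exp2V_l lk).
move: h1 h2 h3; rewrite !ler_norml => /andP[h1 h1'] /andP[h2 h2'] /andP[h3 h3'].
by apply/andP; split; lra.
Qed.

(** The entries above the diagonal act through tail sums of [b] and the diagonal errors through [b]
    itself; both are summable in the row index. *)
Lemma seg_poly_approx (b : nat -> R) m :
  zN (seg_poly m (lincomb m b w) - t *: \sum_(j < m) b j *: 'X^j) <=
  C2 * eta * zN (\sum_(j < m) b j *: 'X^j).
Proof.
have hA := @homogeneous_tails b m; set zb := zN (\sum_(j < m) b j *: 'X^j) in hA *.
set A := K * zb in hA.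
have A0 : 0 <= A by apply: le_trans (hA m (leqnn m)).
set W := \sum_(j < m) b j *: cblock l c x' j.
have h1 := block_approx hA; rewrite -/W in h1.
have -> : seg_poly m (lincomb m b w) - t *: \sum_(j < m) b j *: 'X^j =
    seg_poly m (lincomb m b w - ev e W) + (seg_poly m (ev e W) - t *: \sum_(j < m) b j *: 'X^j).
  rewrite addrA -[seg_poly m (_ - _)]scale1r -seg_poly_lin scale1r subrK//.
rewrite (le_trans (semiD sz _ _))//.
have h2 : zN (seg_poly m (lincomb m b w - ev e W)) <= 2 * K * (4 * eta * A).
  by rewrite (le_trans (seg_poly_le _ _))// ler_wpM2l// mulr_ge0// ltW.
have h3 : zN (seg_poly m (ev e W) - t *: \sum_(j < m) b j *: 'X^j) <= 16 * eta * A * zN 1.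
  have -> : seg_poly m (ev e W) - t *: \sum_(j < m) b j *: 'X^j =
      \sum_(i < m) (et i * (\sum_(i.+1 <= k < m) b k) + b i * th i) *: 'X^i.
    rewrite /seg_poly scaler_sumr -sumrB; apply: eq_bigr => i _.
    rewrite scalerA -scalerBl; congr (_ *: _).
    have [F FE] := linear_pack (seg_lin i).
    have -> : seg i (ev e W) = \sum_(j < m) b j * seg i (ev e (cblock l c x' j)).
      rewrite -FE /W [ev e _]linear_sum [LHS]linear_sum; apply: eq_bigr => j _.
      by rewrite /= [ev e (_ *: _)]linearZ/= linearZ/= FE.
    under eq_bigr do rewrite seg_block mulrDr mulrCA.
    rewrite big_split/= -mulr_sumr.
    have -> : \sum_(j < m) b j * (i < j)%:R = \sum_(i.+1 <= k < m) b k.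
      rewrite [RHS](big_nat_widenl _ 0)//= [RHS]big_mkcond/= big_mkord; apply: eq_bigr => j _.
      by case: (i < j)%N; rewrite ?mulr1 ?mulr0.
    have -> : \sum_(j < m) b j * ((nat_of_ord i == j)%:R * (t + th i)) = b i * (t + th i).
      rewrite (bigD1 i)//= eqxx mul1r big1 ?addr0// => j ji.
      by rewrite (_ : (_ == _) = false) ?mul0r ?mulr0//; apply/negbTE; rewrite eq_sym.
    ring.
  (* Row [i] costs 2 from [et_le] and 2 times 3 from [tails_coef] and [th_le]. *)
  apply: (@le_trans _ _ (\sum_(i < m) (8 * eta * A * zN 1) * 2 ^- i)).
    apply: (semi_sum_le sz) => i _; rewrite (semiZ sz) (spX (zN_spreading hN hz)).
    rewrite mulrAC ler_wpM2r ?(semi_ge0 sz)//.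
    rewrite (le_trans (ler_normD _ _))// !normrM.
    have g1 := et_le i; have g2 := th_le i; have g3 := hA i.+1 (ltn_ord i).
    have g4 := tails_coef hA (ltn_ord i).
    have g5 : `|et i| * `|\sum_(i.+1 <= k < m) b k| <= 2 * eta * 2 ^- i * A by rewrite ler_pM.
    have g6 : `|b i| * `|th i| <= 2 * A * (3 * eta * 2 ^- i) by rewrite ler_pM.
    lra.
  rewrite -mulr_sumr.
  have g0 : 0 <= 8 * eta * A * zN 1 by rewrite !mulr_ge0 ?(semi_ge0 sz)// ltW.
  by have := ler_wpM2l g0 (geometric_sum_le R m); lra.
have h4 : 0 <= K * (eta * A).
  by apply: mulr_ge0; [exact: ltW|apply: mulr_ge0; first exact: ltW].
have h5 : 0 <= N 1 * (K * (eta * A)) by rewrite mulr_ge0.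
rewrite /C2.
have -> : (16 * zN 1 + 8 * K * (2 + N 1)) * K * eta * zb =
   16 * eta * A * zN 1 + 8 * (2 + N 1) * (K * (eta * A)) by rewrite /A; ring.
lra.
Qed.

(** By [eta2] the error in [seg_poly_approx] is at most half of the main term and is absorbed. *)
Lemma homogeneous_lower (b : nat -> R) m :
  zN (\sum_(j < m) b j *: 'X^j) <= 4 * K / `|t| * p (lincomb m b w).
Proof.
have h1 := seg_poly_approx b m; have h2 := seg_poly_le m (lincomb m b w).
set zb := zN (\sum_(j < m) b j *: 'X^j) in h1 *.
have zb0 : 0 <= zb by exact: semi_ge0 sz _.
have h3 := semi_le_dist sz (t *: \sum_(j < m) b j *: 'X^j) (seg_poly m (lincomb m b w)).
rewrite (semi_distC sz) (semiZ sz) -/zb in h3.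
have h4 : C2 * eta * zb <= `|t| / 2 * zb by rewrite ler_wpM2r.
rewrite mulrAC ler_pdivlMr//; lra.
Qed.

Lemma ev_homogeneous_upper q : p (ev w q) <= C1 * zN q.
Proof.
have := homogeneous_upper (fun i => q`_i) (size q).
by rewrite -(polyE (leqnn (size q))).
Qed.

Lemma homogeneous_complemented : complemented (closed_span w).
Proof.
have N11 : 0 <= N 1 by exact: N10.
have B0 : 0 <= B by apply: le_trans (hB 0); exact: semi_ge0 sN _.
have C10 : 0 <= C1.
  rewrite /C1 /D addr_ge0// mulr_ge0 ?(ltW K0)//.
  by rewrite !addr_ge0 ?mulr_ge0// ?addr_ge0.
have CK0 : 0 <= `|t|^-1 * C1 * (2 * K) by rewrite !mulr_ge0 ?invr_ge0 ?(ltW K0).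
have Q1 u : p (t^-1 *: ev w u) <= `|t|^-1 * C1 * zN u.
  rewrite (semiZ sp) normfV -mulrA ler_wpM2l ?invr_ge0//.
  exact: ev_homogeneous_upper.
have tC : 0 <= `|t|^-1 * C1 by rewrite mulr_ge0 ?invr_ge0.
apply: (almost_projection hp (Q := fun m v => t^-1 *: ev w (seg_poly m v)) CK0).
- move=> m s u v; rewrite seg_poly_lin linearP scalerDr !scalerA; congr (_ *: _ + _).
  exact: mulrC.
- move=> m v; rewrite (le_trans (Q1 _))// -[leRHS]mulrA ler_wpM2l//; exact: seg_poly_le.
- by move=> m v; exists (t^-1 *: seg_poly m v); rewrite linearZ.
- move=> v; apply: (pcauchy_cvg hp) => eps e0.
  have tC1 : 0 < `|t|^-1 * C1 + 1 by rewrite ltr_wpDl.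
  have e20 : 0 < eps / (2 * (`|t|^-1 * C1 + 1)) by rewrite divr_gt0// mulr_gt0.
  have [n0 hn0] := partial_cvg hp hbasis v e20.
  exists n0 => m mn; rewrite -scalerBr -linearB/= (le_trans (Q1 _))//.
  rewrite -(subnKC mn).
  have nk k : (n0 <= k)%N -> (n0 <= n (l k))%N.
    move=> h; apply: (leq_trans h); apply: (leq_trans (strictly_increasing_geq hl k)).
    exact: strictly_increasing_geq.
  have h1 := hn0 _ (nk n0 (leqnn _)).
  have h2 := hn0 _ (nk (n0 + (m - n0))%N (leq_addr _ _)).
  have h3 := seg_poly_tail n0 (m - n0) v.
  have h4 : N (partial hbasis (n (l (n0 + (m - n0))%N)) v - partial hbasis (n (l n0)) v) <=
     eps / (2 * (`|t|^-1 * C1 + 1)) + eps / (2 * (`|t|^-1 * C1 + 1)).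
    rewrite /N linearB/=.
    have -> : ev e (partial hbasis (n (l (n0 + (m - n0))%N)) v) - ev e (partial hbasis (n (l n0)) v) =
      (v - ev e (partial hbasis (n (l n0)) v)) -
      (v - ev e (partial hbasis (n (l (n0 + (m - n0))%N)) v)).
      by rewrite opprB [RHS]addrC addrA subrK.
    by rewrite (le_trans (semiB sp _ _))// lerD.
  apply: (@le_trans _ _ ((`|t|^-1 * C1 + 1) * zN (seg_poly (n0 + (m - n0)) v - seg_poly n0 v))).
    by rewrite ler_wpM2r ?(semi_ge0 sz)//; lra.
  rewrite mulrC -ler_pdivlMr//; apply: (le_trans h3); apply: (le_trans h4).
  by rewrite invfM; lra.
(* The error, small in the homogeneous seminorm, is converted to [p] by the lower estimate; [eta3]
   is the resulting requirement. *)
- move=> q; exists (size q) => m qm.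
  have -> : t^-1 *: ev w (seg_poly m (ev w q)) - ev w q =
      t^-1 *: ev w (seg_poly m (ev w q) - t *: q).
    by rewrite linearB/= scalerBr [ev w (t *: q)]linearZ/= scalerA mulVf// scale1r.
  rewrite (le_trans (Q1 _))//.
  have h1 := seg_poly_approx (fun i => q`_i) m.
  have h2 := homogeneous_lower (fun i => q`_i) m.
  rewrite [lincomb m _ w](_ : _ = ev w q) in h1 h2; last by rewrite (evE w qm).
  rewrite -(polyE qm) in h1 h2.
  have C2e : 0 <= C2 * eta.
    by rewrite /C2 mulr_ge0 ?(ltW eta0)// mulr_ge0 ?(ltW K0)// addr_ge0// !mulr_ge0 ?(semi_ge0 sz) ?(ltW K0)// addr_ge0.
  apply: (@le_trans _ _ (`|t|^-1 * C1 * (C2 * eta * (4 * K / `|t| * p (ev w q))))).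
    rewrite ler_wpM2l// (le_trans h1)// ler_wpM2l//.
  rewrite [leLHS](_ : _ = `|t|^-1 * C1 * (C2 * eta) * (4 * K / `|t|) * p (ev w q)).
    by rewrite ler_wpM2r ?(semi_ge0 sp).
  by rewrite !mulrA.
Qed.

End HomogeneousCase.

(** * Case of zero limit sum: blocks equivalent to the summing basis *)

Section SummingCase.
Variable delta : R.
Hypothesis delta0 : 0 < delta.
Hypothesis hgap : forall k, delta <= N (Y (n k.+1) - Y (n k)).
Hypothesis t0 : t = 0.
Hypothesis l00 : (0 < l 0%N)%N.
Let C1 := D + 4 * (2 + N 1).
Let C2 := 2 * K / delta.
Hypothesis eta1 : eta <= 1.
Hypothesis eta4 : C2 * (4 * eta * (2 + N 1)) <= 2^-1.

Lemma summing_error (b : nat -> R) m A : tails_le b m A ->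
  p (lincomb m b w - ev e (\sum_(j < m) b j *: cblock l c (Y \o n) j)) <=
    4 * eta * (2 + N 1) * A.
Proof.
move=> hA; have h1 := block_approx hA.
have h2 : p (ev e (\sum_(j < m) b j *: cblock l c x' j) -
    ev e (\sum_(j < m) b j *: cblock l c (Y \o n) j)) <= 4 * ((1 + N 1) * eta) * A.
  by have := block_decomposition hA; rewrite t0 scale0r subr0 /N linearB.
set u := ev e (\sum_(j < m) b j *: cblock l c x' j) in h1 h2.
have := semiD sp (lincomb m b w - u) (u - ev e (\sum_(j < m) b j *: cblock l c (Y \o n) j)).
by rewrite addrA subrK => /le_trans; apply; lra.
Qed.

Lemma summing_upper (b : nat -> R) m A : tails_le b m A -> p (lincomb m b w) <= C1 * A.
Proof.
move=> hA; have h1 := summing_error hA; have h2 := block_prefix_bound hA.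
set q := \sum_(j < m) b j *: cblock l c (Y \o n) j in h1 h2.
have h3 := semi_le_dist sp (lincomb m b w) (ev e q).
have A0 : 0 <= A by apply: le_trans (hA m (leqnn m)).
have h4 : 0 <= (2 + N 1) * A by rewrite mulr_ge0// addr_ge0.
have h5 : eta * ((2 + N 1) * A) <= (2 + N 1) * A by rewrite ler_piMl.
rewrite -/(N q) in h3; rewrite /C1; lra.
Qed.

(** A single increment ending at [l j]: each [Y (n k)] contains all of it or none of it. Positivity
    of [l 0] makes the predecessor genuine. *)
Let gap_block j := Y (n (l j)) - Y (n (l j).-1).

Let l_gt0 j : (0 < l j)%N.
Proof. by apply: (leq_trans l00); apply: strictly_increasing_leq hl _ _ _. Qed.

Let gap_block_le j : delta <= N (gap_block j).
Proof. by have := hgap (l j).-1; rewrite prednK. Qed.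

Lemma gap_functional j : exists f : {linear X -> R^o},
  f (ev e (gap_block j)) = 1 /\ forall u, `|f u| <= delta^-1 * p u.
Proof.
have [f [f1 f2]] := norming_functional sp (ev e (gap_block j)).
have d0 : 0 < p (ev e (gap_block j)) by exact: lt_le_trans delta0 (gap_block_le j).
have lg : linear ((fun u => (p (ev e (gap_block j)))^-1 * f u) : X -> R^o).
  by move=> s u v; rewrite linearP/= mulrDr; congr (_ + _); exact: mulrCA.
have [g gE] := linear_pack lg; exists g; split => [|u].
  by rewrite gE f1 mulVf// gt_eqF.
rewrite gE normrM gtr0_norm ?invr_gt0//; apply: ler_pM => //.
  by rewrite invr_ge0 ltW.
by rewrite lef_pV2 ?posrE//; exact: gap_block_le.
Qed.

Definition gap_coef (j : nat) (v : X) : R := projT1 (cid (gap_functional j))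
  (ev e (partial hbasis (n (l j)) v - partial hbasis (n (l j).-1) v)).

Lemma gap_coef_lin j s u v : gap_coef j (s *: u + v) = s * gap_coef j u + gap_coef j v.
Proof.
rewrite /gap_coef; set f := projT1 _.
rewrite !partial_lin opprD addrACA -scalerBr.
by rewrite [ev e _]linearP linearP.
Qed.

Lemma gap_coef_le_dist j v : `|gap_coef j v| <=
  delta^-1 * N (partial hbasis (n (l j)) v - partial hbasis (n (l j).-1) v).
Proof. by rewrite /gap_coef; have [_ h] := projT2 (cid (gap_functional j)); exact: h. Qed.

Lemma gap_coef_le j v : `|gap_coef j v| <= C2 * p v.
Proof.
rewrite (le_trans (gap_coef_le_dist _ _))//.
have h0 : 0 <= delta^-1 by rewrite invr_ge0 ltW.
have -> : C2 * p v = delta^-1 * (2 * K * p v) by rewrite /C2; ring.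
rewrite ler_wpM2l// (le_trans (semiB sN _ _))//.
have := (partial_bounds hp hbasis K0 hK (n (l j)) v).2.
have := (partial_bounds hp hbasis K0 hK (n (l j).-1) v).2.
by rewrite -!/(N _); lra.
Qed.

Lemma gap_coef_prefix j k : gap_coef j (ev e (Y (n k))) = (l j <= k)%:R.
Proof.
rewrite /gap_coef !partial_ev.
have E i : prefix_poly (fun i => (Y (n k))`_i) (n i) = if (i <= k)%N then Y (n i) else Y (n k).
  case: leqP => h; last by rewrite prefix_poly_id// (leq_trans (size_prefix_poly _ _))// nle// ltnW.
  by have := @prefix_poly_low (n i) (n k) 0 (nle h); rewrite mulr0 addr0.
rewrite !E; case: leqP => h.
  rewrite (leq_trans (leq_pred _) h).
  by have [h1 _] := projT2 (cid (gap_functional j)).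
have -> : (if ((l j).-1 <= k)%N then Y (n (l j).-1) else Y (n k)) = Y (n k).
  by case: ifP => // h2; congr (Y (n _)); lia.
by rewrite subrr linear0 linear0.
Qed.

Let lle' := strictly_increasing_leq hl.

(** On the [Y] parts the functionals are exactly the coordinates of the summing basis, because a
    block lies wholly before or wholly from [l j] on. *)
Lemma gap_coef_combination j (b : nat -> R) m :
  gap_coef j (ev e (\sum_(i < m) b i *: cblock l c (Y \o n) i)) = \sum_(j <= i < m) b i.
Proof.
have lf : linear (gap_coef j : X -> R^o) by move=> s u v; exact: gap_coef_lin.
have [F FE] := linear_pack lf.
rewrite -FE [ev e _]linear_sum [LHS]linear_sum [RHS](big_nat_widenl _ 0)//= [RHS]big_mkcond/= big_mkord.
apply: eq_bigr => i _.
rewrite /= [ev e (_ *: _)]linearZ/= linearZ/= [ev e (cblock _ _ _ _)]cblock_linear.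
rewrite [F (cblock _ _ _ _)]cblock_linear /cblock.
have -> : \sum_(l i <= k < l i.+1) c k *: (F \o (ev e \o (Y \o n))) k = (j <= i)%:R.
  transitivity (\sum_(l i <= k < l i.+1) c k * (j <= i)%:R).
    apply: eq_big_nat => k /andP[lk kl]; rewrite /= FE gap_coef_prefix.
    congr (_ * (nat_of_bool _)%:R); case: (leqP j i) => h.
      by rewrite (leq_trans (lle' h) lk).
    by apply/negbTE; rewrite -ltnNge (leq_trans kl)// lle'.
  by rewrite -mulr_suml hc.2 mul1r.
change (b i * (j <= i)%:R = if (j <= i)%N then b i else 0).
by case: (j <= i)%N; rewrite ?mulr1 ?mulr0.
Qed.

Lemma gap_coef_error j (b : nat -> R) m A : tails_le b m A ->
  `|gap_coef j (lincomb m b w) - \sum_(j <= i < m) b i| <= C2 * (4 * eta * (2 + N 1)) * A.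
Proof.
move=> hA; rewrite -(gap_coef_combination j b m).
set q := \sum_(i < m) _.
have -> : gap_coef j (lincomb m b w) - gap_coef j (ev e q) = gap_coef j (lincomb m b w - ev e q).
  have E := gap_coef_lin j (-1) (ev e q) (lincomb m b w).
  by rewrite scaleN1r mulN1r in E; rewrite [in RHS]addrC E addrC.
rewrite (le_trans (gap_coef_le _ _))// -mulrA ler_wpM2l ?summing_error//.
by rewrite /C2 divr_ge0// ?mulr_ge0// ltW.
Qed.

Let c0n m (b : nat -> R) := c0_norm (lincomb m b (summing_basis R)).

Lemma c0n_tails m (b : nat -> R) : tails_le b m (c0n m b).
Proof. by move=> i _; exact: c0_norm_tail. Qed.

(** Each tail is a gap coefficient up to half of the largest tail, and this half is absorbed. *)
Lemma summing_lower (b : nat -> R) m : c0n m b <= 2 * C2 * p (lincomb m b w).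
Proof.
have hA := @c0n_tails m b; set A := c0n m b in hA *.
have A0 : 0 <= A by apply: le_trans (hA m (leqnn m)).
suff : A <= C2 * p (lincomb m b w) + 2^-1 * A by lra.
apply: c0_norm_le => j.
have h1 := gap_coef_error j hA; have h2 := gap_coef_le j (lincomb m b w).
have h3 : C2 * (4 * eta * (2 + N 1)) * A <= 2^-1 * A by rewrite ler_wpM2r.
move: h1 h2; rewrite !ler_norml => /andP[h1 h1'] /andP[h2 h2'].
by apply/andP; split; lra.
Qed.

(** Inverts the passage to tails: if [tau m = 0], this is the combination whose tail sums are the
    [tau j]. *)
Definition telescope_comb (tau : nat -> R) (m : nat) : X :=
  lincomb m (fun j => tau j - tau j.+1) w.

Lemma telescope_comb_le tau m A : 0 <= A -> tau m = 0 -> (forall j, `|tau j| <= A) ->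
  p (telescope_comb tau m) <= C1 * A.
Proof.
move=> A0 tm hA; apply: summing_upper => i im.
rewrite (eq_bigr (fun k => - (tau k.+1 - tau k))) => [|k _]; last by rewrite opprB.
by rewrite sumrN telescope_sumr// tm sub0r opprK.
Qed.

Let tau m v j := if (j < m)%N then gap_coef j v else 0.

Lemma telescope_comb_widen tau' m M : (m <= M)%N -> (forall j, (m <= j)%N -> tau' j = 0) ->
  telescope_comb tau' m = telescope_comb tau' M.
Proof.
move=> mM h; rewrite /telescope_comb /lincomb.
rewrite -!(big_mkord xpredT (fun j => (tau' j - tau' j.+1) *: w j)).
rewrite [RHS](big_cat_nat (n := m))//= [X in _ + X]big_nat [X in _ + X]big1 ?addr0// => j /andP[mj _].
by rewrite !h ?subrr ?scale0r// (leq_trans mj).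
Qed.

Lemma telescope_comb_lin s tau1 tau2 m :
  telescope_comb (fun j => s * tau1 j + tau2 j) m =
  s *: telescope_comb tau1 m + telescope_comb tau2 m.
Proof.
rewrite /telescope_comb /lincomb scaler_sumr -big_split/=; apply: eq_bigr => j _.
by rewrite scalerA -scalerDl; congr (_ *: _); ring.
Qed.

Lemma telescope_comb_sub tau1 tau2 m :
  telescope_comb (fun j => tau1 j - tau2 j) m = telescope_comb tau1 m - telescope_comb tau2 m.
Proof.
rewrite /telescope_comb /lincomb -sumrB; apply: eq_bigr => j _.
by rewrite -scalerBl; congr (_ *: _); ring.
Qed.

Hypothesis eta3 : C1 * (C2 * (4 * eta * (2 + N 1))) * (2 * C2) <= 2^-1.

Lemma summing_complemented : complemented (closed_span w).
Proof.
have N11 : 0 <= N 1 by exact: N10.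
have B0 : 0 <= B by apply: le_trans (hB 0); exact: semi_ge0 sN _.
have C10 : 0 <= C1 by rewrite /C1 /D !addr_ge0 ?mulr_ge0// ?addr_ge0.
have C20 : 0 <= C2 by rewrite /C2 divr_ge0// ?mulr_ge0// ltW.
have CC : 0 <= C1 * C2 by rewrite mulr_ge0.
have tauz m v j : (m <= j)%N -> tau m v j = 0 by rewrite /tau ltnNge => ->.
apply: (almost_projection hp (Q := fun m v => telescope_comb (tau m v) m) CC).
- move=> m s u v; rewrite -telescope_comb_lin; congr (telescope_comb _ m).
  apply/funext => j; rewrite /tau; case: ifP => _; first exact: gap_coef_lin.
  by rewrite mulr0 addr0.
- move=> m v; rewrite -mulrA; apply: telescope_comb_le.
  + by rewrite mulr_ge0// (semi_ge0 sp).
  + exact: tauz.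
  + move=> j; rewrite /tau; case: ifP => _; first exact: gap_coef_le.
    by rewrite normr0 mulr_ge0// (semi_ge0 sp).
- move=> m v; exists (\sum_(j < m) (tau m v j - tau m v j.+1) *: 'X^j).
  by rewrite ev_sum.
- move=> v; apply: (pcauchy_cvg hp) => eps e0.
  have C11 : 0 < C1 + 1 by lra.
  have e10 : 0 < eps / (C1 + 1) by rewrite divr_gt0.
  have e20 : 0 < delta * (eps / (C1 + 1)) / 2 by rewrite divr_gt0// mulr_gt0.
  have [n0 hn0] := partial_cvg hp hbasis v e20.
  (* For [j > n0] both [l j] and its predecessor are at least [n0], so the gap coefficients of [v]
     are uniformly small there. *)
  exists n0.+1 => m mn.
  rewrite (@telescope_comb_widen _ n0.+1 m mn (tauz n0.+1 v)) -telescope_comb_sub.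
  apply: (@le_trans _ _ (C1 * (eps / (C1 + 1)))); last first.
    by rewrite mulrA ler_pdivrMr// mulrC ler_wpM2l ?(ltW e0)//; lra.
  apply: telescope_comb_le; [exact: ltW|by rewrite !tauz// subrr|].
  move=> j; rewrite /tau.
  have [jn|nj] := ltnP j n0.+1.
    by rewrite (leq_trans jn mn) subrr normr0 ltW.
  rewrite subr0; case: ifP => _; last by rewrite normr0 ltW.
  rewrite (le_trans (gap_coef_le_dist _ _))// ler_pdivrMl//.
  have nk k : (n0 <= k)%N -> (n0 <= n k)%N.
    by move=> h; apply: (leq_trans h); exact: strictly_increasing_geq.
  have jl : (j <= l j)%N by exact: strictly_increasing_geq.
  have h1 := hn0 _ (nk (l j) (leq_trans (ltnW nj) jl)).
  have h2 := hn0 _ (nk (l j).-1 _).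
  have {}h2 := h2 (_ : (n0 <= (l j).-1)%N).
  have {}h2 : p (v - ev e (partial hbasis (n (l j).-1) v)) <= delta * (eps / (C1 + 1)) / 2.
    by apply: h2; rewrite -ltnS prednK// (leq_trans nj).
  rewrite /N linearB/=.
  have -> : ev e (partial hbasis (n (l j)) v) - ev e (partial hbasis (n (l j).-1) v) =
      (v - ev e (partial hbasis (n (l j).-1) v)) - (v - ev e (partial hbasis (n (l j)) v)).
    by rewrite opprB [RHS]addrC addrA subrK.
  by rewrite (le_trans (semiB sp _ _))//; lra.
- move=> q; exists (size q) => m qm.
  pose b i := q`_i.
  have wq : ev w q = lincomb m b w by rewrite (evE w qm).
  have hA := @c0n_tails m b; have hlow := summing_lower b m.
  set A := c0n m b in hA hlow.
  have A0 : 0 <= A by apply: le_trans (hA m (leqnn m)).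
  have wE : ev w q = telescope_comb (fun j => \sum_(j <= i < m) b i) m.
    rewrite wq /telescope_comb /lincomb; apply: eq_bigr => j _; congr (_ *: _).
    by rewrite [\sum_(j <= i < m) _]big_ltn// addrK.
  rewrite {2}wE -telescope_comb_sub.
  have C3 : 0 <= C2 * (4 * eta * (2 + N 1)).
    by apply: mulr_ge0 => //; apply: mulr_ge0; [rewrite mulr_ge0// ltW|lra].
  apply: (@le_trans _ _ (C1 * (C2 * (4 * eta * (2 + N 1)) * A))).
    apply: telescope_comb_le; [by rewrite mulr_ge0|by rewrite tauz// big_geq// subrr|].
    move=> j; rewrite /tau; case: ltnP => mj; first by rewrite wq; exact: gap_coef_error.
    by rewrite big_geq// subrr normr0 mulr_ge0.
  rewrite mulrA; apply: (@le_trans _ _ (C1 * (C2 * (4 * eta * (2 + N 1))) * (2 * C2 * p (ev w q)))).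
    by apply: ler_wpM2l; [exact: mulr_ge0|rewrite wq].
  by rewrite mulrA ler_wpM2r ?(semi_ge0 sp).
Qed.

End SummingCase.
End BlockEstimates.

(** * The dichotomy and the conclusion *)

Lemma small_factor (R : realType) (A1 A2 b1 b2 : R) : 0 < b1 -> 0 < b2 ->
  exists eta, [/\ 0 < eta, eta <= 1, A1 * eta <= b1 & A2 * eta <= b2].
Proof.
move=> b10 b20; have Ap (A : R) : 0 < `|A| + 1 by rewrite ltr_wpDl.
pose eta := Num.min 1 (Num.min (b1 / (`|A1| + 1)) (b2 / (`|A2| + 1))).
have eta0 : 0 < eta by rewrite !lt_min ltr01 !divr_gt0.
have etaA (A b : R) : eta <= b / (`|A| + 1) -> A * eta <= b.
  rewrite ler_pdivlMr// => h; apply: le_trans h; rewrite mulrC ler_wpM2l ?ltW//.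
  by rewrite (le_lt_trans (ler_norm _))// ltrDl.
by exists eta; split => //; rewrite ?etaA// ?ge_min ?lexx ?orbT.
Qed.

Lemma norm_seq_equiv_for (R : realType) (X : normedModType R) (W : lmodType R)
    (p : X -> R) (q : W -> R) (w : nat -> X) (y : nat -> W) (C1 C2 : R) :
  equivalent_norm p -> 0 < C1 -> 0 < C2 ->
  (forall m b, p (lincomb m b w) <= C1 * q (lincomb m b y)) ->
  (forall m b, q (lincomb m b y) <= C2 * p (lincomb m b w)) ->
  seq_equiv_for (fun v : X => `|v|) q w y.
Proof.
move=> [_ _ [c [C [c0 C0 cC]]]] C10 C20 h1 h2.
exists (C2 * C)^-1, (c^-1 * C1); split; rewrite ?invr_gt0 ?mulr_gt0 ?invr_gt0// => m b.
have /andP[lo up] := cC (lincomb m b w); apply/andP; split.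
  rewrite ler_pdivrMl ?mulr_gt0//; apply: (le_trans (h2 m b)).
  by rewrite -mulrA ler_wpM2l// ltW.
by rewrite -mulrA ler_pdivlMl// (le_trans lo).
Qed.

Section Dichotomy.
Variables (R : realType) (X : completeNormedModType R) (e : nat -> X) (p : X -> R) (K : R).
Hypothesis hp : equivalent_norm p.
Hypothesis hbasis : schauder_basis e.
Let N (q : {poly R}) := p (ev e q).
Hypothesis hN : spreading_seminorm N.
Hypothesis K0 : 0 < K.
Hypothesis hK : forall m (u w : {poly R}), (size u <= m)%N ->
  [/\ `|u.[1]| <= K * N (u + 'X^m * w), `|w.[1]| <= K * N (u + 'X^m * w),
      N u <= K * N (u + 'X^m * w) & N w <= K * N (u + 'X^m * w)].
Hypothesis hphi : forall eps, 0 < eps ->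
  exists2 M, (0 < M)%N & N (diff_poly (avg M)) <= eps.
Variable x : nat -> X.
Hypothesis wx : weakly_cauchy x.
Let sp : seminorm p := equivalent_norm_seminorm hp.
Let sN : seminorm N := hN.1.
Let N10 : 0 <= N 1 := semi_ge0 sN 1.
Local Notation Y := (prefix_poly (limit_coords hp hbasis K0 hK wx)).

Section BlockSplitting.
Variables (iota n : nat -> nat) (r : nat -> {poly R}) (sg t B : R).
Hypothesis hsplit : block_splitting hp hbasis K0 hK wx iota n r sg t.
Hypothesis B0 : 0 < B.
Hypothesis hB : forall m, N (Y m) <= B.

Let iota_incr k : (iota k < iota k.+1)%N. Proof. by case: hsplit. Qed.
Let n_incr k : (n k < n k.+1)%N. Proof. by case: hsplit. Qed.
Let hr : successive n r. Proof. by case: hsplit. Qed.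
Let hsg k : `|(Y (n k)).[1] - sg| <= 2 ^- k.
Proof. by case: hsplit => _ _ _ h _; have [] := h k. Qed.
Let ht k : `|(r k).[1] - t| <= 2 ^- k.
Proof. by case: hsplit => _ _ _ h _; have [] := h k. Qed.
Let hx k : p (x (iota k) - ev e (Y (n k) + 'X^(n k) * r k)) <= 2 ^- k.
Proof. by case: hsplit. Qed.

Lemma functional_cvg_subseq (f : {linear X -> R^o}) (D l : R) : 0 <= D ->
  (forall u, `|f u| <= D * p u) -> (f \o x) @ \oo --> (l : R^o) ->
  forall eps, 0 < eps -> exists k0, forall k, (k0 <= k)%N -> `|f (x (iota k)) - l| <= eps.
Proof.
move=> D0 fD /(@cvg_epsP R R^o) fx eps eps0; have [k0 hk0] := fx _ eps0.
exists k0 => k kk; apply: hk0; exact: leq_trans kk (strictly_increasing_geq iota_incr k).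
Qed.

Lemma block_splitting_weakly_cvg (f : {linear X -> R^o}) : (forall u, `|f u| <= p u) ->
  exists l : R, (fun k => f (ev e (Y (n k) + 'X^(n k) * r k))) @ \oo --> l.
Proof.
move=> fp; have fD u : `|f u| <= 1 * p u by rewrite mul1r.
have [l fl] : exists l : R^o, (f \o x) @ \oo --> l.
  exact: (cvg_ex _).1 (wx (continuous_le_p hp ler01 fD)).
exists l; apply/(@cvg_epsP R R^o) => eps eps0.
have e20 : 0 < eps / 2 by rewrite divr_gt0.
have [k1 hk1] := functional_cvg_subseq ler01 fD fl e20.
have [k2 hk2] := exp2V_small e20.
exists (maxn k1 k2) => k; rewrite geq_max => /andP[kk1 kk2].
rewrite -(subrK (f (x (iota k))) (f (ev _ _))) -addrA [leRHS]splitr.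
rewrite (le_trans (ler_normD _ _))// lerD ?hk1//.
by rewrite -linearB (le_trans (fp _))// (semi_distC sp) (le_trans (hx k))// hk2.
Qed.

Lemma homogeneous_case (zN : {poly R} -> R) :
  (forall q eps, 0 < eps -> exists M0, forall M, (M0 <= M)%N -> `|N (blow M q) - zN q| <= eps) ->
  t != 0 ->
  exists (w : nat -> X) (C1 C2 : R), [/\ convex_block_sequence x w, complemented (closed_span w),
    0 < C1 /\ 0 < C2,
    forall m (b : nat -> R), p (lincomb m b w) <= C1 * zN (\sum_(j < m) b j *: 'X^j) &
    forall m (b : nat -> R), zN (\sum_(j < m) b j *: 'X^j) <= C2 * p (lincomb m b w)].
Proof.
move=> hz t0; have tp : 0 < `|t| by rewrite normr_gt0.
have N11 : 0 <= N 1 by exact: N10.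
pose C1 := (5 * B + 12 * N 1 + 4 * `|t| + 4 * (2 + N 1)) * K + `|t|.
pose C2 := (16 * zN 1 + 8 * K * (2 + N 1)) * K.
have C10 : 0 < C1.
  by rewrite /C1 ltr_wpDl// mulr_ge0 ?ltW// ; have := B0; have := tp; lra.
have t20 : 0 < `|t| / 2 by rewrite divr_gt0.
have h20 : 0 < 2^-1 :> R by rewrite invr_gt0.
have [eta [eta0 eta1 eta2 eta3]] := small_factor C2 (`|t|^-1 * C1 * C2 * (4 * K / `|t|)) t20 h20.
have eta3' : `|t|^-1 * C1 * (C2 * eta) * (4 * K / `|t|) <= 2^-1.
  by apply: le_trans eta3; rewrite le_eqVlt; apply/orP; left; apply/eqP; ring.
have [L0 hL0] := exp2V_small eta0.
have epsp j : 0 < eta * 2 ^- j :> R by rewrite mulr_gt0 ?exp2V_gt0.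
have [l [c [l0 hl hc hd hu]]] :=
  small_block_selection sp hN hphi hB n_incr hr hsg ht block_splitting_weakly_cvg L0 epsp.
have hl0 : 2 ^- l 0%N <= eta by rewrite l0 hL0.
exists (cblock l c (x \o iota)), C1, (4 * K / `|t|); split.
- exact: cblock_convex_block_sequence.
- exact: (homogeneous_complemented hp hbasis hN K0 hK hB n_incr hr hsg ht hx eta0 hl
    hc hl0 hd hu hz).
- by split => //; rewrite divr_gt0 ?mulr_gt0.
- move=> m b; exact: (homogeneous_upper hp hN K0 hK hB n_incr hsg ht hx hl hc hl0 hd hu hz).
- move=> m b; exact: (homogeneous_lower hp hbasis hN K0 hK n_incr hr hsg ht hx eta0 hl hc hl0 hz).
Qed.

Lemma summing_case (delta : R) : t = 0 -> 0 < delta ->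
  (forall k, delta <= N (Y (n k.+1) - Y (n k))) ->
  exists w, [/\ convex_block_sequence x w, complemented (closed_span w) &
    equiv_summing_basis w].
Proof.
move=> t0 d0 hgap; have N11 : 0 <= N 1 by exact: N10.
pose C1 := 5 * B + 12 * N 1 + 4 * (2 + N 1).
pose C2 := 2 * K / delta.
have C10 : 0 < C1 by rewrite /C1; have := B0; lra.
have C20 : 0 < C2 by rewrite /C2 divr_gt0 ?mulr_gt0.
have h20 : 0 < 2^-1 :> R by rewrite invr_gt0.
have [eta [eta0 eta1 eta3 eta4]] :=
  small_factor (C1 * (C2 * (4 * (2 + N 1))) * (2 * C2)) (C2 * (4 * (2 + N 1))) h20 h20.
have eta3' : C1 * (C2 * (4 * eta * (2 + N 1))) * (2 * C2) <= 2^-1.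
  by apply: le_trans eta3; rewrite le_eqVlt; apply/orP; left; apply/eqP; ring.
have eta4' : C2 * (4 * eta * (2 + N 1)) <= 2^-1.
  by apply: le_trans eta4; rewrite le_eqVlt; apply/orP; left; apply/eqP; ring.
have [L0 hL0] := exp2V_small eta0.
have epsp j : 0 < eta * 2 ^- j :> R by rewrite mulr_gt0 ?exp2V_gt0.
(* The start [L0.+1] makes [l 0] positive, as the gaps before the blocks require. *)
have [l [c [l0 hl hc hd hu]]] :=
  small_block_selection sp hN hphi hB n_incr hr hsg ht block_splitting_weakly_cvg L0.+1 epsp.
have hl0 : 2 ^- l 0%N <= eta by rewrite l0 hL0.
have l00 : (0 < l 0)%N by rewrite l0.
exists (cblock l c (x \o iota)); split.
- exact: cblock_convex_block_sequence.
- exact: (summing_complemented hp hbasis hN K0 hK hB n_incr hsg ht hx eta0 hl hc hl0 hd d0 hgap).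
- apply: (norm_seq_equiv_for hp C10 (C2 := 2 * C2)); first by rewrite mulr_gt0.
    by move=> m b; apply: (summing_upper hp hN hB n_incr hsg ht hx hl hc hl0 hd) => // i im;
      exact: c0n_tails.
  move=> m b; exact: (summing_lower hp hbasis hN K0 hK n_incr ht hx eta0 hl hc hl0 hd
    d0 hgap t0 l00 eta1 eta4').
Qed.

(** Far convex combinations of the subsequence come close to [y] in norm, while [f] on them is close
    to its limit along [x]; so [f y] is that limit. *)
Lemma weak_limit_of_partials (y : X) : t = 0 ->
  (fun k => ev e (Y (n k))) @ \oo --> y -> weakly_cvg x y.
Proof.
move=> t0 Yy f fc.
have [D D0 fD] : exists2 D, 0 < D & forall u, `|f u| <= D * p u.
  have /linear_boundedP/pinfty_ex_gt0[M M0 fM] := (linear_bounded_continuous f).2 fc.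
  have [_ _ [c [C [c0 C0 cC]]]] := hp; exists (M / c) => [|u]; first by rewrite divr_gt0.
  rewrite (le_trans (fM u))// -mulrA (ler_wpM2l (ltW M0))// [c^-1 * _]mulrC ler_pdivlMr// mulrC.
  by have /andP[] := cC u.
have [l fl] : exists l : R^o, (f \o x) @ \oo --> l by exact: (cvg_ex _).1 (wx fc).
suff -> : f y = l by [].
have N11 : 0 <= N 1 by exact: N10.
apply/eqP; rewrite -subr_eq0 -normr_le0; apply/ler_addgt0Pl => eps0 eps00; rewrite addr0.
(* The distance to [y] collects three errors [eps] and one [N 1 * eps] from the sums of the [r k];
   the final 1 is for [f u - l]. *)
pose eps := eps0 / (D * (3 + N 1) + 1).
have den0 : 0 < D * (3 + N 1) + 1 by have := mulr_gt0 D0 (ltr_wpDr N11 (ltr0n R 3)); lra.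
have ep : 0 < eps by rewrite divr_gt0.
have [k1 hk1] := functional_cvg_subseq (ltW D0) fD fl ep.
have [k2 hk2] := exp2V_small ep.
have [k3 hk3] := (pcvgP hp _ _).1 Yy _ ep.
have [k4 [c [k04 c0 c1 hc]]] := small_convex_combination sp hN hphi hB n_incr hr hsg ht
  block_splitting_weakly_cvg (maxn k1 (maxn k2 k3)) ep.
set k0 := maxn k1 _ in k04 c1 hc.
have avg_le (g : nat -> R) b : (forall k, (k0 <= k)%N -> g k <= b) ->
    \sum_(k0 <= k < k4) c k * g k <= b.
  move=> gb; rewrite -[leRHS]mul1r -c1 mulr_suml !big_nat; apply: ler_sum => k /andP[kk _].
  by rewrite ler_wpM2l// gb.
have avgE (g : nat -> X) u : \sum_(k0 <= k < k4) c k *: (g k - u) =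
    \sum_(k0 <= k < k4) c k *: g k - u.
  under eq_bigr do rewrite scalerBr.
  by rewrite sumrB -scaler_suml c1 scale1r.
have semi_avg (g : nat -> X) b : (forall k, (k0 <= k)%N -> p (g k) <= b) ->
    p (\sum_(k0 <= k < k4) c k *: g k) <= b.
  move=> gb; apply: le_trans (avg_le (p \o g) b gb); apply: (semi_sum_le sp) => k _.
  by rewrite (semiZ sp) ger0_norm.
have kk0 k : (k0 <= k)%N -> [/\ (k1 <= k)%N, (k2 <= k)%N & (k3 <= k)%N].
  by rewrite !geq_max => /and3P[].
pose u := \sum_(k0 <= k < k4) c k *: x (iota k).
have uy : p (u - y) <= (3 + N 1) * eps.
  have -> : u - y = (\sum_(k0 <= k < k4) c k *: (x (iota k) - ev e (Y (n k) + 'X^(n k) * r k)))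
      + (\sum_(k0 <= k < k4) c k *: (ev e (Y (n k)) - y))
      + ev e (\sum_(k0 <= k < k4) c k *: ('X^(n k) * zero_sum_part r k))
      + \sum_(k0 <= k < k4) c k *: ev e ('X^(n k) * (r k).[1]%:P).
    rewrite -avgE [ev e (\sum_(_ <= _ < _) _)]linear_sum -!big_split/=; apply: eq_bigr => k _.
    rewrite [ev e (c k *: _)]linearZ/= -!scalerDr; congr (_ *: _).
    have -> : ev e (Y (n k) + 'X^(n k) * r k) = ev e (Y (n k)) +
        ev e ('X^(n k) * zero_sum_part r k) + ev e ('X^(n k) * (r k).[1]%:P).
      by rewrite -!raddfD -addrA -mulrDr subrK.
    set s1 := ev e (Y _); set s2 := ev e _; set s3 := ev e _.
    rewrite -2!(addrA (x (iota k) - (s1 + s2 + s3))) (addrAC s1 (- y)) (addrAC (s1 + s2)).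
    by rewrite addrA subrK.
  have -> : (3 + N 1) * eps = eps + eps + eps + N 1 * eps by ring.
  have pD v1 v2 b1 b2 : p v1 <= b1 -> p v2 <= b2 -> p (v1 + v2) <= b1 + b2.
    by move=> ? ?; rewrite (le_trans (semiD sp _ _)) ?lerD.
  apply: (pD); [apply: (pD) => //; apply: (pD); apply: (semi_avg)|apply: (semi_avg)].
  - by move=> k /kk0[_ h _]; rewrite (le_trans (hx k))// hk2.
  - by move=> k /kk0[_ _ h]; rewrite hk3.
  - move=> k /kk0[_ h _]; rewrite mulrC mul_polyC [ev e (_ *: _)]linearZ/= (semiZ sp).
    rewrite -/(N 'X^(n k)) (spX hN) mulrC ler_wpM2l// (le_trans _ (hk2 k h))//.
    by have := ht k; rewrite t0 subr0.
have ful : `|f u - l| <= eps.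
  have -> : f u - l = \sum_(k0 <= k < k4) c k * (f (x (iota k)) - l).
    under [RHS]eq_bigr do rewrite mulrBr.
    by rewrite sumrB -mulr_suml c1 mul1r /u linear_sum; under eq_bigr do rewrite linearZ/=.
  rewrite (le_trans (ler_norm_sum _ _ _))//; under eq_bigr do rewrite normrM ger0_norm//.
  by apply: (avg_le (fun k => `|f (x (iota k)) - l|)) => k /kk0[h _ _]; exact: hk1.
have -> : f y - l = (f u - l) - f (u - y) by rewrite linearB/=; ring.
rewrite (le_trans (ler_normB _ _))// (le_trans (lerD ful (fD _)))//.
rewrite (le_trans (lerD (lexx _) (ler_wpM2l (ltW D0) uy)))//.
have -> : eps0 = eps * (D * (3 + N 1) + 1) by rewrite divfK// gt_eqF.
by rewrite le_eqVlt; apply/orP; left; apply/eqP; ring.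
Qed.

End BlockSplitting.

(** Failure of the Cauchy criterion gives, after every index, a later one at distance at least
    [delta]. Iterating this choice produces a subsequence with uniform consecutive gaps. *)
Lemma summing_or_weakly_cvg iota n r sg B : block_splitting hp hbasis K0 hK wx iota n r sg 0 ->
  0 < B -> (forall m, N (Y m) <= B) ->
  (exists w, [/\ convex_block_sequence x w, complemented (closed_span w) &
     equiv_summing_basis w]) \/ exists y, weakly_cvg x y.
Proof.
move=> hsplit B0 hB.
have [[delta d0 gap]|nogap] := pselect (exists2 delta, 0 < delta &
    forall k, exists m, (k < m)%N /\ delta <= N (Y (n m) - Y (n k))).
  left; have [M hM] := choice gap; pose phi k := iter k M 0%N.
  have phi_incr k : (phi k < phi k.+1)%N by have [] := hM (phi k).
  apply: (summing_case (block_splitting_subseq phi_incr hsplit) B0 hB (erefl 0) d0) => k.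
  by have [] := hM (phi k).
right; exists (lim ((fun k => ev e (Y (n k))) @ \oo)).
apply: (weak_limit_of_partials hsplit hB (erefl 0)); apply: (pcauchy_cvg hp) => eps eps0.
apply: contrapT => H; apply: nogap; exists eps => // k; apply: contrapT => Hk; apply: H.
exists k => m; rewrite leq_eqVlt => /predU1P[<-|km]; first by rewrite subrr (semi0 sp) ltW.
rewrite leNgt -raddfB -/(N _); apply/negP => lt; apply: Hk; exists m; split => //.
exact: ltW.
Qed.

End Dichotomy.

Lemma spreading_seminorm_ev (R : realType) (X : completeNormedModType R)
    (p : X -> R) (e : nat -> X) :
  equivalent_norm p -> one_spreading_for p e -> spreading_seminorm (fun q => p (ev e q)).
Proof.
move=> hp hs; have [pD pZ] := equivalent_norm_seminorm hp; split; last first.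
  by move=> phi hphi q; rewrite ev_spread /ev -(hs phi hphi).
by split=> [u v|s u]; rewrite ?raddfD ?linearZ/=.
Qed.

Theorem theorem5 (R : realType) (X : completeNormedModType R) (e : nat -> X)
    (he : conditional_spreading_basis e)
    (Z : completeNormedModType R) (z : nat -> Z)
    (hz : convex_block_homogeneous_part e z)
    (x : nat -> X) (hx : nontrivial_weak_cauchy x) :
  exists w : nat -> X,
    convex_block_sequence x w /\
    (equiv_summing_basis w \/ seq_equiv w z) /\
    complemented (closed_span w).
Proof.
have [hbasis _ hcond] := he; have [_ [p [hp hspread hlim]]] := hz; have [wx nx] := hx.
(* The homogeneous seminorm is read off the norm of [Z]; the limit defining it is the assumption on
   [z]. *)
pose zN (q : {poly R}) := `|ev z q|.
have hN := spreading_seminorm_ev hp hspread.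
have hzN q eps : 0 < eps ->
    exists M0, forall M, (M0 <= M)%N -> `|p (ev e (blow M q)) - zN q| <= eps.
  move=> eps0; have /(@cvg_epsP R R^o)/(_ _ eps0)[M0 hM0] := hlim (size q) (fun i => q`_i).
  by exists M0 => M MM; rewrite ev_blow; exact: hM0.
have [K K0 hK] := prefix_bounds hp hbasis hcond hN hzN.
have hphi := diff_avg_small hp hbasis hcond hN.
have [B B0 [_ hB _]] := limit_partial_bound hp hbasis hN K0 hK wx.
have [iota [n [r [sg [t hsplit]]]]] := block_splitting_exists hp hbasis hN K0 hK wx.
have [t0|t0] := eqVneq t 0.
  move: hsplit; rewrite t0 => hsplit.
  have [[w [hw cw ew]]|//] := summing_or_weakly_cvg hN hphi hsplit B0 hB.
  by exists w; split => //; split => //; left.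
have [w [C1 [C2 [hw cw [C10 C20] upper lower]]]] := homogeneous_case hN hphi hsplit B0 hB hzN t0.
exists w; split => //; split => //; right.
have zE m (b : nat -> R) : zN (\sum_(j < m) b j *: 'X^j) = `|lincomb m b z|.
  by rewrite /zN ev_sum.
by apply: (norm_seq_equiv_for hp C10 C20) => m b; rewrite -zE; [exact: upper|exact: lower].
Qed.
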